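(* Let $S$ be a self-adjoint restriction of $T_{\max}$ with separated boundary conditions. Let $\phi_z$, $z\in\mathbb C\setminus\{0\}$, be non-trivial solutions of $(\tau-z)u=0$ such that $\phi_z$ lies in $S$ near $a$ and, for each $c\in(a,b)$, $z\mapsto\phi_z(c)$ and $z\mapsto\phi_z^{[1]}(c)$ are real analytic in $\mathbb C\setminus\{0\}$ with at most poles at zero. Let $\theta_z$, $z\in\mathbb C\setminus\{0\}$, be solutions of $(\tau-z)u=0$ with $V(\theta_z,\phi_z)=1$ such that $z\mapsto\theta_z(c)$ and $z\mapsto\theta_z^{[1]}(c)$ are real analytic in $\mathbb C\setminus\{0\}$ with at most poles at zero. Define $M:\rho(S)\setminus\{0\}\to\mathbb C$ by requiring that $\psi_z=\theta_z+M(z)\phi_z$ lies in $S$ near $b$; this determines $M(z)$ uniquely. Then $M$ is analytic on $\rho(S)\setminus\{0\}$ and $M(z)=M(z^\ast)^\ast$ for all $z\in\rho(S)\setminus\{0\}$.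
   Context: Let $-\infty\le a<b\le\infty$ and let $\varrho,\varsigma,\chi$ be complex Borel measures on $(a,b)$, finite on compact subintervals, such that $\varrho$ is real-valued, $\varsigma$ is positive with support all of $(a,b)$, $\chi$ is positive and not identically zero, and $\varsigma(\{x\})\chi(\{x\})=\varsigma(\{x\})\varrho(\{x\})=0$ for all $x$. For such a measure $\mu$ write $\int_c^x h\,d\mu=\int_{[c,x)}h\,d\mu$ if $x>c$, $0$ if $x=c$, and $-\int_{[x,c)}h\,d\mu$ if $x<c$. $AC_{\mathrm{loc}}((a,b);\mu)$ is the set of functions $f(x)=f(c)+\int_c^xh\,d\mu$ with $h\in L^1_{\mathrm{loc}}(\mu)$, and $df/d\mu=h$. $\mathfrak D_\tau$ is the set of $f\in AC_{\mathrm{loc}}((a,b);\varsigma)$ for which $x\mapsto-\frac{df}{d\varsigma}(x)+\int_c^xf\,d\chi$ has a (unique) representative in $AC_{\mathrm{loc}}((a,b);\varrho)$. For such $f$, $\tau f$ is its Radon–Nikodym derivative with respect to $\varrho$, and $f^{[1]}=df/d\varsigma$. A solution of $(\tau-z)u=0$ is some $u\in\mathfrak D_\tau$ with $\tau u=zu$, identified with the pair $(u,zu)$. Set $V(f,g)(x)=f_\tau g^{[1]}-f^{[1]}g_\tau$ for pairs $(f,f_\tau)$ with $\tau f=f_\tau$; it is constant for two solutions of the same equation. $H^1(a,b)$ is the Hilbert space of $f\in AC_{\mathrm{loc}}((a,b);\varsigma)$ with $f\in L^2(\chi)$ and $f^{[1]}\in L^2(\varsigma)$, with inner product $\int fg^\ast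 d\chi+\int f^{[1]}(g^{[1]})^\ast d\varsigma$. ''In $H^1$ near an endpoint'' means the integrals are finite over a neighbourhood of it. $T_{\max}$ is the set of pairs $(f,f_\tau)$ with $\tau f=f_\tau$ and $f,f_\tau\in H^1(a,b)$. A pair lies in $T_{\max}$ near an endpoint if both components lie in $H^1$ near it; then $V(f,g)(a)=\lim_{x\to a}V(f,g)(x)$ and $V(f,g)(b)$ exist. $\tau$ is l.c. at an endpoint if for all $z\ne0$ all solutions of $(\tau-z)u=0$ lie in $H^1$ near it, and l.p. otherwise. $S=\{f\in T_{\max}:V(f,v_a^\ast)(a)=V(f,v_b^\ast)(b)=0\}$, where $v_a\in T_{\max}$ satisfies $V(v_a,v_a^\ast)(a)=0$ and $V(f,v_a^\ast)(a)\ne0$ for some $f\in T_{\max}$ if $\tau$ is l.c. at $a$ (analogously $v_b$). A pair lies in $S$ near $a$ (resp. $b$) if it lies in $T_{\max}$ near $a$ and, in the l.c. case there, satisfies $V(f,v_a^\ast)(a)=0$ (resp. $V(f,v_b^\ast)(b)=0$). $\rho(S)$ is the resolvent set of $S$. Real analytic on $\mathbb C\setminus\{0\}$ means analytic with $F(z^\ast)=F(z)^\ast$. *)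

(* Defs.v *)
(* MathComp + MathComp-Analysis (R : realType, complex numbers R[i]
   from mathcomp-real-closed, equipped with its numFieldType topology). *)
From HB Require Import structures.
From mathcomp Require Import all_boot all_order all_algebra.
From mathcomp Require Export complex.
From mathcomp Require Export all_classical all_reals all_analysis.
Export Order.TTheory GRing.Theory Num.Theory.
Export numFieldNormedType.Exports.

Set Implicit Arguments.
Unset Strict Implicit.
Unset Printing Implicit Defensive.

Local Open Scope ring_scope.
Local Open Scope classical_set_scope.

(* Complex numbers                                                      *)
Definition Cx (R : realType) : numClosedFieldType := R[i].

Definition RtoC {R : realType} (x : R) : Cx R := (x%:C)%C.
Definition iC {R : realType} : Cx R := ('i)%C.
Definition cconj {R : realType} (z : Cx R) : Cx R := (z^*)%C.
Definition ReC {R : realType} (z : Cx R) : R := @complex.Re R z.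
Definition ImC {R : realType} (z : Cx R) : R := @complex.Im R z.
(* |z|^2 *)
Definition cnorm2 {R : realType} (z : Cx R) : R := ReC z ^+ 2 + ImC z ^+ 2.

(* The data: endpoints -oo <= a < b <= +oo, and the measures.           *)
(* All measures are Borel measures on R; only their restriction to      *)
(* (a,b) is ever used.  The real (signed) measure rho is given by its    *)
(* Jordan decomposition rho = rho_p - rho_n (see sl_hyp).               *)
Record sldata (R : realType) := SLdata {
  sl_a : \bar R;
  sl_b : \bar R;
  rho_p : {measure set R -> \bar R};
  rho_n : {measure set R -> \bar R};
  sigma : {measure set R -> \bar R};
  chi : {measure set R -> \bar R}
}.

Section SL.
Context {R : realType} (D : sldata R).
Local Notation C := (Cx R).
Local Notation a := (sl_a D).
Local Notation b := (sl_b D).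

(* the open interval (a,b) *)
Definition Iab : set R := [set x | (a < x%:E)%E /\ (x%:E < b)%E].
(* neighbourhoods (a,c) and (c,b) of the endpoints *)
Definition Iac (c : R) : set R := [set x | (a < x%:E)%E /\ x < c].
Definition Icb (c : R) : set R := [set x | c < x /\ (x%:E < b)%E].

(* filters "x -> a+" and "x -> b-" on R *)
Definition near_a : set_system R :=
  match a with r%:E => r^'+ | -oo%E => -oo | +oo%E => +oo end.
Definition near_b : set_system R :=
  match b with r%:E => r^'- | +oo%E => +oo | -oo%E => -oo end.

(* Standing hypotheses on the data *)
Definition sl_hyp : Prop :=
  [/\ (a < b)%E,
      (* finite on compact subintervals *)
      (forall x y, Iab x -> Iab y ->
         [/\ (rho_p D `[x, y]%classic < +oo)%E, (rho_n D `[x, y]%classic < +oo)%E,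
             (sigma D `[x, y]%classic < +oo)%E & (chi D `[x, y]%classic < +oo)%E]),
      (* rho_p, rho_n mutually singular: rho = rho_p - rho_n is the Jordan
         decomposition of the real measure rho *)
      (exists P, measurable P /\ rho_n D P = 0%E /\ rho_p D (~` P) = 0%E),
      (* supp sigma = (a,b) *)
      (forall x y, Iab x -> Iab y -> x < y -> (0 < sigma D `]x, y[%classic)%E) /\
      (* chi is not identically zero on (a,b) *)
      (chi D Iab <> 0%E) &
      (* sigma({x}) chi({x}) = sigma({x}) rho({x}) = 0 *)
      (forall x, Iab x ->
         (sigma D [set x] = 0%E \/ chi D [set x] = 0%E) /\
         (sigma D [set x] = 0%E \/ rho_p D [set x] = rho_n D [set x]))].

(* ---------------- complex integration ---------------- *)
Definition cintegrable (mu : {measure set R -> \bar R}) (A : set R)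
  (h : R -> C) : Prop :=
  mu.-integrable A (fun t => (ReC (h t))%:E) /\
  mu.-integrable A (fun t => (ImC (h t))%:E).

Definition cint (mu : {measure set R -> \bar R}) (A : set R) (h : R -> C) : C :=
  RtoC (Rintegral mu A (fun t => ReC (h t))) +
  iC * RtoC (Rintegral mu A (fun t => ImC (h t))).

(* \int_c^x h dmu, with the convention of the paper *)
Definition sint (mu : {measure set R -> \bar R}) (c x : R) (h : R -> C) : C :=
  if c < x then cint mu `[c, x[%classic h
  else if x == c then 0 else - cint mu `[x, c[%classic h.

(* integrals with respect to rho = rho_p - rho_n *)
Definition sint_rho (c x : R) (h : R -> C) : C :=
  sint (rho_p D) c x h - sint (rho_n D) c x h.

(* L^1_loc((a,b); mu) *)
Definition L1loc (mu : {measure set R -> \bar R}) (h : R -> C) : Prop :=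
  forall x y, Iab x -> Iab y -> cintegrable mu `[x, y]%classic h.
Definition L1loc_rho (h : R -> C) : Prop :=
  L1loc (rho_p D) h /\ L1loc (rho_n D) h.

(* f in AC_loc((a,b); mu) with df/dmu = h *)
Definition isAC (mu : {measure set R -> \bar R}) (f h : R -> C) : Prop :=
  L1loc mu h /\
  exists c, Iab c /\ forall x, Iab x -> f x = f c + sint mu c x h.
Definition isAC_rho (f h : R -> C) : Prop :=
  L1loc_rho h /\
  exists c, Iab c /\ forall x, Iab x -> f x = f c + sint_rho c x h.

(* is_tau f f1 ft : f in D_tau, with quasi-derivative f^[1] = f1 (the
   representative of df/dsigma for which -f^[1] + \int f dchi is in
   AC_loc(rho)), and tau f = ft. *)
Definition is_tau (f f1 ft : R -> C) : Prop :=
  isAC (sigma D) f f1 /\ L1loc (chi D) f /\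
  exists c, Iab c /\
    isAC_rho (fun x => - f1 x + sint (chi D) c x f) ft.

(* u is a solution of (tau - z) u = 0, with quasi-derivative u1 *)
Definition is_sol (z : C) (u u1 : R -> C) : Prop :=
  is_tau u u1 (fun x => z * u x).

(* ---------------- the space H^1 ---------------- *)
Definition L2 (mu : {measure set R -> \bar R}) (A : set R) (h : R -> C) : Prop :=
  measurable_fun A (fun t => ReC (h t)) /\
  measurable_fun A (fun t => ImC (h t)) /\
  mu.-integrable A (fun t => (cnorm2 (h t))%:E).

(* f in H^1(a,b) with f^[1] = df/dsigma = f1 *)
Definition H1 (f f1 : R -> C) : Prop :=
  isAC (sigma D) f f1 /\ L2 (chi D) Iab f /\ L2 (sigma D) Iab f1.

(* squared H^1 norm *)
Definition H1norm2 (f f1 : R -> C) : R :=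
  Rintegral (chi D) Iab (fun t => cnorm2 (f t)) +
  Rintegral (sigma D) Iab (fun t => cnorm2 (f1 t)).

(* in H^1 near a / near b *)
Definition H1_near_a (f f1 : R -> C) : Prop :=
  isAC (sigma D) f f1 /\
  exists c, Iab c /\ L2 (chi D) (Iac c) f /\ L2 (sigma D) (Iac c) f1.
Definition H1_near_b (f f1 : R -> C) : Prop :=
  isAC (sigma D) f f1 /\
  exists c, Iab c /\ L2 (chi D) (Icb c) f /\ L2 (sigma D) (Icb c) f1.

(* (f, ft) in T_max, with f^[1] = f1 and ft^[1] = ft1 *)
Definition Tmax (f f1 ft ft1 : R -> C) : Prop :=
  is_tau f f1 ft /\ H1 f f1 /\ H1 ft ft1.

(* V(f,g)(x) = f_tau g^[1] - f^[1] g_tau *)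
Definition Vw (f1 ft g1 gt : R -> C) (x : R) : C :=
  ft x * g1 x - f1 x * gt x.
(* V(f, g^* ) where g^* = (g^*, g_tau^* ) (the measures are real, so
   (g^* )^[1] = (g^[1])^* ) *)
Definition Vc (f1 ft g1 gt : R -> C) : R -> C :=
  Vw f1 ft (fun x => cconj (g1 x)) (fun x => cconj (gt x)).

(* limit-circle at the endpoints *)
Definition lc_a : Prop :=
  forall (z : C) (u u1 : R -> C), z != 0 -> is_sol z u u1 -> H1_near_a u u1.
Definition lc_b : Prop :=
  forall (z : C) (u u1 : R -> C), z != 0 -> is_sol z u u1 -> H1_near_b u u1.

(* Boundary functions v_a = (va, vat) (with va^[1] = va1, vat^[1] = vat1),
   required when tau is l.c. at a; analogously at b. *)
Definition bfun_a (va va1 vat vat1 : R -> C) : Prop :=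
  lc_a ->
  [/\ Tmax va va1 vat vat1,
      Vc va1 vat va1 vat @ near_a --> (0 : C) &
      exists f f1 ft ft1, Tmax f f1 ft ft1 /\
        ~ (Vc f1 ft va1 vat @ near_a --> (0 : C))].
Definition bfun_b (vb vb1 vbt vbt1 : R -> C) : Prop :=
  lc_b ->
  [/\ Tmax vb vb1 vbt vbt1,
      Vc vb1 vbt vb1 vbt @ near_b --> (0 : C) &
      exists f f1 ft ft1, Tmax f f1 ft ft1 /\
        ~ (Vc f1 ft vb1 vbt @ near_b --> (0 : C))].

Section S.
Variables (va1 vat vb1 vbt : R -> C).

(* (f, ft) in S, with derivatives f1, ft1 *)
Definition inS (f f1 ft ft1 : R -> C) : Prop :=
  [/\ Tmax f f1 ft ft1,
      (lc_a -> Vc f1 ft va1 vat @ near_a --> (0 : C)) &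
      (lc_b -> Vc f1 ft vb1 vbt @ near_b --> (0 : C))].

(* resolvent set of the linear relation S in H^1(a,b):
   (S - z)^{-1} is an everywhere defined bounded operator on H^1 *)
Definition resolvent (z : C) : Prop :=
  [/\ (* everywhere defined *)
      (forall h h1, H1 h h1 ->
         exists f f1 ft ft1, inS f f1 ft ft1 /\
           forall x, Iab x -> ft x - z * f x = h x),
      (* single valued: ker (S - z) = {0} *)
      (forall f f1 ft ft1, inS f f1 ft ft1 ->
         (forall x, Iab x -> ft x = z * f x) -> forall x, Iab x -> f x = 0) &
      (* bounded *)
      (exists K : R, forall f f1 ft ft1, inS f f1 ft ft1 ->
         H1norm2 f f1 <=
         K * H1norm2 (fun x => ft x - z * f x) (fun x => ft1 x - z * f1 x))].

(* solution (u, z u) lies in S near a / near b *)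
Definition sol_in_S_near_a (z : C) (u u1 : R -> C) : Prop :=
  [/\ H1_near_a u u1,
      H1_near_a (fun x => z * u x) (fun x => z * u1 x) &
      (lc_a -> Vc u1 (fun x => z * u x) va1 vat @ near_a --> (0 : C))].
Definition sol_in_S_near_b (z : C) (u u1 : R -> C) : Prop :=
  [/\ H1_near_b u u1,
      H1_near_b (fun x => z * u x) (fun x => z * u1 x) &
      (lc_b -> Vc u1 (fun x => z * u x) vb1 vbt @ near_b --> (0 : C))].
End S.
End SL.

(* ---------------- analyticity ---------------- *)
(* F is analytic (holomorphic) at every point of the open set C \ {0},
   real (F(z^* ) = F(z)^* ), and has at most a pole at 0 *)
Definition real_analytic_pole0 {R : realType} (F : Cx R -> Cx R) : Prop :=
  [/\ (forall z : Cx R, z != 0 -> derivable F z 1),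
      (forall z : Cx R, z != 0 -> F (cconj z) = cconj (F z)) &
      (exists (n : nat) (r : R) (G : Cx R -> Cx R), 0 < r /\
         (forall z, ball (0 : Cx R) (RtoC r) z -> derivable G z 1) /\
         (forall z, ball (0 : Cx R) (RtoC r) z -> z != 0 -> G z = z ^+ n * F z))].

(* Main.v *)
Require Import Defs.
From mathcomp Require Import finmap.
From mathcomp Require Import all_boot all_order all_algebra.
From mathcomp Require Import complex all_classical all_reals all_analysis.
From mathcomp Require Import measurable_realfun ring lra.
Import Order.TTheory GRing.Theory Num.Theory.
Import numFieldNormedType.Exports.
Set Implicit Arguments.
Unset Strict Implicit.
Unset Printing Implicit Defensive.
Local Open Scope ring_scope.
Local Open Scope classical_set_scope.

(* Fix z0 and let h be psi_{z0} cut off to the left of a point c.  Then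
   u_z = psi_{z0} + (z - z0) (S - z)^-1 h solves (tau - z) u = 0 on [c, b) and is
   in S near b, whence, with Wronskians at c,
     M(z) = - W(u_z, theta_z) / W(u_z, phi_z).
   Since (S - z)^-1 h is continuous in z at z0 and point evaluations are bounded on H^1,
   this quotient is differentiable at z0.  Uniqueness of M(z) is injectivity of S - z, and
   M(z^* ) = M(z)^* follows because S is invariant under conjugation.  Existence is
   elementary if tau is l.c. at b.  Otherwise, the absence of a z-solution in H^1 near b
   would make phi_z a solution for every spectral parameter, proportional to the
   solution in H^1 near b which Weyl's disc argument provides for the parameter i. *)

(** * Complex numbers *)

(** The resolvent of [S] acts on H^1, and [psi_{z0}] need not lie in H^1 near [a]; hence the
    cut-off. It need not belong to the domain of [tau]: an element of H^1 is all that [(S - z)^-1]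
    asks for. The factor [z - z0] in [u_z] is what lets mere continuity of the resolvent yield
    differentiability at [z0].

    The delicate point is existence outside the l.c. case at [b]. Applying [(S - z)^-1] to functions
    supported away from [b] does produce solutions in H^1 near [b], but all of them may vanish
    there, since [rho] may be degenerate, even zero. This forces the detour through the parameter
    [i], where Green's identity turns the H^1 norm into a flux and needs nothing from [rho].

    No initial value problem is solved: every fundamental system, including the one at [i], consists
    of [theta_z] and [phi_z], and other solutions are expanded in it by Cramer's rule.

    The measures may have atoms, so functions and quasi-derivatives may jump. Half-open intervals,
    together with [sigma] sharing no atom with [chi] or [rho], keep integration by parts free of
    jump terms. *)

Section ComplexParts.
Context {R : realType}.
Implicit Types z w : Cx R.

Lemma ReCD z w : ReC (z + w) = ReC z + ReC w.
Proof. by case: z w => [? ?] [? ?]. Qed.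
Lemma ImCD z w : ImC (z + w) = ImC z + ImC w.
Proof. by case: z w => [? ?] [? ?]. Qed.
Lemma ReCN z : ReC (- z) = - ReC z.
Proof. by case: z. Qed.
Lemma ImCN z : ImC (- z) = - ImC z.
Proof. by case: z. Qed.
Lemma ReCM z w : ReC (z * w) = ReC z * ReC w - ImC z * ImC w.
Proof. by case: z w => [? ?] [? ?]. Qed.
Lemma ImCM z w : ImC (z * w) = ReC z * ImC w + ImC z * ReC w.
Proof. by case: z w => [? ?] [? ?]. Qed.
Lemma ReC_conj z : ReC (cconj z) = ReC z.
Proof. by case: z. Qed.
Lemma ImC_conj z : ImC (cconj z) = - ImC z.
Proof. by case: z. Qed.
Lemma ReC0 : ReC (0 : Cx R) = 0. Proof. by []. Qed.
Lemma ImC0 : ImC (0 : Cx R) = 0. Proof. by []. Qed.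
Lemma ReC1 : ReC (1 : Cx R) = 1. Proof. by []. Qed.
Lemma ImC1 : ImC (1 : Cx R) = 0. Proof. by []. Qed.
Lemma ReC_RtoC (x : R) : ReC (RtoC x) = x. Proof. by []. Qed.
Lemma ImC_RtoC (x : R) : ImC (RtoC x) = 0. Proof. by []. Qed.
Lemma ReC_i : ReC (iC : Cx R) = 0. Proof. by []. Qed.
Lemma ImC_i : ImC (iC : Cx R) = 1. Proof. by []. Qed.

Lemma eqCx z w : ReC z = ReC w -> ImC z = ImC w -> z = w.
Proof. by case: z w => [? ?] [? ?] /= -> ->. Qed.

(** Rewriting with it reduces an identity in [Cx R] to two real ones within reach of [ring] and
    [lra]. *)
Definition reimE := (ReCD, ImCD, ReCN, ImCN, ReCM, ImCM, ReC_conj, ImC_conj,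
  ReC_RtoC, ImC_RtoC, ReC_i, ImC_i, ReC0, ImC0, ReC1, ImC1).

Lemma cconjD z w : cconj (z + w) = cconj z + cconj w.
Proof. by apply: eqCx; rewrite !reimE; ring. Qed.
Lemma cconjN z : cconj (- z) = - cconj z.
Proof. by apply: eqCx; rewrite !reimE; ring. Qed.
Lemma cconjB z w : cconj (z - w) = cconj z - cconj w.
Proof. by rewrite cconjD cconjN. Qed.
Lemma cconjM z w : cconj (z * w) = cconj z * cconj w.
Proof. by apply: eqCx; rewrite !reimE; ring. Qed.
Lemma cconjK z : cconj (cconj z) = z.
Proof. by apply: eqCx; rewrite !reimE; ring. Qed.
Lemma cconj0 : cconj (0 : Cx R) = 0.
Proof. by apply: eqCx; rewrite !reimE; ring. Qed.
Lemma cconj_eq0 z : (cconj z == 0) = (z == 0).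
Proof.
apply/eqP/eqP => [h|->]; last exact: cconj0.
by rewrite -(cconjK z) h cconj0.
Qed.

(** The norm of [Cx R] takes its values in [Cx R]; estimates are carried out with this real-valued
    modulus. *)
Definition nrm z : R := Num.sqrt (cnorm2 z).

Lemma nrmE z : `|z| = RtoC (nrm z).
Proof. exact: (normc_def z). Qed.

Lemma RtoC_le (x y : R) : (RtoC x <= RtoC y) = (x <= y).
Proof. by rewrite /RtoC lecR. Qed.
Lemma RtoC_lt (x y : R) : (RtoC x < RtoC y) = (x < y).
Proof. by rewrite /RtoC ltcR. Qed.

Lemma cnorm2_ge0 z : 0 <= cnorm2 z.
Proof. by rewrite addr_ge0 ?sqr_ge0. Qed.
Lemma nrm_ge0 z : 0 <= nrm z. Proof. exact: sqrtr_ge0. Qed.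
Lemma sqr_nrm z : nrm z ^+ 2 = cnorm2 z.
Proof. by rewrite sqr_sqrtr ?cnorm2_ge0. Qed.
Lemma RtoCD (x y : R) : RtoC (x + y) = RtoC x + RtoC y.
Proof. by apply: eqCx; rewrite !reimE; ring. Qed.
Lemma RtoCM (x y : R) : RtoC (x * y) = RtoC x * RtoC y.
Proof. by apply: eqCx; rewrite !reimE; ring. Qed.
Lemma RtoC_inj : injective (@RtoC R).
Proof. by move=> x y /(congr1 ReC); rewrite !reimE. Qed.

Lemma le_nrmD z w : nrm (z + w) <= nrm z + nrm w.
Proof. by rewrite -RtoC_le RtoCD -!nrmE ler_normD. Qed.
Lemma nrmM z w : nrm (z * w) = nrm z * nrm w.
Proof. by apply: RtoC_inj; rewrite RtoCM -!nrmE normrM. Qed.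
Lemma nrmN z : nrm (- z) = nrm z.
Proof. by apply: RtoC_inj; rewrite -!nrmE normrN. Qed.
Lemma nrm0 : nrm (0 : Cx R) = 0.
Proof. by apply: RtoC_inj; rewrite -!nrmE normr0; apply: eqCx; rewrite !reimE. Qed.
Lemma nrm_eq0 z : (nrm z == 0) = (z == 0).
Proof.
apply/eqP/eqP => [h|->]; last exact: nrm0.
by apply/eqP; rewrite -normr_eq0 nrmE h; apply/eqP/eqCx; rewrite !reimE.
Qed.
Lemma nrm_conj z : nrm (cconj z) = nrm z.
Proof. by rewrite /nrm /cnorm2 !reimE sqrrN. Qed.
Lemma cnorm2M z w : cnorm2 (z * w) = cnorm2 z * cnorm2 w.
Proof. by rewrite /cnorm2 !reimE; ring. Qed.
Lemma cnorm2N z : cnorm2 (- z) = cnorm2 z.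
Proof. by rewrite /cnorm2 !reimE; ring. Qed.
Lemma cnorm2_conj z : cnorm2 (cconj z) = cnorm2 z.
Proof. by rewrite /cnorm2 !reimE; ring. Qed.
Lemma cnorm20 : cnorm2 (0 : Cx R) = 0.
Proof. by rewrite /cnorm2 !reimE; ring. Qed.
Lemma cnorm2_eq0 z : (cnorm2 z == 0) = (z == 0).
Proof. by rewrite -sqr_nrm sqrf_eq0 nrm_eq0. Qed.
Lemma cnorm2D z w : cnorm2 (z + w) <= 2 * cnorm2 z + 2 * cnorm2 w.
Proof.
rewrite /cnorm2 !reimE.
have := sqr_ge0 (ReC z - ReC w); have := sqr_ge0 (ImC z - ImC w).
rewrite !sqrrD !sqrrN; nra.
Qed.
Lemma Re_le_nrm z : `|ReC z| <= nrm z.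
Proof.
rewrite -(@ler_pXn2r _ 2%N)// ?nnegrE ?nrm_ge0//.
by rewrite sqr_nrm real_normK ?num_real// lerDl sqr_ge0.
Qed.
Lemma Im_le_nrm z : `|ImC z| <= nrm z.
Proof.
rewrite -(@ler_pXn2r _ 2%N)// ?nnegrE ?nrm_ge0//.
by rewrite sqr_nrm real_normK ?num_real// lerDr sqr_ge0.
Qed.
Lemma nrm_le_ReIm z : nrm z <= `|ReC z| + `|ImC z|.
Proof.
rewrite -(@ler_pXn2r _ 2%N)// ?nnegrE ?nrm_ge0// ?addr_ge0//.
rewrite sqr_nrm sqrrD !real_normK ?num_real// /cnorm2.
have : 0 <= `|ReC z| * `|ImC z| by rewrite mulr_ge0.
lra.
Qed.
Lemma nrm_sub z w : nrm (z - w) = nrm (w - z).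
Proof. by rewrite -nrmN opprB. Qed.

End ComplexParts.

(** * Integrals *)

Section RealIntegrals.
Context {R : realType} (mu : {measure set R -> \bar R}).
Implicit Types (A : set R) (f g : R -> R).

Definition rint A f := mu.-integrable A (fun t => (f t)%:E).

Lemma rint_meas A f : rint A f -> measurable_fun A f.
Proof. by move=> /measurable_int /measurable_EFinP. Qed.

Lemma rintD A f g : measurable A -> rint A f -> rint A g ->
  rint A (fun t => f t + g t).
Proof. by move=> mA; exact: integrableD. Qed.

Lemma rintN A f : measurable A -> rint A f -> rint A (fun t => - f t).
Proof. by move=> mA; exact: integrableN. Qed.

Lemma rintB A f g : measurable A -> rint A f -> rint A g ->
  rint A (fun t => f t - g t).
Proof. by move=> mA; exact: integrableB. Qed.

Lemma rintZ A (k : R) f : measurable A -> rint A f -> rint A (fun t => k * f t).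
Proof. by move=> mA; exact: integrableZl. Qed.

Lemma rint_eq A f g : measurable A -> (forall t, A t -> f t = g t) ->
  rint A f -> rint A g.
Proof.
move=> mA fg; apply: eq_integrable => // t /set_mem At.
by rewrite fg.
Qed.

Lemma rint_le A f g : measurable A -> measurable_fun A f ->
  (forall t, A t -> `|f t| <= g t) -> rint A g -> rint A f.
Proof.
move=> mA mf fg ig; apply: (le_integrable mA _ _ ig).
  exact/measurable_EFinP.
by move=> t At; rewrite /= lee_fin (le_trans (fg t At))// ler_norm.
Qed.

Lemma rint_sub A B f : measurable A -> measurable B -> A `<=` B ->
  rint B f -> rint A f.
Proof. by move=> mA mB AB; exact: integrableS. Qed.

Lemma rint_norm A f : rint A f -> rint A (fun t => `|f t|).
Proof. exact: integrable_norm. Qed.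

Lemma rint_cst A (k : R) : measurable A -> (mu A < +oo)%E ->
  rint A (fun=> k).
Proof.
move=> mA fA; apply: measurable_bounded_integrable => //.
exact: bounded_cst.
Qed.

Lemma rint_bM A f g (B : R) : measurable A -> measurable_fun A f ->
  (forall t, A t -> `|f t| <= B) -> rint A g -> rint A (fun t => f t * g t).
Proof.
move=> mA mf fB ig.
apply: (@rint_le _ _ (fun t => B * `|g t|)) => //.
- exact: measurable_funM mf (rint_meas ig).
- by move=> t At; rewrite normrM ler_wpM2r// fB.
- exact/rintZ/rint_norm.
Qed.

Lemma Rint_eq A f g : (forall t, A t -> f t = g t) ->
  Rintegral mu A f = Rintegral mu A g.
Proof. by move=> fg; apply: eq_Rintegral => t /set_mem; exact: fg. Qed.

Lemma RintN A f : measurable A -> rint A f ->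
  Rintegral mu A (fun t => - f t) = - Rintegral mu A f.
Proof.
move=> mA fi; rewrite -mulN1r -RintegralZl//.
by apply: Rint_eq => t _; rewrite mulN1r.
Qed.

Lemma Rint_le A f g : measurable A -> rint A f -> rint A g ->
  (forall t, A t -> f t <= g t) -> Rintegral mu A f <= Rintegral mu A g.
Proof. by move=> mA fi gi; exact: le_Rintegral. Qed.

Lemma rint_setU A B f : measurable A -> measurable B ->
  rint A f -> rint B f -> rint (A `|` B) f.
Proof.
move=> mA mB /integrableP[mf fi] /integrableP[mg gi].
apply/integrableP; split; first exact/measurable_funU.
have mD := measurableD mB mA.
have AB : A `|` B = A `|` (B `\` A) by rewrite setUDr setDv setD0.
rewrite AB ge0_integral_setU//.
- apply: lte_add_pinfty => //; apply: le_lt_trans gi.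
  apply: ge0_subset_integral => //; exact: measurableT_comp.
- rewrite -AB; apply: measurableT_comp => //; exact/measurable_funU.
- by apply/disj_setPS => t [/= At [_ nAt]]; exact: nAt.
Qed.

Lemma Rint_ge0_sub A B f : measurable A -> measurable B -> A `<=` B ->
  rint B f -> (forall t, B t -> 0 <= f t) ->
  Rintegral mu A f <= Rintegral mu B f.
Proof.
move=> mA mB AB fi f0.
have fi' : rint (A `|` (B `\` A)) f by rewrite setDUK.
rewrite -[in leRHS](setDUK AB) Rintegral_setU//.
- by rewrite lerDl Rintegral_ge0// => t [Bt _]; exact: f0.
- exact: measurableD.
- by apply/disj_setPS => t [/= At [_ nAt]]; exact: nAt.
Qed.

(* Cauchy-Schwarz against the constant 1, from [0 <= (m f - I)^2] integrated. *)
Lemma Rint_sqr_le A f : measurable A -> (mu A < +oo)%E ->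
  measurable_fun A f -> rint A (fun t => f t ^+ 2) ->
  rint A f /\ (Rintegral mu A f) ^+ 2 <=
    fine (mu A) * Rintegral mu A (fun t => f t ^+ 2).
Proof.
move=> mA fA mf f2.
have fi : rint A f.
  apply: (@rint_le _ _ (fun t => 1 + f t ^+ 2)) => //; last first.
    by apply: rintD => //; exact: rint_cst.
  move=> t _; rewrite -[f t ^+ 2]real_normK ?num_real//.
  have := sqr_ge0 (`|f t| - 1); have := normr_ge0 (f t).
  rewrite sqrrB; nra.
split=> //; set I := Rintegral mu A f; set m := fine (mu A).
set J := Rintegral mu A _.
have m0 : 0 <= m by rewrite fine_ge0// measure_ge0.
(* The square [(m f - I)^2] yields the claim multiplied by [m], so a null set [A] is treated
   apart. *)
have [m00|mpos] := eqVneq m 0.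
  rewrite m00 mul0r.
  have : `|I| <= Rintegral mu A (fun t => `|f t|) by exact: le_normr_Rintegral.
  have -> : I = 0.
    have mu0 : mu A = 0%E.
      by rewrite -(@fineK _ (mu A)) ?ge0_fin_numE// -/m m00.
    rewrite /I /Rintegral null_set_integral//; first exact/measurable_EFinP.
  by rewrite expr0n.
have : 0 <= Rintegral mu A (fun t => (m * f t - I) ^+ 2).
  by apply: Rintegral_ge0 => t _; exact: sqr_ge0.
rewrite (_ : Rintegral _ _ _ = Rintegral mu A (fun t =>
    m ^+ 2 * f t ^+ 2 + ((- 2 * m * I) * f t + I ^+ 2))); last first.
  by apply: Rint_eq => t _; ring.
have i1 : rint A (fun t => m ^+ 2 * f t ^+ 2) by exact: rintZ.
have i2 : rint A (fun t => - 2 * m * I * f t) by exact: rintZ.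
have i3 : rint A (fun=> I ^+ 2) by exact: rint_cst.
rewrite RintegralD//; last exact: rintD.
rewrite RintegralD// Rintegral_cst// !RintegralZl// -/m -/I -/J => H.
have mp : 0 < m by rewrite lt_def mpos.
rewrite -(ler_pM2l mp); nra.
Qed.

End RealIntegrals.

Section ComplexIntegrals.
Context {R : realType} (mu : {measure set R -> \bar R}).
Local Notation C := (Cx R).
Implicit Types (A : set R) (f g h : R -> C).

Definition cmeas A f :=
  measurable_fun A (fun t => ReC (f t)) /\ measurable_fun A (fun t => ImC (f t)).



Lemma cmeasD A f g : cmeas A f -> cmeas A g -> cmeas A (fun t => f t + g t).
Proof.
move=> [f1 f2] [g1 g2]; split.
- under eq_fun do rewrite ReCD; exact: measurable_funD.
- under eq_fun do rewrite ImCD; exact: measurable_funD.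
Qed.

Lemma cmeasM A f g : cmeas A f -> cmeas A g -> cmeas A (fun t => f t * g t).
Proof.
move=> [f1 f2] [g1 g2]; split.
- under eq_fun do rewrite ReCM.
  by apply: measurable_funB; exact: measurable_funM.
- under eq_fun do rewrite ImCM.
  by apply: measurable_funD; exact: measurable_funM.
Qed.

Lemma cmeas_cst A (k : C) : cmeas A (fun=> k).
Proof. by split; exact: measurable_cst. Qed.

Lemma cmeasZ A (k : C) f : cmeas A f -> cmeas A (fun t => k * f t).
Proof. exact/cmeasM/cmeas_cst. Qed.

Lemma cmeas_conj A f : cmeas A f -> cmeas A (fun t => cconj (f t)).
Proof.
move=> [f1 f2]; split.
- by under eq_fun do rewrite ReC_conj.
- under eq_fun do rewrite ImC_conj; exact: measurableT_comp.
Qed.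

Lemma cmeas_sub A B f : measurable B -> A `<=` B -> cmeas B f -> cmeas A f.
Proof. by move=> mB AB [f1 f2]; split; exact: (measurable_funS mB AB). Qed.

Lemma cmeas_eq A f g : (forall t, A t -> f t = g t) -> cmeas A f -> cmeas A g.
Proof.
move=> fg [f1 f2]; split.
- by apply: (eq_measurable_fun _ _ f1) => t /set_mem /fg ->.
- by apply: (eq_measurable_fun _ _ f2) => t /set_mem /fg ->.
Qed.

Lemma cmeas_setU A B f : measurable A -> measurable B ->
  cmeas A f -> cmeas B f -> cmeas (A `|` B) f.
Proof. by move=> mA mB [f1 f2] [g1 g2]; split; apply/measurable_funU. Qed.

Lemma cmeas_cnorm2 A f : cmeas A f -> measurable_fun A (fun t => cnorm2 (f t)).
Proof. by move=> [f1 f2]; apply: measurable_funD; exact: measurable_funX. Qed.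

Lemma cableD A f g : measurable A -> cintegrable mu A f -> cintegrable mu A g ->
  cintegrable mu A (fun t => f t + g t).
Proof.
move=> mA [f1 f2] [g1 g2]; split.
- by under eq_fun do rewrite ReCD; exact: rintD.
- by under eq_fun do rewrite ImCD; exact: rintD.
Qed.

Lemma cableN A f : measurable A -> cintegrable mu A f ->
  cintegrable mu A (fun t => - f t).
Proof.
move=> mA [f1 f2]; split.
- by under eq_fun do rewrite ReCN; exact: rintN.
- by under eq_fun do rewrite ImCN; exact: rintN.
Qed.

Lemma cableB A f g : measurable A -> cintegrable mu A f -> cintegrable mu A g ->
  cintegrable mu A (fun t => f t - g t).
Proof. by move=> mA fi gi; apply: cableD => //; exact: cableN. Qed.

Lemma cable_conj A f : measurable A -> cintegrable mu A f ->
  cintegrable mu A (fun t => cconj (f t)).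
Proof.
move=> mA [f1 f2]; split.
- by under eq_fun do rewrite ReC_conj.
- by under eq_fun do rewrite ImC_conj; exact: rintN.
Qed.

Lemma cable_bM A f g (B : R) : measurable A -> cmeas A f ->
  (forall t, A t -> nrm (f t) <= B) -> cintegrable mu A g ->
  cintegrable mu A (fun t => f t * g t).
Proof.
move=> mA [f1 f2] fB [g1 g2].
have fR t : A t -> `|ReC (f t)| <= B by move=> At; rewrite (le_trans (Re_le_nrm _))// fB.
have fI t : A t -> `|ImC (f t)| <= B by move=> At; rewrite (le_trans (Im_le_nrm _))// fB.
split.
- under eq_fun do rewrite ReCM.
  by apply: rintB => //; [exact: (rint_bM mA f1 fR)|exact: (rint_bM mA f2 fI)].
- under eq_fun do rewrite ImCM.
  by apply: rintD => //; [exact: (rint_bM mA f1 fR)|exact: (rint_bM mA f2 fI)].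
Qed.

Lemma cableZ A (k : C) f : measurable A -> cintegrable mu A f ->
  cintegrable mu A (fun t => k * f t).
Proof.
move=> mA fi; apply: (@cable_bM _ (fun=> k) f (nrm k)) => //.
Qed.

Lemma cable_sub A B f : measurable A -> measurable B -> A `<=` B ->
  cintegrable mu B f -> cintegrable mu A f.
Proof. by move=> mA mB AB [f1 f2]; split; exact: (rint_sub mA mB AB). Qed.

Lemma cable_eq A f g : measurable A -> (forall t, A t -> f t = g t) ->
  cintegrable mu A f -> cintegrable mu A g.
Proof.
move=> mA fg [f1 f2]; split.
- by apply: rint_eq f1 => // t At; rewrite fg.
- by apply: rint_eq f2 => // t At; rewrite fg.
Qed.

Lemma cable_le A f (g : R -> R) : measurable A -> cmeas A f ->
  (forall t, A t -> nrm (f t) <= g t) -> rint mu A g -> cintegrable mu A f.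
Proof.
move=> mA [f1 f2] fg gi; split; apply: rint_le gi => // t At;
  rewrite (le_trans _ (fg t At)) ?Re_le_nrm ?Im_le_nrm//.
Qed.

Lemma cable_bounded A f (B : R) : measurable A -> (mu A < +oo)%E -> cmeas A f ->
  (forall t, A t -> nrm (f t) <= B) -> cintegrable mu A f.
Proof.
move=> mA fA mf fB; apply: (@cable_le _ _ (fun=> B)) => //; exact: rint_cst.
Qed.

Lemma cable_cst A (k : C) : measurable A -> (mu A < +oo)%E ->
  cintegrable mu A (fun=> k).
Proof.
by move=> mA fA; apply: (@cable_bounded _ _ (nrm k)) => //; exact: cmeas_cst.
Qed.

Lemma Re_cint A f : ReC (cint mu A f) = Rintegral mu A (fun t => ReC (f t)).
Proof. by rewrite /cint !reimE mul0r mulr0 subrr addr0. Qed.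

Lemma Im_cint A f : ImC (cint mu A f) = Rintegral mu A (fun t => ImC (f t)).
Proof. by rewrite /cint !reimE mul0r mul1r !add0r. Qed.

Lemma cint_eq A f g : (forall t, A t -> f t = g t) -> cint mu A f = cint mu A g.
Proof.
by move=> fg; apply: eqCx; rewrite ?Re_cint ?Im_cint; apply: Rint_eq => t /fg ->.
Qed.

Lemma cint_set0 f : cint mu set0 f = 0.
Proof. by apply: eqCx; rewrite ?Re_cint ?Im_cint Rintegral_set0. Qed.

Lemma cintD A f g : measurable A -> cintegrable mu A f -> cintegrable mu A g ->
  cint mu A (fun t => f t + g t) = cint mu A f + cint mu A g.
Proof.
move=> mA [f1 f2] [g1 g2]; apply: eqCx.
- rewrite ReCD !Re_cint -RintegralD//.
  by apply: Rint_eq => t _; rewrite ReCD.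
- rewrite ImCD !Im_cint -RintegralD//.
  by apply: Rint_eq => t _; rewrite ImCD.
Qed.

Lemma cintZ A (k : C) f : measurable A -> cintegrable mu A f ->
  cint mu A (fun t => k * f t) = k * cint mu A f.
Proof.
move=> mA [f1 f2]; apply: eqCx.
- rewrite ReCM !Re_cint !Im_cint -!RintegralZl// -RintegralB//; last 2 first.
    exact: (rintZ (ReC k)).
    exact: (rintZ (ImC k)).
  by apply: Rint_eq => t _; rewrite ReCM.
- rewrite ImCM !Re_cint !Im_cint -!RintegralZl// -RintegralD//; last 2 first.
    exact: (rintZ (ReC k)).
    exact: (rintZ (ImC k)).
  by apply: Rint_eq => t _; rewrite ImCM.
Qed.

Lemma cintN A f : measurable A -> cintegrable mu A f ->
  cint mu A (fun t => - f t) = - cint mu A f.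
Proof.
move=> mA fi; rewrite -mulN1r -cintZ//.
by apply: cint_eq => t _; rewrite mulN1r.
Qed.

Lemma cintB A f g : measurable A -> cintegrable mu A f -> cintegrable mu A g ->
  cint mu A (fun t => f t - g t) = cint mu A f - cint mu A g.
Proof. by move=> mA fi gi; rewrite cintD ?cintN//; exact: cableN. Qed.

Lemma cint_conj A f : measurable A -> cintegrable mu A f ->
  cint mu A (fun t => cconj (f t)) = cconj (cint mu A f).
Proof.
move=> mA [f1 f2]; apply: eqCx.
- rewrite ReC_conj !Re_cint.
  by apply: Rint_eq => t _; rewrite ReC_conj.
- rewrite ImC_conj !Im_cint -RintN//.
  by apply: Rint_eq => t _; rewrite ImC_conj.
Qed.

Lemma cint_setU A B f : measurable A -> measurable B ->
  cintegrable mu (A `|` B) f -> A `&` B `<=` set0 ->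
  cint mu (A `|` B) f = cint mu A f + cint mu B f.
Proof.
move=> mA mB [f1 f2] AB.
have {}AB : [disjoint A & B] by apply/disj_setPS.
apply: eqCx.
- by rewrite [in RHS]ReCD !Re_cint Rintegral_setU.
- by rewrite [in RHS]ImCD !Im_cint Rintegral_setU.
Qed.

(** The factor 2 comes from estimating real and imaginary part separately. *)
Lemma nrm_cint_le A f (g : R -> R) : measurable A -> cintegrable mu A f ->
  rint mu A g -> (forall t, A t -> nrm (f t) <= g t) ->
  nrm (cint mu A f) <= 2 * Rintegral mu A g.
Proof.
move=> mA [f1 f2] gi fg; apply: (le_trans (nrm_le_ReIm _)).
rewrite mulr_natl mulr2n Re_cint Im_cint; apply: lerD.
- apply: (le_trans (le_normr_Rintegral mA f1)); apply: Rint_le => //.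
    exact: rint_norm.
  by move=> t At; rewrite (le_trans (Re_le_nrm _))// fg.
- apply: (le_trans (le_normr_Rintegral mA f2)); apply: Rint_le => //.
    exact: rint_norm.
  by move=> t At; rewrite (le_trans (Im_le_nrm _))// fg.
Qed.

Lemma nrm_cint_bound A f (B : R) : measurable A -> (mu A < +oo)%E ->
  cintegrable mu A f -> (forall t, A t -> nrm (f t) <= B) ->
  nrm (cint mu A f) <= 2 * B * fine (mu A).
Proof.
move=> mA fA fi fB; rewrite -mulrA -Rintegral_cst//.
by apply: nrm_cint_le => //; exact: rint_cst.
Qed.

Lemma cint_itv_cat (x y z : R) f : x <= y -> y <= z ->
  cintegrable mu `[x, z[ f ->
  cint mu `[x, z[ f = cint mu `[x, y[ f + cint mu `[y, z[ f.
Proof.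
move=> xy yz fi.
have E : `[x, z[%classic = `[x, y[ `|` `[y, z[.
  by apply: itv_bndbnd_setU; rewrite bnd_simp.
rewrite E cint_setU//; first by rewrite -E.
by move=> t /= []; rewrite !in_itv/= => /andP[_ ty] /andP[yt _]; move: (lt_le_trans ty yt); rewrite ltxx.
Qed.

End ComplexIntegrals.

Section SquareIntegrable.
Context {R : realType} (mu : {measure set R -> \bar R}).
Local Notation C := (Cx R).
Implicit Types (A : set R) (f g h : R -> C).

Lemma L2_meas A f : L2 mu A f -> cmeas A f.
Proof. by case=> ? []. Qed.
Lemma L2_rint A f : L2 mu A f -> rint mu A (fun t => cnorm2 (f t)).
Proof. by case=> ? []. Qed.
Lemma L2I A f : cmeas A f -> rint mu A (fun t => cnorm2 (f t)) -> L2 mu A f.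
Proof. by case. Qed.

Lemma L2_le A f (g : R -> R) : measurable A -> cmeas A f ->
  (forall t, A t -> cnorm2 (f t) <= g t) -> rint mu A g -> L2 mu A f.
Proof.
move=> mA mf fg gi; apply: L2I => //; apply: rint_le gi => //.
  exact: cmeas_cnorm2.
by move=> t At; rewrite ger0_norm ?cnorm2_ge0// fg.
Qed.

Lemma L2D A f g : measurable A -> L2 mu A f -> L2 mu A g ->
  L2 mu A (fun t => f t + g t).
Proof.
move=> mA fi gi.
apply: (@L2_le _ _ (fun t => 2 * cnorm2 (f t) + 2 * cnorm2 (g t))) => //.
- by apply: cmeasD; exact: L2_meas.
- by move=> t _; exact: cnorm2D.
- by apply: rintD => //; apply: rintZ => //; exact: L2_rint.
Qed.

Lemma L2Z A (k : C) f : measurable A -> L2 mu A f -> L2 mu A (fun t => k * f t).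
Proof.
move=> mA fi; apply: (@L2_le _ _ (fun t => cnorm2 k * cnorm2 (f t))) => //.
- by apply: cmeasZ; exact: L2_meas.
- by move=> t _; rewrite cnorm2M.
- by apply: rintZ => //; exact: L2_rint.
Qed.

Lemma L2_eq A f g : measurable A -> (forall t, A t -> f t = g t) ->
  L2 mu A f -> L2 mu A g.
Proof.
move=> mA fg fi; apply: L2I; first exact: cmeas_eq (L2_meas fi).
by apply: rint_eq (L2_rint fi) => // t At; rewrite fg.
Qed.

Lemma L2_conj A f : L2 mu A f -> L2 mu A (fun t => cconj (f t)).
Proof.
move=> fi; apply: L2I; first exact/cmeas_conj/L2_meas.
by under eq_fun do rewrite cnorm2_conj; exact: L2_rint.
Qed.

Lemma L2_sub A B f : measurable A -> measurable B -> A `<=` B ->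
  L2 mu B f -> L2 mu A f.
Proof.
move=> mA mB AB fi; apply: L2I; first exact: cmeas_sub (L2_meas fi).
by apply: rint_sub (L2_rint fi).
Qed.

Lemma L2_setU A B f : measurable A -> measurable B ->
  L2 mu A f -> L2 mu B f -> L2 mu (A `|` B) f.
Proof.
move=> mA mB fi gi; apply: L2I.
- by apply: cmeas_setU => //; exact: L2_meas.
- by apply: rint_setU => //; exact: L2_rint.
Qed.

Lemma L2_bounded A f (B : R) : measurable A -> (mu A < +oo)%E -> cmeas A f ->
  (forall t, A t -> nrm (f t) <= B) -> L2 mu A f.
Proof.
move=> mA fA mf fB; apply: (@L2_le _ _ (fun=> B ^+ 2)) => //.
- move=> t At; rewrite -sqr_nrm ler_pXn2r ?nnegrE ?nrm_ge0 ?fB//.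
  exact: le_trans (nrm_ge0 _) (fB t At).
- exact: rint_cst.
Qed.

Lemma L2_0 A : measurable A -> L2 mu A (fun=> 0).
Proof.
move=> mA; apply: L2I; first exact: cmeas_cst.
under eq_fun do rewrite cnorm20; exact: integrable0.
Qed.

Lemma nrmM_le (z w : C) : nrm (z * w) <= cnorm2 z + cnorm2 w.
Proof.
rewrite nrmM -!sqr_nrm.
have := sqr_ge0 (nrm z - nrm w); have := nrm_ge0 z; have := nrm_ge0 w.
have := sqr_ge0 (nrm z); have := sqr_ge0 (nrm w).
rewrite sqrrB; nra.
Qed.

Lemma L2_mul A f g : measurable A -> L2 mu A f -> L2 mu A g ->
  cintegrable mu A (fun t => f t * g t).
Proof.
move=> mA fi gi.
apply: (@cable_le _ _ _ _ (fun t => cnorm2 (f t) + cnorm2 (g t))) => //.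
- by apply: cmeasM; exact: L2_meas.
- by move=> t _; exact: nrmM_le.
- by apply: rintD => //; exact: L2_rint.
Qed.

End SquareIntegrable.

(** * Fubini's theorem on a triangle *)

Section Triangle.
Context {R : realType} (mu nu : {measure set R -> \bar R}).
Variables (x y : R).
Local Notation A := (`[x, y[%classic : set R).
Hypothesis (muA : (mu A < +oo)%E) (nuA : (nu A < +oo)%E).

Let mA : measurable A. Proof. exact: measurable_itv. Qed.

(** Fubini is applied to finite measures on the whole line, whereas [mu] and [nu] are finite only on
    [A]. Their restrictions [mfrestr] to [A] are finite, and an integrand vanishing off [A] does not
    see the difference. *)
Lemma integral_mfrestr (m : {measure set R -> \bar R}) (mf : (m A < +oo)%E)
  (g : R -> R) : (forall t, ~ A t -> g t = 0) ->
  (\int[mfrestr mA mf]_t (g t)%:E = \int[m]_(t in A) (g t)%:E)%E.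
Proof.
move=> g0; have -> : (\int[m]_(t in A) (g t)%:E =
    \int[mfrestr mA mf]_(t in A) (g t)%:E)%E.
  apply: eq_measure_integral => B mB BA.
  by rewrite /= /mfrestr /mrestr setIidl.
rewrite [in RHS]integral_mkcond; apply: eq_integral => t _.
by rewrite /patch; case: ifPn => // /negP; rewrite inE => /g0 ->.
Qed.

Variables (h k : R -> R).
Hypothesis (hi : rint mu A h) (ki : rint nu A k).

Let m1 : {finite_measure set R -> \bar R} := mfrestr mA muA.
Let m2 : {finite_measure set R -> \bar R} := mfrestr mA nuA.
Let h' := h \_ A.
Let k' := k \_ A.
(** The diagonal belongs to the triangle: the inner domain is [[s, y[] in one order and the closed
    interval [[x, t]] in the other. The excess of [[x, t]] over [[x, t[] is the only source of jump
    terms in integration by parts. *)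
Let f (p : R * R) : \bar R := (if p.1 <= p.2 then h' p.1 * k' p.2 else 0)%:E.

Let h'0 t : ~ A t -> h' t = 0.
Proof. by move=> nA; rewrite /h' patchE ifF//; apply/negbTE/negP; rewrite inE. Qed.
Let k'0 t : ~ A t -> k' t = 0.
Proof. by move=> nA; rewrite /k' patchE ifF//; apply/negbTE/negP; rewrite inE. Qed.
Let h'E t : A t -> h' t = h t.
Proof. by move=> At; rewrite /h' patchE ifT// inE. Qed.
Let k'E t : A t -> k' t = k t.
Proof. by move=> At; rewrite /k' patchE ifT// inE. Qed.

Let mh' : measurable_fun setT h'.
Proof. by apply/(measurable_restrictT h) => //; exact: rint_meas hi. Qed.
Let mk' : measurable_fun setT k'.
Proof. by apply/(measurable_restrictT k) => //; exact: rint_meas ki. Qed.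

Let mf : measurable_fun setT f.
Proof.
apply/measurable_EFinP; apply: measurable_fun_ifT.
- exact: measurable_fun_ler.
- by apply: measurable_funM; exact: measurableT_comp.
- exact: measurable_cst.
Qed.

(** Tonelli: without the indicator of the triangle the integrand is dominated by [|h'| |k'|], whose
    factors integrate separately. *)
Let fi : (m1 \x m2)%E.-integrable setT f.
Proof.
apply/integrable12ltyP => //.
pose J := Rintegral nu A (fun t => `|k t|).
apply: (@le_lt_trans _ _ (\int[m1]_s (`|h' s| * J)%:E)%E).
  apply: ge0_le_integral => //.
  - by move=> s _; apply: integral_ge0.
  - apply: (measurable_fun_fubini_tonelli_F (abse \o f)) => //=.
    exact: measurableT_comp.
  - apply/measurable_EFinP; apply: measurable_funM => //.
    exact: measurableT_comp.
  move=> s _; apply: (@le_trans _ _ (\int[m2]_t (`|h' s| * `|k' t|)%:E)%E).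
    apply: ge0_le_integral => //.
    - apply: measurableT_comp => //.
      exact: (measurableT_comp mf (pair1_measurable s)).
    - apply/measurable_EFinP; apply: measurable_funM => //.
      exact: measurableT_comp.
    move=> t _; rewrite /f /= lee_fin; case: ifP => _; last by rewrite normr0 mulr_ge0.
    by rewrite normrM.
  rewrite integral_mfrestr; last by move=> t /k'0 ->; rewrite normr0 mulr0.
  have ki' : rint nu A (fun t => `|h' s| * `|k t|) by apply: rintZ => //; exact: rint_norm.
  rewrite (eq_integral (fun t => (`|h' s| * `|k t|)%:E)); last first.
    by move=> t /set_mem At; rewrite k'E.
  rewrite -[leLHS]fineK ?integrable_fin_num// lee_fin.
  rewrite -/(Rintegral nu A (fun t => `|h' s| * `|k t|)) RintegralZl//.
  exact: rint_norm.
rewrite integral_mfrestr; last by move=> t /h'0 ->; rewrite normr0 mul0r.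
have hi' : rint mu A (fun t => `|h' t| * J).
  apply: (@rint_eq _ _ _ (fun t => J * `|h t|)) => //.
    by move=> t At; rewrite h'E// mulrC.
  by apply: rintZ => //; exact: rint_norm.
by have /integrable_fin_num := hi'; rewrite fin_numE ltey => /(_ mA)/andP[].
Qed.

Let inner1 s : (\int[m2]_t f (s, t) = (h' s * Rintegral nu `[s, y[ k)%:E)%E.
Proof.
have [As|nAs] := pselect (A s); last first.
  rewrite h'0// mul0r integral0_eq// => t _.
  by rewrite /f /= h'0// mul0r if_same.
have sA : `[s, y[ `<=` A.
  move=> t /=; rewrite !in_itv/= => /andP[st ->]; rewrite andbT.
  by move: As; rewrite /= in_itv/= => /andP[xs _]; exact: le_trans st.
rewrite integral_mfrestr; last by move=> t /k'0 /= ->; rewrite mulr0 if_same.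
have ks : rint nu `[s, y[ k by exact: rint_sub sA ki.
rewrite -RintegralZl// /Rintegral fineK; last first.
  apply: integrable_fin_num => //.
  exact: (rintZ (h' s) _ ks).
rewrite -[in RHS](setIidr sA) [in RHS]integral_mkcondr.
apply: eq_integral => t /set_mem At.
rewrite /f /= patchE k'E//.
rewrite mem_setE in_itv/=; move: At; rewrite /= in_itv/= => /andP[_ ->].
by rewrite andbT; case: ifP.
Qed.

Let inner2 t : (\int[m1]_s f (s, t) = (k' t * Rintegral mu `[x, t] h)%:E)%E.
Proof.
have [As|nAs] := pselect (A t); last first.
  rewrite k'0// mul0r integral0_eq// => s _.
  by rewrite /f /= k'0// mulr0 if_same.
have sA : `[x, t] `<=` A.
  move=> s /=; rewrite !in_itv/= => /andP[-> st]/=.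
  by move: As; rewrite /= in_itv/= => /andP[_ ty]; exact: le_lt_trans st ty.
rewrite integral_mfrestr; last by move=> s /h'0 /= ->; rewrite mul0r if_same.
have hs : rint mu `[x, t] h by exact: rint_sub sA hi.
rewrite -RintegralZl// /Rintegral fineK; last first.
  apply: integrable_fin_num => //.
  exact: (rintZ (k' t) _ hs).
rewrite -[in RHS](setIidr sA) [in RHS]integral_mkcondr.
apply: eq_integral => s /set_mem sA'.
rewrite /f /= patchE h'E// mulrC.
rewrite mem_setE in_itv/=; move: sA'; rewrite /= in_itv/= => /andP[-> _] /=.
by case: ifP.
Qed.

Lemma rint_triangle1 : rint mu A (fun s => h s * Rintegral nu `[s, y[ k).
Proof.
have /integrableP[m i] := integrable_fubini_F fi.
have E : fubini_F m2 f = fun s => (h' s * Rintegral nu `[s, y[ k)%:E.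
  by apply/funext => s; exact: inner1.
rewrite E in m i.
have mg : measurable_fun A (fun s => h' s * Rintegral nu `[s, y[ k).
  exact/measurable_funTS/measurable_EFinP.
apply: (@rint_eq _ _ _ (fun s => h' s * Rintegral nu `[s, y[ k)) => //.
  by move=> s As; rewrite h'E.
apply/integrableP; split; first exact/measurable_EFinP.
move: i; under eq_integral do rewrite /=.
by rewrite integral_mfrestr// => s /h'0 ->; rewrite mul0r normr0.
Qed.

Lemma rint_triangle2 : rint nu A (fun t => k t * Rintegral mu `[x, t] h).
Proof.
have m := measurable_fubini_G fi.
have E : fubini_G m1 f = fun s => (k' s * Rintegral mu `[x, s] h)%:E.
  by apply/funext => s; exact: inner2.
rewrite E in m.
have mg : measurable_fun A (fun s => k' s * Rintegral mu `[x, s] h).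
  exact/measurable_funTS/measurable_EFinP.
apply: (@rint_le _ _ _ _ (fun t => Rintegral mu A (fun s => `|h s|) * `|k t|)) => //.
- by apply: (eq_measurable_fun _ _ mg) => s /set_mem As; rewrite k'E.
- move=> t At; rewrite normrM mulrC ler_wpM2r//.
  have sA : `[x, t] `<=` A.
    move=> s /=; rewrite !in_itv/= => /andP[-> st]/=.
    by move: At; rewrite /= in_itv/= => /andP[_ ty]; exact: le_lt_trans st ty.
  apply: le_trans (le_normr_Rintegral _ _) _ => //; first exact: rint_sub sA hi.
  by apply: Rint_ge0_sub => //; exact: rint_norm.
- by apply: rintZ => //; exact: rint_norm.
Qed.

Lemma Rint_triangle : Rintegral mu A (fun s => h s * Rintegral nu `[s, y[ k) =
  Rintegral nu A (fun t => k t * Rintegral mu `[x, t] h).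
Proof.
have /(congr1 fine) := Fubini fi.
under eq_integral do rewrite inner1.
rewrite integral_mfrestr; last by move=> s /h'0 ->; rewrite mul0r.
under [X in _ = fine X]eq_integral do rewrite inner2.
rewrite integral_mfrestr; last by move=> s /k'0 ->; rewrite mul0r.
move=> E; transitivity (Rintegral mu A (fun s => h' s * Rintegral nu `[s, y[ k)).
  by apply: Rint_eq => s As; rewrite h'E.
by rewrite [LHS]E; apply: Rint_eq => s As; rewrite k'E.
Qed.

End Triangle.

Section Atoms.
Context {R : realType} (mu : {measure set R -> \bar R}).

(** Only finitely many atoms have mass above [1 / (n + 1)], since [N] of them together would exceed
    [mu A] for large [N]; then [n] runs through the integers. *)
Lemma countable_atoms (A : set R) : measurable A -> (mu A < +oo)%E ->
  countable [set t | A t /\ mu [set t] != 0%E].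
Proof.
move=> mA fA; set M := fine (mu A).
have fin t : A t -> mu [set t] \is a fin_num.
  move=> At; rewrite ge0_fin_numE//; apply: le_lt_trans fA.
  by apply: le_measure; rewrite ?inE// => _ ->.
rewrite (_ : mkset _ = \bigcup_n [set t | A t /\ n.+1%:R^-1 < fine (mu [set t])]).
  apply: bigcup_countable => // n _; apply: finite_set_countable.
  apply: contrapT => inf.
  have [N MN] : exists N : nat, M * n.+1%:R < N%:R.
    exists (Num.bound `|M * n.+1%:R|).
    by rewrite (le_lt_trans (ler_norm _))// archi_boundP.
  have [B BS NB] := infinite_set_fset N inf.
  have : (mu (\big[setU/set0]_(i <- B) [set i]) <= mu A)%E.
    apply: le_measure; rewrite ?inE//; first by apply: bigsetU_measurable.
    by rewrite -bigcup_fset => t [i /= iB ->]; have [] := BS _ iB.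
  rewrite measure_fbigsetU//; last first.
    by move=> i j _ _ [t [/= -> ->]].
  rewrite -(@fineK _ (mu A)) ?ge0_fin_numE// -/M.
  rewrite big_seq (eq_bigr (fun i => (fine (mu [set i]))%:E)); last first.
    by move=> i /BS[Ai _]; rewrite fineK// fin.
  rewrite sumEFin lee_fin leNgt => /negP; apply.
  apply: (@lt_le_trans _ _ (\sum_(i <- B | i \in B) n.+1%:R^-1)); last first.
    by apply: ler_sum => i /BS[_ /ltW].
  rewrite -big_seq big_const_seq count_predT iter_addr_0 -[X in _ < X]mulr_natr mulrC.
  rewrite ltr_pdivlMr ?ltr0n//; apply: (lt_le_trans MN); rewrite ler_nat.
  exact: NB.
apply/seteqP; split => [t [At t0]|t [n _ [At lt]]]; last first.
  split=> //; apply/eqP => t0; move: lt; rewrite t0 /= ltNge => /negP; apply.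
  by rewrite invr_ge0.
have : 0 < fine (mu [set t]).
  rewrite lt_def fine_ge0// andbT; apply: contra t0 => /eqP t0.
  by rewrite -(@fineK _ (mu [set t])) ?fin// t0.
move=> /ltr_add_invr[n]; rewrite add0r => nt; exists n => //.
Qed.

End Atoms.

(** * Integration by parts for two measures *)

Section IntegrationByParts.
Context {R : realType} (mu nu : {measure set R -> \bar R}).
Variables (x y : R).
Local Notation A := (`[x, y[%classic : set R).
Hypothesis (xy : x <= y) (muA : (mu A < +oo)%E) (nuA : (nu A < +oo)%E).

Let mA : measurable A. Proof. exact: measurable_itv. Qed.

Lemma Rint_itv_cat (m : {measure set R -> \bar R}) (f : R -> R) u v w :
  u <= v -> v <= w -> rint m `[u, w[ f ->
  Rintegral m `[u, w[ f = Rintegral m `[u, v[ f + Rintegral m `[v, w[ f.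
Proof.
move=> uv vw fi.
have E : `[u, w[%classic = `[u, v[ `|` `[v, w[.
  by apply: itv_bndbnd_setU; rewrite bnd_simp.
rewrite E Rintegral_setU//; first by rewrite -E.
apply/disj_setPS => t /= []; rewrite !in_itv/= => /andP[_ tv] /andP[vt _].
by move: (lt_le_trans tv vt); rewrite ltxx.
Qed.

(** Measurability comes for free from the triangle with first integrand 1: the section [s |->
    int_[s, y[ h] is measurable, and the primitive is its difference from the full integral. *)
Lemma meas_prim (h : R -> R) : rint mu A h ->
  measurable_fun A (fun t => Rintegral mu `[x, t[ h).
Proof.
move=> hi.
have i1 : rint mu A (fun=> 1 : R) by exact: rint_cst.
have := rint_meas (rint_triangle1 muA muA i1 hi).
move=> m; apply: (eq_measurable_fun (fun t => Rintegral mu A h - 1 * Rintegral mu `[t, y[ h)).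
  move=> t /set_mem /=; rewrite in_itv/= => /andP[xt ty].
  by rewrite mul1r (Rint_itv_cat xt (ltW ty) hi) addrK.
exact: measurable_funB.
Qed.

Hypothesis atoms : forall t, A t -> mu [set t] = 0%E \/ nu [set t] = 0%E.
Variables (h k : R -> R).
Hypothesis (hi : rint mu A h) (ki : rint nu A k).

Let H t := Rintegral mu `[x, t[ h.
Let K t := Rintegral nu `[x, t[ k.

Let KE s : A s -> Rintegral nu `[s, y[ k = K y - K s.
Proof.
move=> /=; rewrite in_itv/= => /andP[xs sy].
have E : K y = K s + Rintegral nu `[s, y[ k by exact: (Rint_itv_cat xs (ltW sy) ki).
by rewrite E addrC addKr.
Qed.

Let HE s : A s -> Rintegral mu `[s, y[ h = H y - H s.
Proof.
move=> /=; rewrite in_itv/= => /andP[xs sy].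
have E : H y = H s + Rintegral mu `[s, y[ h by exact: (Rint_itv_cat xs (ltW sy) hi).
by rewrite E addrC addKr.
Qed.

Lemma rint_mul_prim1 : rint mu A (fun s => h s * K s).
Proof.
apply: (@rint_eq _ _ _ (fun s => K y * h s - h s * Rintegral nu `[s, y[ k)) => //.
  by move=> s As; rewrite KE//; ring.
apply: rintB => //; first exact: rintZ.
exact: rint_triangle1.
Qed.

Lemma rint_mul_prim2 : rint nu A (fun s => k s * H s).
Proof.
apply: (@rint_eq _ _ _ (fun s => H y * k s - k s * Rintegral mu `[s, y[ h)) => //.
  by move=> s As; rewrite HE//; ring.
apply: rintB => //; first exact: rintZ.
exact: rint_triangle1.
Qed.

(** Fubini leaves the closed intervals [[x, t]] on one side. The atoms of [mu] form a countable set
    of [nu]-null points, so [[x, t]] may be replaced by [[x, t[] for [nu]-almost every [t]. *)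
Lemma Rint_by_parts :
  Rintegral nu A (fun t => k t * H t) + Rintegral mu A (fun s => h s * K s) =
  Rintegral mu A h * Rintegral nu A k.
Proof.
have : Rintegral mu A (fun s => h s * Rintegral nu `[s, y[ k) =
    Rintegral nu A (fun t => k t * H t).
  apply: (eq_trans (Rint_triangle muA nuA hi ki)).
  apply: (congr1 fine).
  apply: ae_eq_integral => //.
  - have m2 := rint_meas (rint_triangle2 muA nuA hi ki).
    by apply/measurable_EFinP; exact: m2.
  - have m2 := rint_meas rint_mul_prim2.
    by apply/measurable_EFinP; exact: m2.
  have N : nu.-negligible [set t | A t /\ mu [set t] != 0%E].
    have /countable_injP[f injf] := countable_atoms mA muA.
    have E : [set t | A t /\ mu [set t] != 0%E] `<=`
        \bigcup_n [set t | [/\ A t, mu [set t] != 0%E & f t = n]].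
      by move=> t [At mt]; exists (f t).
    apply: (negligibleS E); apply: negligible_bigcup => n.
    have [[t0 [At0 mt0 ft0]]|none] := pselect (exists t, [/\ A t, mu [set t] != 0%E & f t = n]).
      have E0 : [set t | [/\ A t, mu [set t] != 0%E & f t = n]] `<=` [set t0].
        move=> t [At mt ft] /=; apply: injf; rewrite ?inE//.
        by rewrite ft ft0.
      apply: (negligibleS E0); apply/negligibleP; first exact: measurable_set1.
      by case: (atoms At0) => // mt; move: mt0; rewrite mt eqxx.
    rewrite (_ : mkset _ = set0); first exact: negligible_set0.
    by apply/seteqP; split => // t tn; apply: none; exists t.
  change (nu.-negligible (~` [set t | A t -> (k t * Rintegral mu `[x, t] h)%:E = (k t * H t)%:E])).
  apply: negligibleS N.
  move=> t /= /not_implyP[At]; move=> ne; split => //.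
  apply/negP => /eqP mt; apply: ne; congr (_ * _)%:E.
  rewrite /H; move: At; rewrite /= in_itv/= => /andP[xt ty].
  have E : `[x, t]%classic = `[x, t[ `|` [set t].
    by rewrite -(@setUitv1 _ _ (BLeft x) t true)// bnd_simp.
  rewrite E Rintegral_setU//.
  - rewrite [X in _ + X](_ : _ = 0) ?addr0//.
    rewrite /Rintegral null_set_integral//.
    have st : [set t] `<=` A by move=> _ ->; rewrite /= in_itv/= xt.
    have mt' := measurable_funS mA st (rint_meas hi).
    by apply/measurable_EFinP; exact: mt'.
  - rewrite -E; apply: rint_sub hi => // s /=; rewrite !in_itv/= => /andP[-> st]/=.
    exact: le_lt_trans st ty.
  - by apply/disj_setPS => s /= []; rewrite in_itv/= => /andP[_ /[swap] ->]; rewrite ltxx.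
rewrite (_ : Rintegral mu A (fun s => h s * Rintegral nu `[s, y[ k) =
   Rintegral mu A (fun s => K y * h s - h s * K s)); last first.
  by apply: Rint_eq => s As; rewrite KE//; ring.
rewrite RintegralB//; last 2 first.
  exact: rintZ.
  exact: rint_mul_prim1.
by rewrite RintegralZl// => <-; rewrite subrK mulrC.
Qed.

End IntegrationByParts.

(** * The interval and its exhaustions *)

Lemma cableI {R : realType} (mu : {measure set R -> \bar R}) (A : set R)
    (f : R -> Cx R) (g1 g2 : R -> R) :
  (forall t, ReC (f t) = g1 t) -> (forall t, ImC (f t) = g2 t) ->
  rint mu A g1 -> rint mu A g2 -> cintegrable mu A f.
Proof. by move=> /funext <- /funext <-. Qed.

Lemma cmeasI {R : realType} (A : set R) (f : R -> Cx R) (g1 g2 : R -> R) :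
  (forall t, ReC (f t) = g1 t) -> (forall t, ImC (f t) = g2 t) ->
  measurable_fun A g1 -> measurable_fun A g2 -> cmeas A f.
Proof. by move=> /funext <- /funext <-. Qed.

(** * Integration by parts for complex integrands *)

Section ComplexByParts.
Context {R : realType} (mu nu : {measure set R -> \bar R}).
Local Notation C := (Cx R).
Variables (x y : R).
Local Notation A := (`[x, y[%classic : set R).
Hypothesis (xy : x <= y) (muA : (mu A < +oo)%E) (nuA : (nu A < +oo)%E).

Lemma cmeas_prim (h : R -> C) : cintegrable mu A h ->
  cmeas A (fun t => cint mu `[x, t[ h).
Proof.
move=> [h1 h2].
apply: (@cmeasI _ _ _ (fun t => Rintegral mu `[x, t[ (fun s => ReC (h s)))
  (fun t => Rintegral mu `[x, t[ (fun s => ImC (h s)))).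
- by move=> t; rewrite Re_cint.
- by move=> t; rewrite Im_cint.
- exact: meas_prim.
- exact: meas_prim.
Qed.

Hypothesis atoms : forall t, A t -> mu [set t] = 0%E \/ nu [set t] = 0%E.
Variables (h k : R -> C).
Hypothesis (hi : cintegrable mu A h) (ki : cintegrable nu A k).

Let mA : measurable A. Proof. exact: measurable_itv. Qed.
Let atoms' t : A t -> nu [set t] = 0%E \/ mu [set t] = 0%E.
Proof. by move=> /atoms[]; [right|left]. Qed.

Lemma cable_mul_prim1 : cintegrable mu A (fun s => h s * cint nu `[x, s[ k).
Proof.
case: hi ki => h1 h2 [k1 k2].
pose P1 t := Rintegral nu `[x, t[ (fun s => ReC (k s)).
pose P2 t := Rintegral nu `[x, t[ (fun s => ImC (k s)).
apply: (@cableI _ _ _ _ (fun t => ReC (h t) * P1 t - ImC (h t) * P2 t)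
  (fun t => ReC (h t) * P2 t + ImC (h t) * P1 t)).
- by move=> t; rewrite ReCM Re_cint Im_cint.
- by move=> t; rewrite ImCM Re_cint Im_cint.
- by apply: rintB => //; exact: rint_mul_prim1.
- by apply: rintD => //; exact: rint_mul_prim1.
Qed.

Lemma cable_mul_prim2 : cintegrable nu A (fun s => k s * cint mu `[x, s[ h).
Proof.
case: hi ki => h1 h2 [k1 k2].
pose P1 t := Rintegral mu `[x, t[ (fun s => ReC (h s)).
pose P2 t := Rintegral mu `[x, t[ (fun s => ImC (h s)).
apply: (@cableI _ _ _ _ (fun t => ReC (k t) * P1 t - ImC (k t) * P2 t)
  (fun t => ReC (k t) * P2 t + ImC (k t) * P1 t)).
- by move=> t; rewrite ReCM Re_cint Im_cint.
- by move=> t; rewrite ImCM Re_cint Im_cint.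
- by apply: rintB => //; exact: rint_mul_prim2.
- by apply: rintD => //; exact: rint_mul_prim2.
Qed.

Lemma cint_by_parts :
  cint nu A (fun t => k t * cint mu `[x, t[ h) +
  cint mu A (fun s => h s * cint nu `[x, s[ k) = cint mu A h * cint nu A k.
Proof.
case: hi ki => h1 h2 [k1 k2]; apply: eqCx.
- rewrite [LHS]ReCD [RHS]ReCM !Re_cint !Im_cint.
  have -> : Rintegral nu A (fun t => ReC (k t * cint mu `[x, t[ h)) =
    Rintegral nu A (fun t => ReC (k t) * Rintegral mu `[x, t[ (fun s => ReC (h s)))
    - Rintegral nu A (fun t => ImC (k t) * Rintegral mu `[x, t[ (fun s => ImC (h s))).
    rewrite -RintegralB//; last 2 first.
      exact: rint_mul_prim2.
      exact: rint_mul_prim2.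
    by apply: Rint_eq => t _; rewrite ReCM Re_cint Im_cint.
  have -> : Rintegral mu A (fun t => ReC (h t * cint nu `[x, t[ k)) =
    Rintegral mu A (fun t => ReC (h t) * Rintegral nu `[x, t[ (fun s => ReC (k s)))
    - Rintegral mu A (fun t => ImC (h t) * Rintegral nu `[x, t[ (fun s => ImC (k s))).
    rewrite -RintegralB//; last 2 first.
      exact: rint_mul_prim1.
      exact: rint_mul_prim1.
    by apply: Rint_eq => t _; rewrite ReCM Re_cint Im_cint.
  have := Rint_by_parts muA nuA atoms h1 k1.
  have := Rint_by_parts muA nuA atoms h2 k2.
  lra.
- rewrite [LHS]ImCD [RHS]ImCM !Re_cint !Im_cint.
  have -> : Rintegral nu A (fun t => ImC (k t * cint mu `[x, t[ h)) =
    Rintegral nu A (fun t => ReC (k t) * Rintegral mu `[x, t[ (fun s => ImC (h s)))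
    + Rintegral nu A (fun t => ImC (k t) * Rintegral mu `[x, t[ (fun s => ReC (h s))).
    rewrite -RintegralD//; last 2 first.
      exact: rint_mul_prim2.
      exact: rint_mul_prim2.
    by apply: Rint_eq => t _; rewrite ImCM Re_cint Im_cint.
  have -> : Rintegral mu A (fun t => ImC (h t * cint nu `[x, t[ k)) =
    Rintegral mu A (fun t => ReC (h t) * Rintegral nu `[x, t[ (fun s => ImC (k s)))
    + Rintegral mu A (fun t => ImC (h t) * Rintegral nu `[x, t[ (fun s => ReC (k s))).
    rewrite -RintegralD//; last 2 first.
      exact: rint_mul_prim1.
      exact: rint_mul_prim1.
    by apply: Rint_eq => t _; rewrite ImCM Re_cint Im_cint.
  have := Rint_by_parts muA nuA atoms h1 k2.
  have := Rint_by_parts muA nuA atoms h2 k1.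
  lra.
Qed.

End ComplexByParts.

Section Interval.
Context {R : realType} (D : sldata R).
Hypothesis H : sl_hyp D.
Local Notation a := (sl_a D).
Local Notation b := (sl_b D).
Local Notation I := (Iab D).

Lemma Iab_conv x y t : I x -> I y -> x <= t -> t <= y -> I t.
Proof.
move=> [ax _] [_ yb] xt ty; split.
- by apply: lt_le_trans ax _; rewrite lee_fin.
- by apply: le_lt_trans yb; rewrite lee_fin.
Qed.

Lemma Iab_sub x y : I x -> I y -> `[x, y] `<=` I.
Proof. by move=> Ix Iy t /=; rewrite in_itv/= => /andP[]; exact: Iab_conv. Qed.

Lemma Iab_subo x y : I x -> I y -> `[x, y[ `<=` I.
Proof.
move=> Ix Iy t /=; rewrite in_itv/= => /andP[xt ty].
exact: (Iab_conv Ix Iy xt (ltW ty)).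
Qed.

Lemma Iab_max x y : I x -> I y -> I (Num.max x y).
Proof. by move=> Ix Iy; rewrite /Num.max; case: ifP. Qed.
Lemma Iab_min x y : I x -> I y -> I (Num.min x y).
Proof. by move=> Ix Iy; rewrite /Num.min; case: ifP. Qed.

(** Monotone sequences treat finite and infinite endpoints alike; measurability, dominated
    convergence and Fatou's lemma are run along them. *)
Lemma exhaust_right c : I c -> exists r : nat -> R,
  [/\ forall n, I (r n), forall n, c <= r n, nondecreasing_seq r &
      forall x, I x -> exists n, x < r n].
Proof.
move=> [ac cb]; move Eb : b cb => [B| |] cb //.
- rewrite lte_fin in cb.
  have n0 n : 0 < (n.+1%:R : R) by rewrite ltr0n.
  have rc n : c <= B - (B - c) / n.+1%:R.
    rewrite lerBrDl -lerBrDr ler_pdivrMr//.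
    by apply: ler_peMr; rewrite ?subr_ge0 ?ler1n// ltW.
  exists (fun n => B - (B - c) / n.+1%:R); split => //.
  + move=> n; split; first by apply: (lt_le_trans ac); rewrite lee_fin.
    by rewrite Eb lte_fin ltrBlDr ltrDl divr_gt0// subr_gt0.
  + move=> m n mn; rewrite lerD2l lerN2; apply: ler_wpM2l; first by rewrite subr_ge0 ltW.
    by rewrite lef_pV2 ?posrE// ler_nat.
  + move=> x [_]; rewrite Eb lte_fin => xB.
    have Bx : 0 < (B - x) / (B - c) by rewrite divr_gt0// subr_gt0.
    have [n] := ltr_add_invr Bx; rewrite add0r => nx.
    exists n; rewrite ltrBrDr -ltrBrDl mulrC -ltr_pdivlMr ?subr_gt0//.
- exists (fun n => c + n%:R); split.
  + move=> n; split; last by rewrite Eb ltry.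
    by apply: (lt_le_trans ac); rewrite lee_fin lerDl.
  + by move=> n; rewrite lerDl.
  + by move=> m n mn; rewrite lerD2l ler_nat.
  + move=> x _; exists (Num.bound `|x - c|).
    rewrite -ltrBlDl; apply: (le_lt_trans (ler_norm _)).
    by apply: archi_boundP.
Qed.

Lemma exhaust_left c : I c -> exists r : nat -> R,
  [/\ forall n, I (r n), forall n, r n <= c, nonincreasing_seq r &
      forall x, I x -> exists n, r n < x].
Proof.
move=> [ac cb]; move Ea : a ac => [B| |] ac //.
- rewrite lte_fin in ac.
  have n0 n : 0 < (n.+1%:R : R) by rewrite ltr0n.
  have rc n : B + (c - B) / n.+1%:R <= c.
    rewrite -lerBrDl ler_pdivrMr//.
    by apply: ler_peMr; rewrite ?subr_ge0 ?ler1n// ltW.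
  exists (fun n => B + (c - B) / n.+1%:R); split => //.
  + move=> n; split; last by apply: (le_lt_trans _ cb); rewrite lee_fin.
    by rewrite Ea lte_fin ltrDl divr_gt0// subr_gt0.
  + move=> m n mn; rewrite lerD2l; apply: ler_wpM2l; first by rewrite subr_ge0 ltW.
    by rewrite lef_pV2 ?posrE// ler_nat.
  + move=> x []; rewrite Ea lte_fin => Bx _.
    have Bx' : 0 < (x - B) / (c - B) by rewrite divr_gt0// subr_gt0.
    have [n] := ltr_add_invr Bx'; rewrite add0r => nx.
    exists n; rewrite -ltrBrDl mulrC -ltr_pdivlMr ?subr_gt0//.
- exists (fun n => c - n%:R); split.
  + move=> n; split; first by rewrite Ea ltNyr.
    by apply: (le_lt_trans _ cb); rewrite lee_fin gerBl.
  + by move=> n; rewrite gerBl.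
  + by move=> m n mn; rewrite lerD2l lerN2 ler_nat.
  + move=> x _; exists (Num.bound `|c - x|).
    rewrite ltrBlDr -ltrBlDl; apply: (le_lt_trans (ler_norm _)).
    by apply: archi_boundP.
Qed.

Lemma Iab_nonempty : exists c, I c.
Proof.
case: H => ab _ _ _ _; rewrite /Iab; case: a b ab => [A| |] [B| |]//=.
- rewrite lte_fin => AB; exists ((A + B) / 2); rewrite /= !lte_fin.
  by rewrite midf_lt// midf_lt.
- by move=> _; exists (A + 1); rewrite /= lte_fin ltrDl ltry.
- by move=> _; exists (B - 1); rewrite /= lte_fin gtrBl ltNyr.
- by move=> _; exists 0; rewrite /= ltNyr ltry.
Qed.

Lemma Iab_right x : I x -> exists y, I y /\ x < y.
Proof.
by move=> Ix; have [r [Ir _ _ /(_ _ Ix)[n]]] := exhaust_right Ix; exists (r n).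
Qed.
Lemma Iab_left x : I x -> exists y, I y /\ y < x.
Proof.
by move=> Ix; have [r [Ir _ _ /(_ _ Ix)[n]]] := exhaust_left Ix; exists (r n).
Qed.

Lemma Iab_bigcup : exists l r : nat -> R,
  [/\ forall n, I (l n), forall n, I (r n),
      nonincreasing_seq l, nondecreasing_seq r & I = \bigcup_n `[l n, r n[%classic].
Proof.
have [c Ic] := Iab_nonempty.
have [l [Il _ ldec lex]] := exhaust_left Ic.
have [r [Ir _ rinc rex]] := exhaust_right Ic.
exists l, r; split => //; apply/seteqP; split => [t It|t [n _]]; last exact: Iab_subo.
have [n ln] := lex _ It; have [m rm] := rex _ It.
exists (maxn n m) => //=; rewrite in_itv/=; apply/andP; split.
- by apply: le_trans (ltW ln); apply: ldec; rewrite leq_maxl.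
- by apply: lt_le_trans rm _; apply: rinc; rewrite leq_maxr.
Qed.

Lemma measurable_Iab : measurable I.
Proof.
have [l [r [_ _ _ _ ->]]] := Iab_bigcup.
by apply: bigcup_measurable => n _; exact: measurable_itv.
Qed.

Lemma Iac_bigcup c : I c -> exists l : nat -> R,
  [/\ forall n, I (l n), forall n, l n <= c, nonincreasing_seq l,
    (forall x, I x -> exists n, l n < x) & Iac D c = \bigcup_n `[l n, c[%classic].
Proof.
move=> Ic; have [l [Il lc ldec lex]] := exhaust_left Ic.
exists l; split => //; apply/seteqP; split => [t [at_ tc]|t [n _]] /=.
- have It : I t by split => //; case: Ic => _; apply: le_lt_trans; rewrite lee_fin ltW.
  by have [n ln] := lex _ It; exists n => //=; rewrite in_itv/= (ltW ln).
- by rewrite in_itv/= => /andP[lt tc]; split => //; case: (Il n) => al _;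
    apply: (lt_le_trans al); rewrite lee_fin.
Qed.

Lemma Icb_bigcup c : I c -> exists r : nat -> R,
  [/\ forall n, I (r n), forall n, c <= r n, nondecreasing_seq r,
    (forall x, I x -> exists n, x < r n) & Icb D c = \bigcup_n `]c, r n[%classic].
Proof.
move=> Ic; have [r [Ir cr rinc rex]] := exhaust_right Ic.
exists r; split => //; apply/seteqP; split => [t [ct tb]|t [n _]] /=.
- have It : I t by split => //; case: Ic => + _; move/lt_trans; apply; rewrite lte_fin.
  by have [n rn] := rex _ It; exists n => //=; rewrite in_itv/= ct.
- by rewrite in_itv/= => /andP[ct tr]; split => //; case: (Ir n) => _;
    apply: lt_trans; rewrite lte_fin.
Qed.

Lemma measurable_Iac c : I c -> measurable (Iac D c).
Proof.
move=> /Iac_bigcup[l [_ _ _ _ ->]].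
by apply: bigcup_measurable => n _; exact: measurable_itv.
Qed.
Lemma measurable_Icb c : I c -> measurable (Icb D c).
Proof.
move=> /Icb_bigcup[l [_ _ _ _ ->]].
by apply: bigcup_measurable => n _; exact: measurable_itv.
Qed.

Lemma Iac_sub c : I c -> Iac D c `<=` I.
Proof.
move=> [_ cb] t [at_ tc]; split => //.
by apply: le_lt_trans cb; rewrite lee_fin ltW.
Qed.
Lemma Icb_sub c : I c -> Icb D c `<=` I.
Proof.
move=> [ac _] t [ct tb]; split => //.
by apply: lt_trans ac _; rewrite lte_fin.
Qed.

(** The filter is handled through interior points [c] only, so that the distinction between finite
    and infinite [b] is made once. *)
Lemma near_bP (P : R -> Prop) : (\forall x \near near_b D, P x) <->
  exists c, I c /\ forall x, I x -> c < x -> P x.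
Proof.
rewrite /near_b; have [c0 Ic0] := Iab_nonempty.
have [ac0 c0b] := Ic0; move Eb : b (c0b) => [B| |] // cb.
- rewrite lte_fin in cb; split.
  + move=> [e /= e0 eP].
    have Bc : Num.max c0 (B - e / 2) < B.
      by rewrite gt_max cb ltrBlDr ltrDl divr_gt0.
    exists (Num.max c0 (B - e / 2)); split.
      split; last by rewrite Eb lte_fin.
      by apply: lt_le_trans ac0 _; rewrite lee_fin le_max lexx.
    move=> x [_]; rewrite Eb lte_fin => xB.
    rewrite gt_max => /andP[_ xe]; apply: eP => //=.
    by rewrite gtr0_norm ?subr_gt0//; lra.
  + move=> [c [Ic cP]].
    have cB : c < B by case: Ic; rewrite Eb lte_fin.
    near=> x; apply: cP.
    * split; last by rewrite Eb lte_fin; near: x; exact: nbhs_left_lt.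
      case: Ic => ac _; apply: (lt_trans ac); rewrite lte_fin.
      by near: x; exact: nbhs_left_gt.
    * by near: x; exact: nbhs_left_gt.
- split.
  + move=> [M [_ MP]]; exists (Num.max c0 M); split.
      split; last by rewrite Eb ltry.
      by apply: lt_le_trans ac0 _; rewrite lee_fin le_max lexx.
    by move=> x _; rewrite gt_max => /andP[_]; exact: MP.
  + move=> [c [Ic cP]]; exists c; split => //; first exact: num_real.
    move=> x cx; apply: cP => //; split; last by rewrite Eb ltry.
    by case: Ic => /lt_trans + _; apply; rewrite lte_fin.
Unshelve. all: by end_near. Qed.

Lemma near_aP (P : R -> Prop) : (\forall x \near near_a D, P x) <->
  exists c, I c /\ forall x, I x -> x < c -> P x.
Proof.
rewrite /near_a; have [c0 Ic0] := Iab_nonempty.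
have [ac0 c0b] := Ic0; move Ea : a (ac0) => [A| |] // ac.
- rewrite lte_fin in ac; split.
  + move=> [e /= e0 eP].
    have Ac : A < Num.min c0 (A + e / 2).
      by rewrite lt_min ac ltrDl divr_gt0.
    exists (Num.min c0 (A + e / 2)); split.
      split; first by rewrite Ea lte_fin.
      by apply: le_lt_trans c0b; rewrite lee_fin ge_min lexx.
    move=> x []; rewrite Ea lte_fin => Ax _.
    rewrite lt_min => /andP[_ xe]; apply: eP => //=.
    by rewrite distrC gtr0_norm ?subr_gt0//; lra.
  + move=> [c [Ic cP]].
    have Ac : A < c by case: Ic; rewrite Ea lte_fin.
    near=> x; apply: cP.
    * split; first by rewrite Ea lte_fin; near: x; exact: nbhs_right_gt.
      case: Ic => _; apply: lt_trans; rewrite lte_fin.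
      by near: x; exact: nbhs_right_lt.
    * by near: x; exact: nbhs_right_lt.
- split.
  + move=> [M [_ MP]]; exists (Num.min c0 M); split.
      split; first by rewrite Ea ltNyr.
      by apply: le_lt_trans c0b; rewrite lee_fin ge_min lexx.
    by move=> x _; rewrite lt_min => /andP[_]; exact: MP.
  + move=> [c [Ic cP]]; exists c; split => //; first exact: num_real.
    move=> x cx; apply: cP => //; split; first by rewrite Ea ltNyr.
    by case: Ic => _; apply: lt_trans; rewrite lte_fin.
Unshelve. all: by end_near. Qed.

Lemma near_b_proper : ProperFilter (near_b D).
Proof.
have [c0 [_ c0b]] := Iab_nonempty.
by rewrite /near_b; case: b c0b => [B| |] // _; typeclasses eauto.
Qed.

Lemma near_a_proper : ProperFilter (near_a D).
Proof.
have [c0 [ac0 _]] := Iab_nonempty.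
by rewrite /near_a; case: a ac0 => [B| |] // _; typeclasses eauto.
Qed.

End Interval.

(** * Absolutely continuous functions and the differential expression *)

Section AbsolutelyContinuous.
Context {R : realType} (D : sldata R).
Hypothesis H : sl_hyp D.
Local Notation C := (Cx R).
Local Notation I := (Iab D).
Implicit Types (m : {measure set R -> \bar R}) (f g h : R -> C).

Definition locfin m := forall x y, I x -> I y -> (m `[x, y]%classic < +oo)%E.

Lemma locfin_rho_p : locfin (rho_p D).
Proof. by case: H => _ + _ _ _ x y Ix Iy => /(_ x y Ix Iy)[]. Qed.
Lemma locfin_rho_n : locfin (rho_n D).
Proof. by case: H => _ + _ _ _ x y Ix Iy => /(_ x y Ix Iy)[]. Qed.
Lemma locfin_sigma : locfin (sigma D).
Proof. by case: H => _ + _ _ _ x y Ix Iy => /(_ x y Ix Iy)[]. Qed.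
Lemma locfin_chi : locfin (chi D).
Proof. by case: H => _ + _ _ _ x y Ix Iy => /(_ x y Ix Iy)[]. Qed.

Lemma sub_itvoc (x y : R) : `[x, y[ `<=` `[x, y]%classic.
Proof. by move=> t /=; rewrite !in_itv/= => /andP[-> /ltW]. Qed.

Lemma locfin_co m x y : locfin m -> I x -> I y -> (m `[x, y[%classic < +oo)%E.
Proof.
move=> fm Ix Iy; apply: le_lt_trans (fm x y Ix Iy).
by apply: le_measure; rewrite ?inE//; exact: sub_itvoc.
Qed.

Lemma atoms_chi t : I t -> sigma D [set t] = 0%E \/ chi D [set t] = 0%E.
Proof. by case: H => _ _ _ _ /(_ t) h /h[]. Qed.

(** The hypothesis on the data only gives [rho_p = rho_n] at the point [t]. The two measures are
    carried by complementary sets, so one of them vanishes at [t], hence both do. *)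
Lemma atoms_rho t : I t -> sigma D [set t] = 0%E \/
  (rho_p D [set t] = 0%E /\ rho_n D [set t] = 0%E).
Proof.
case: H => _ _ [P [mP [nP pP]]] _ /(_ t) h /h[_ [|e]]; first by left.
have z m (Q : set R) : measurable Q -> m Q = 0%E -> Q t -> m [set t] = 0%E.
  move=> mQ Q0 Qt; apply/eqP; rewrite eq_le measure_ge0 andbT -Q0.
  by apply: le_measure; rewrite ?inE// => _ ->.
right; have [Pt|nPt] := pselect (P t).
- by rewrite e (z _ _ mP nP Pt).
- by rewrite -e (z _ _ (measurableC mP) pP nPt).
Qed.

Lemma L1loc_co m h x y : L1loc D m h -> I x -> I y -> cintegrable m `[x, y[ h.
Proof.
move=> hi Ix Iy; apply: cable_sub (hi x y Ix Iy) => //; exact: sub_itvoc.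
Qed.

(** Increments over [[x, y[] absorb both the base point and the sign convention of [sint]. *)
Lemma sint_incr m h c x y : L1loc D m h -> I c -> I x -> I y -> x <= y ->
  sint m c y h - sint m c x h = cint m `[x, y[ h.
Proof.
move=> hi Ic Ix Iy xy; rewrite /sint.
have [cx|xc|cx] := ltgtP c x.
- rewrite (lt_le_trans cx xy) (cint_itv_cat (ltW cx) xy (L1loc_co hi Ic Iy)).
  by rewrite addrC addKr.
- have [cy|yc|cy] := ltgtP c y.
  + rewrite (cint_itv_cat (ltW xc) (ltW cy) (L1loc_co hi Ix Iy)).
    by rewrite opprK addrC.
  + rewrite (cint_itv_cat xy (ltW yc) (L1loc_co hi Ix Ic)).
    by rewrite opprK addrC addrK.
  + by rewrite cy sub0r opprK.
- move: xy; rewrite -cx => xy.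
  rewrite subr0; have [cy|yc|cy] := ltgtP c y => //.
  + by move: (lt_le_trans yc xy); rewrite ltxx.
  + by rewrite cy set_itvco0 cint_set0.
Qed.

Lemma isAC_incr m f h x y : isAC D m f h -> I x -> I y -> x <= y ->
  f y - f x = cint m `[x, y[ h.
Proof.
move=> [hi [c [Ic fE]]] Ix Iy xy; rewrite (fE y)// (fE x)//.
by rewrite opprD addrACA subrr add0r sint_incr.
Qed.

Lemma sint_cc m h c : sint m c c h = 0.
Proof. by rewrite /sint ltxx eqxx. Qed.

(** Together with [isAC_incr] this replaces the definition with its base point by a condition on
    increments, which is stable under linear operations and limits. *)
Lemma isAC_intro m f h : L1loc D m h ->
  (forall x y, I x -> I y -> x <= y -> f y - f x = cint m `[x, y[ h) ->
  isAC D m f h.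
Proof.
move=> hi fE; split=> //; have [c Ic] := Iab_nonempty H; exists c; split => // x Ix.
have [cx|xc] := leP c x.
- by rewrite -(subr0 (sint _ _ _ _)) -(sint_cc m h c) sint_incr// -fE// addrC subrK.
- have := sint_incr hi Ic Ix Ic (ltW xc); rewrite sint_cc sub0r -fE// ?ltW//.
  by move=> /(congr1 -%R); rewrite opprK => ->; rewrite opprB addrC subrK.
Qed.

Lemma isAC_sint m h c : L1loc D m h -> I c -> isAC D m (fun x => sint m c x h) h.
Proof.
move=> hi Ic; split => //; exists c; split => // x Ix.
by rewrite sint_cc add0r.
Qed.

(** Atoms destroy continuity, so the local boundedness that makes all integrals over compact
    intervals finite is carried along as a property of its own. *)
Definition locb f := cmeas I f /\
  forall x y, I x -> I y -> exists B, forall t, x <= t -> t <= y -> nrm (f t) <= B.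

Lemma locb_eq f g : (forall t, I t -> f t = g t) -> locb f -> locb g.
Proof.
move=> fg [mf bf]; split; first exact: cmeas_eq mf.
move=> x y Ix Iy; have [B fB] := bf _ _ Ix Iy; exists B => t xt ty.
by rewrite -fg ?fB//; exact: (Iab_conv Ix Iy).
Qed.

Lemma locbD f g : locb f -> locb g -> locb (fun t => f t + g t).
Proof.
move=> [mf bf] [mg bg]; split; first exact: cmeasD.
move=> x y Ix Iy; have [B fB] := bf _ _ Ix Iy; have [B' gB] := bg _ _ Ix Iy.
exists (B + B') => t xt ty; apply: (le_trans (le_nrmD _ _)).
by rewrite lerD ?fB ?gB.
Qed.

Lemma locbM f g : locb f -> locb g -> locb (fun t => f t * g t).
Proof.
move=> [mf bf] [mg bg]; split; first exact: cmeasM.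
move=> x y Ix Iy; have [B fB] := bf _ _ Ix Iy; have [B' gB] := bg _ _ Ix Iy.
exists (B * B') => t xt ty; rewrite nrmM.
by rewrite ler_pM ?nrm_ge0 ?fB ?gB.
Qed.

Lemma locb_cst (k : C) : locb (fun=> k).
Proof. by split; [exact: cmeas_cst|move=> x y _ _; exists (nrm k)]. Qed.

Lemma locbZ (k : C) f : locb f -> locb (fun t => k * f t).
Proof. exact/locbM/locb_cst. Qed.

Lemma locbN f : locb f -> locb (fun t => - f t).
Proof.
move=> lf; apply: locb_eq (locbZ (-1) lf) => t _; exact: mulN1r.
Qed.

Lemma locb_itv f x y : locb f -> I x -> I y ->
  exists B, forall t, `[x, y[%classic t -> nrm (f t) <= B.
Proof.
move=> [_ bf] Ix Iy; have [B fB] := bf x y Ix Iy; exists B => t /=.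
by rewrite in_itv/= => /andP[xt ty]; rewrite fB// ltW.
Qed.

Lemma locb_L1loc m f : locfin m -> locb f -> L1loc D m f.
Proof.
move=> lm [mf bf] x y Ix Iy; have [B fB] := bf x y Ix Iy.
apply: (@cable_bounded _ _ _ _ B) => //; first exact: lm.
- exact: cmeas_sub (measurable_Iab H) (Iab_sub Ix Iy) mf.
- by move=> t /=; rewrite in_itv/= => /andP[]; exact: fB.
Qed.

Lemma locb_L1locM m f h : locb f -> L1loc D m h -> L1loc D m (fun t => f t * h t).
Proof.
move=> [mf bf] hi x y Ix Iy; have [B fB] := bf x y Ix Iy.
apply: (@cable_bM _ _ _ _ _ B) => //; last exact: hi.
- exact: cmeas_sub (measurable_Iab H) (Iab_sub Ix Iy) mf.
- by move=> t /=; rewrite in_itv/= => /andP[]; exact: fB.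
Qed.

Lemma isAC_locb m f h : locfin m -> isAC D m f h -> locb f.
Proof.
move=> lm fh; have [hi _] := fh; split; last first.
  move=> x y Ix Iy.
  pose g t := `|ReC (h t)| + `|ImC (h t)|.
  have gi : rint m `[x, y] g.
    by have [h1 h2] := hi x y Ix Iy; apply: rintD => //; exact: rint_norm.
  exists (nrm (f x) + 2 * Rintegral m `[x, y] g) => t xt ty.
  have It : I t by exact: (Iab_conv Ix Iy).
  have sub : `[x, t[ `<=` `[x, y]%classic.
    move=> s /=; rewrite !in_itv/= => /andP[-> st]/=.
    exact: le_trans (ltW st) ty.
  rewrite -(subrK (f x) (f t)) (isAC_incr fh)// addrC.
  apply: (le_trans (le_nrmD _ _)); rewrite lerD2l.
  have gi' : rint m `[x, t[ g by exact: rint_sub gi.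
  apply: (@le_trans _ _ (2 * Rintegral m `[x, t[ g)).
    apply: nrm_cint_le => //; first exact: L1loc_co.
    by move=> s _; exact: nrm_le_ReIm.
  by rewrite ler_pM2l// Rint_ge0_sub// => s _; rewrite addr_ge0.
have [l [r [Il Ir _ _ IE]]] := Iab_bigcup H.
have key n : cmeas `[l n, r n[ f.
  apply: (@cmeas_eq _ _ (fun t => f (l n) + cint m `[l n, t[ h)).
    move=> t /=; rewrite in_itv/= => /andP[lt tr].
    rewrite -(isAC_incr fh) ?Il//; first by rewrite addrC subrK.
    exact: (Iab_conv (Il n) (Ir n) lt (ltW tr)).
  apply: cmeasD; first exact: cmeas_cst.
  apply: cmeas_prim; first exact: locfin_co.
  exact: L1loc_co.
split; rewrite IE; apply/measurable_fun_bigcup => n //; first by have [] := key n.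
by have [] := key n.
Qed.

Lemma isAC_add m f g h k (c : C) : isAC D m f h -> isAC D m g k ->
  isAC D m (fun x => f x + c * g x) (fun x => h x + c * k x).
Proof.
move=> fh gk; have [hi _] := fh; have [ki _] := gk.
apply: isAC_intro => [x y Ix Iy|x y Ix Iy xy].
- by apply: cableD => //; [exact: hi|apply: cableZ => //; exact: ki].
- have hi' := L1loc_co hi Ix Iy; have ki' := L1loc_co ki Ix Iy.
  rewrite cintD ?cintZ//; last exact: cableZ.
  rewrite -(isAC_incr fh)// -(isAC_incr gk)//; ring.
Qed.

Lemma isAC_Z m f h (c : C) : isAC D m f h ->
  isAC D m (fun x => c * f x) (fun x => c * h x).
Proof.
move=> fh; have [hi _] := fh.
apply: isAC_intro => [x y Ix Iy|x y Ix Iy xy].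
- by apply: cableZ => //; exact: hi.
- by rewrite cintZ//; [rewrite -(isAC_incr fh)// mulrBr|exact: L1loc_co].
Qed.

Lemma isAC_conj m f h : isAC D m f h ->
  isAC D m (fun x => cconj (f x)) (fun x => cconj (h x)).
Proof.
move=> fh; have [hi _] := fh.
apply: isAC_intro => [x y Ix Iy|x y Ix Iy xy].
- by apply: cable_conj => //; exact: hi.
- by rewrite cint_conj//; [rewrite -(isAC_incr fh)// cconjB|exact: L1loc_co].
Qed.

Lemma isAC_eq m f g h : (forall x, I x -> f x = g x) -> isAC D m f h ->
  isAC D m g h.
Proof.
move=> fg fh; have [hi _] := fh; apply: isAC_intro => // x y Ix Iy xy.
by rewrite -!fg// (isAC_incr fh).
Qed.

Definition crho A h := cint (rho_p D) A h - cint (rho_n D) A h.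

Lemma locb_rho f : locb f -> L1loc_rho D f.
Proof.
by move=> lf; split; apply: locb_L1loc => //; [exact: locfin_rho_p|exact: locfin_rho_n].
Qed.

Lemma tau_ac f f1 ft : is_tau D f f1 ft -> isAC D (sigma D) f f1.
Proof. by case. Qed.

Lemma tau_rho f f1 ft : is_tau D f f1 ft -> L1loc_rho D ft.
Proof. by case=> _ [_ [c [_ []]]]. Qed.

Lemma tau_locb f f1 ft : is_tau D f f1 ft -> locb f.
Proof. by move/tau_ac; exact/isAC_locb/locfin_sigma. Qed.

(** The equation in the integrated form [d f1 = f dchi - ft drho]; with [tau_intro] it eliminates
    the two base points hidden in [is_tau]. *)
Lemma tau_incr f f1 ft x y : is_tau D f f1 ft -> I x -> I y -> x <= y ->
  f1 y - f1 x = cint (chi D) `[x, y[ f - crho `[x, y[ ft.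
Proof.
move=> [_ [fl [c [Ic [[pl nl] [c' [Ic' fE]]]]]]] Ix Iy xy.
have := fE y Iy; have := fE x Ix; rewrite /sint_rho => ex ey.
rewrite -(sint_incr fl Ic Ix Iy xy) /crho.
rewrite -(sint_incr pl Ic' Ix Iy xy) -(sint_incr nl Ic' Ix Iy xy).
have {}ex : f1 x = sint (chi D) c x f - (- f1 c' + sint (chi D) c c' f +
    (sint (rho_p D) c' x ft - sint (rho_n D) c' x ft)) by rewrite -ex; ring.
have {}ey : f1 y = sint (chi D) c y f - (- f1 c' + sint (chi D) c c' f +
    (sint (rho_p D) c' y ft - sint (rho_n D) c' y ft)) by rewrite -ey; ring.
by rewrite ex ey; ring.
Qed.

Lemma tau_intro f f1 ft : isAC D (sigma D) f f1 -> L1loc_rho D ft ->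
  (forall x y, I x -> I y -> x <= y ->
     f1 y - f1 x = cint (chi D) `[x, y[ f - crho `[x, y[ ft) ->
  is_tau D f f1 ft.
Proof.
move=> ac [pl nl] fE.
have fl : L1loc D (chi D) f by exact/locb_L1loc/isAC_locb/ac/locfin_sigma/locfin_chi.
have [c Ic] := Iab_nonempty H.
split => //; split => //; exists c; split => //; split => //.
exists c; split => // x Ix; rewrite sint_cc addr0 /sint_rho.
have [cx|/ltW xc] := leP c x.
- have := fE c x Ic Ix cx; rewrite /crho.
  rewrite -(sint_incr fl Ic Ic Ix cx) -(sint_incr pl Ic Ic Ix cx) -(sint_incr nl Ic Ic Ix cx).
  rewrite !sint_cc !subr0 => /eqP; rewrite subr_eq => /eqP ->; ring.
- have := fE x c Ix Ic xc; rewrite /crho.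
  rewrite -(sint_incr fl Ic Ix Ic xc) -(sint_incr pl Ic Ix Ic xc) -(sint_incr nl Ic Ix Ic xc).
  rewrite !sint_cc !sub0r => /eqP; rewrite subr_eq => /eqP ->; ring.
Qed.

(** No single measure makes [f1] absolutely continuous; it is a constant plus primitives for [chi],
    [rho_p] and [rho_n], each of which is locally bounded. *)
Lemma tau_locb1 f f1 ft : is_tau D f f1 ft -> locb f1.
Proof.
move=> tf; have [_ [fl _]] := tf; have [pl nl] := tau_rho tf.
have [c Ic] := Iab_nonempty H.
apply: (@locb_eq (fun x => f1 c + (sint (chi D) c x f +
    - (sint (rho_p D) c x ft + - sint (rho_n D) c x ft)))).
  move=> x Ix; have [cx|/ltW xc] := leP c x.
  - have := tau_incr tf Ic Ix cx; rewrite /crho.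
    rewrite -(sint_incr fl Ic Ic Ix cx) -(sint_incr pl Ic Ic Ix cx) -(sint_incr nl Ic Ic Ix cx).
    by rewrite !sint_cc !subr0 => /eqP; rewrite subr_eq => /eqP ->; ring.
  - have := tau_incr tf Ix Ic xc; rewrite /crho.
    rewrite -(sint_incr fl Ic Ix Ic xc) -(sint_incr pl Ic Ix Ic xc) -(sint_incr nl Ic Ix Ic xc).
    by rewrite !sint_cc !sub0r => /eqP; rewrite subr_eq => /eqP ->; ring.
apply: locbD; first exact: locb_cst.
apply: locbD; first exact: isAC_locb locfin_chi (isAC_sint fl Ic).
apply/locbN/locbD; first exact: isAC_locb locfin_rho_p (isAC_sint pl Ic).
apply/locbN; exact: isAC_locb locfin_rho_n (isAC_sint nl Ic).
Qed.

Lemma crhoD A f g : measurable A ->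
  cintegrable (rho_p D) A f -> cintegrable (rho_n D) A f ->
  cintegrable (rho_p D) A g -> cintegrable (rho_n D) A g ->
  crho A (fun t => f t + g t) = crho A f + crho A g.
Proof. by move=> mA fp fn gp gn; rewrite /crho !cintD//; ring. Qed.

Lemma crhoZ A (c : C) f : measurable A ->
  cintegrable (rho_p D) A f -> cintegrable (rho_n D) A f ->
  crho A (fun t => c * f t) = c * crho A f.
Proof. by move=> mA fp fn; rewrite /crho !cintZ//; ring. Qed.

Lemma crho_eq A f g : (forall t, A t -> f t = g t) -> crho A f = crho A g.
Proof. by move=> fg; rewrite /crho !(cint_eq _ fg). Qed.

Lemma tau_add f f1 ft g g1 gt (c : C) : is_tau D f f1 ft -> is_tau D g g1 gt ->
  is_tau D (fun x => f x + c * g x) (fun x => f1 x + c * g1 x)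
    (fun x => ft x + c * gt x).
Proof.
move=> tf tg; have [fp fn] := tau_rho tf; have [gp gn] := tau_rho tg.
apply: tau_intro; first by apply: isAC_add; [exact: tau_ac tf|exact: tau_ac tg].
- split=> x y Ix Iy; apply: cableD => //.
  + exact: fp. + by apply: cableZ => //; exact: gp.
  + exact: fn. + by apply: cableZ => //; exact: gn.
- move=> x y Ix Iy xy.
  have fl := L1loc_co (locb_L1loc locfin_chi (tau_locb tf)) Ix Iy.
  have gl := L1loc_co (locb_L1loc locfin_chi (tau_locb tg)) Ix Iy.
  have fp' := L1loc_co fp Ix Iy; have fn' := L1loc_co fn Ix Iy.
  have gp' := L1loc_co gp Ix Iy; have gn' := L1loc_co gn Ix Iy.
  rewrite cintD ?cintZ//; last exact: cableZ.
  rewrite crhoD ?crhoZ//; [|exact: cableZ|exact: cableZ].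
  have := tau_incr tf Ix Iy xy; have := tau_incr tg Ix Iy xy.
  move=> /eqP; rewrite subr_eq => /eqP -> /eqP; rewrite subr_eq => /eqP ->.
  by ring.
Qed.

Lemma tau_eq f f1 ft g g1 gt : (forall x, I x -> f x = g x) ->
  (forall x, I x -> f1 x = g1 x) -> (forall x, I x -> ft x = gt x) ->
  is_tau D f f1 ft -> is_tau D g g1 gt.
Proof.
move=> fg fg1 fgt tf; have [fp fn] := tau_rho tf.
have le_eq m h k : (forall x, I x -> h x = k x) -> L1loc D m h -> L1loc D m k.
  move=> hk hi x y Ix Iy; apply: cable_eq (hi x y Ix Iy) => // t.
  by move/(Iab_sub Ix Iy)/hk.
have ac := isAC_eq fg (tau_ac tf).
apply: tau_intro.
- apply: isAC_intro; first by apply: le_eq fg1 _; case: ac.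
  move=> x y Ix Iy xy; rewrite (isAC_incr ac)//; apply: cint_eq => t.
  by move/(Iab_subo Ix Iy)/fg1.
- by split; [exact: le_eq fp|exact: le_eq fn].
- move=> x y Ix Iy xy; rewrite -!fg1// (tau_incr tf)//; congr (_ - _).
  + by apply: cint_eq => t /(Iab_subo Ix Iy)/fg.
  + by apply: crho_eq => t /(Iab_subo Ix Iy)/fgt.
Qed.

Lemma tau_Z f f1 ft (c : C) : is_tau D f f1 ft ->
  is_tau D (fun x => c * f x) (fun x => c * f1 x) (fun x => c * ft x).
Proof.
move=> tf; have := tau_add (c - 1) tf tf.
by apply: tau_eq => x _; ring.
Qed.

Lemma tau_conj f f1 ft : is_tau D f f1 ft ->
  is_tau D (fun x => cconj (f x)) (fun x => cconj (f1 x)) (fun x => cconj (ft x)).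
Proof.
move=> tf; have [fp fn] := tau_rho tf.
apply: tau_intro; first by apply: isAC_conj; exact: (tau_ac tf).
- by split=> x y Ix Iy; apply: cable_conj => //; [exact: fp|exact: fn].
- move=> x y Ix Iy xy.
  have fl := L1loc_co (locb_L1loc locfin_chi (tau_locb tf)) Ix Iy.
  have fp' := L1loc_co fp Ix Iy; have fn' := L1loc_co fn Ix Iy.
  by rewrite /crho !cint_conj// -!cconjB (tau_incr tf).
Qed.

End AbsolutelyContinuous.

(** * Product rule, Lagrange identity and Wronskian *)

Section Lagrange.
Context {R : realType} (D : sldata R).
Hypothesis H : sl_hyp D.
Local Notation C := (Cx R).
Local Notation I := (Iab D).
Implicit Types (m : {measure set R -> \bar R}) (f g h u : R -> C).

Section OneMeasure.
Variables (m : {measure set R -> \bar R}) (F F1 k : R -> C) (x y : R).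
Hypotheses (lm : locfin D m)
  (atoms : forall t, I t -> sigma D [set t] = 0%E \/ m [set t] = 0%E)
  (ac : isAC D (sigma D) F F1) (kl : L1loc D m k)
  (Ix : I x) (Iy : I y) (xy : x <= y).
Local Notation A := (`[x, y[%classic : set R).

Let sA : (sigma D A < +oo)%E. Proof. exact: (locfin_co (locfin_sigma H) Ix Iy). Qed.
Let mA : (m A < +oo)%E. Proof. exact: (locfin_co lm Ix Iy). Qed.
Let at' t : A t -> sigma D [set t] = 0%E \/ m [set t] = 0%E.
Proof. by move/(Iab_subo Ix Iy)/atoms. Qed.
Let Fi : cintegrable (sigma D) A F1.
Proof. by case: ac => F1l _; exact: (L1loc_co F1l Ix Iy). Qed.
Let ki : cintegrable m A k. Proof. exact: (L1loc_co kl Ix Iy). Qed.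

Lemma prim_cable : cintegrable (sigma D) A (fun t => F1 t * cint m `[x, t[ k).
Proof. exact: cable_mul_prim1. Qed.

(** The measures making up [d g1], namely [chi], [rho_p] and [rho_n], are treated one at a time, as
    each shares no atom with [sigma]. The primitive of [k] starts at [x], which leaves a boundary
    term at [y] only. *)
Lemma prim_by_parts : cint m A (fun t => F t * k t) +
  cint (sigma D) A (fun t => F1 t * cint m `[x, t[ k) = F y * cint m A k.
Proof.
have := cint_by_parts sA mA at' Fi ki.
rewrite -(isAC_incr ac)// => E.
have i2 := cable_mul_prim2 sA mA Fi ki.
rewrite (_ : cint m A (fun t => F t * k t) =
    cint m A (fun t => k t * cint (sigma D) `[x, t[ F1 + F x * k t)); last first.
  apply: cint_eq => t At; have It := Iab_subo Ix Iy At.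
  move: At; rewrite /= in_itv/= => /andP[xt _].
  by rewrite -(isAC_incr ac)//; ring.
rewrite cintD// ?cintZ//; last exact: cableZ.
by rewrite addrAC E; ring.
Qed.

End OneMeasure.

Let at_p t : I t -> sigma D [set t] = 0%E \/ rho_p D [set t] = 0%E.
Proof. by move=> /(atoms_rho H)[|[]]; [left|right]. Qed.
Let at_n t : I t -> sigma D [set t] = 0%E \/ rho_n D [set t] = 0%E.
Proof. by move=> /(atoms_rho H)[|[]]; [left|right]. Qed.

(** The product rule [d(F g1) = F1 g1 dsigma + F d g1] with [d g1 = g dchi - gt drho]. *)
Lemma tau_prod F F1 g g1 gt x y : isAC D (sigma D) F F1 -> is_tau D g g1 gt ->
  I x -> I y -> x <= y ->
  F y * g1 y - F x * g1 x = cint (sigma D) `[x, y[ (fun t => F1 t * g1 t) +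
    cint (chi D) `[x, y[ (fun t => F t * g t) -
    crho D `[x, y[ (fun t => F t * gt t).
Proof.
move=> ac tg Ix Iy xy.
have gl := locb_L1loc H (locfin_chi H) (tau_locb H tg).
have [gp gn] := tau_rho tg.
have ec := prim_by_parts (locfin_chi H) (@atoms_chi _ _ H) ac gl Ix Iy xy.
have ep := prim_by_parts (locfin_rho_p H) at_p ac gp Ix Iy xy.
have en := prim_by_parts (locfin_rho_n H) at_n ac gn Ix Iy xy.
have ic := prim_cable (locfin_chi H) ac gl Ix Iy.
have ip := prim_cable (locfin_rho_p H) ac gp Ix Iy.
have i_n := prim_cable (locfin_rho_n H) ac gn Ix Iy.
have F1i : cintegrable (sigma D) `[x, y[ F1 by case: ac => F1l _; exact: (L1loc_co F1l Ix Iy).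
(* Inserting [g1 t = g1 x +] primitives from the integrated equation brings every term into the form
   of [prim_by_parts]. *)
rewrite (_ : cint (sigma D) `[x, y[ (fun t => F1 t * g1 t) =
   cint (sigma D) `[x, y[ (fun t => g1 x * F1 t +
     (F1 t * cint (chi D) `[x, t[ g + (F1 t * cint (rho_n D) `[x, t[ gt
       - F1 t * cint (rho_p D) `[x, t[ gt)))); last first.
  apply: cint_eq => t At; have It := Iab_subo Ix Iy At.
  move: At; rewrite /= in_itv/= => /andP[xt _].
  have := tau_incr tg Ix It xt; rewrite /crho => /eqP.
  by rewrite subr_eq => /eqP ->; ring.
rewrite cintD//; last 2 first.
- exact: cableZ.
- by apply: cableD => //; apply: cableB.
rewrite cintD//; last exact: cableB.
rewrite cintB// cintZ// -(isAC_incr ac)// /crho.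
have := tau_incr tg Ix Iy xy; rewrite /crho => /eqP.
rewrite subr_eq => /eqP ->.
move: ec ep en.
set Jc := cint (chi D) _ (fun t => F t * g t).
set Kc := cint (sigma D) _ _; set Gc := cint (chi D) _ g.
set Jp := cint (rho_p D) _ (fun t => F t * gt t).
set Kp := cint (sigma D) _ _; set Gp := cint (rho_p D) _ gt.
set Jn := cint (rho_n D) _ (fun t => F t * gt t).
set Kn := cint (sigma D) _ _; set Gn := cint (rho_n D) _ gt.
move=> /(canRL (addrK _)) -> /(canRL (addrK _)) -> /(canRL (addrK _)) ->.
ring.
Qed.

(** The product rule for [ft g1] and for [gt f1] produces the same integral of [ft gt] against
    [rho], which cancels. Only [sigma] and [chi] remain, so the form [V] is controlled by H^1
    norms. *)
Lemma lagrange_identity f f1 ft ft1 g g1 gt gt1 x y :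
  is_tau D f f1 ft -> isAC D (sigma D) ft ft1 ->
  is_tau D g g1 gt -> isAC D (sigma D) gt gt1 ->
  I x -> I y -> x <= y ->
  Vw f1 ft g1 gt y - Vw f1 ft g1 gt x =
  cint (sigma D) `[x, y[ (fun t => ft1 t * g1 t - f1 t * gt1 t) +
  cint (chi D) `[x, y[ (fun t => ft t * g t - f t * gt t).
Proof.
move=> tf af tg ag Ix Iy xy.
have E1 := tau_prod af tg Ix Iy xy.
have E2 := tau_prod ag tf Ix Iy xy.
have itv_sub := Iab_subo Ix Iy.
have bM m (p q : R -> C) : locfin D m -> locb D p -> locb D q ->
    cintegrable m `[x, y[ (fun t => p t * q t).
  move=> lm lp lq; have := L1loc_co (locb_L1loc H lm (locbM lp lq)) Ix Iy; exact.
have bL (p q : R -> C) : locb D p -> L1loc D (sigma D) q ->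
    cintegrable (sigma D) `[x, y[ (fun t => p t * q t).
  move=> lp lq; have := L1loc_co (locb_L1locM H lp lq) Ix Iy; exact.
have lf := tau_locb H tf; have lg := tau_locb H tg.
have lf1 := tau_locb1 H tf; have lg1 := tau_locb1 H tg.
have lft := isAC_locb H (locfin_sigma H) af.
have lgt := isAC_locb H (locfin_sigma H) ag.
rewrite cintB//; last 2 first.
- apply: (@cable_eq _ _ _ (fun t => g1 t * ft1 t)) => //.
    by move=> t _; rewrite mulrC.
  by apply: bL => //; case: af.
- by apply: bL => //; case: ag.
rewrite cintB//; last 2 first.
- by apply: bM => //; exact: locfin_chi.
- by apply: bM => //; exact: locfin_chi.
rewrite /Vw.
rewrite (_ : cint (sigma D) _ (fun t => f1 t * gt1 t) =
  cint (sigma D) `[x, y[ (fun t => gt1 t * f1 t)); last first.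
  by apply: cint_eq => t _; rewrite mulrC.
rewrite (_ : cint (chi D) _ (fun t => f t * gt t) =
  cint (chi D) `[x, y[ (fun t => gt t * f t)); last first.
  by apply: cint_eq => t _; rewrite mulrC.
have -> : ft y * g1 y - f1 y * gt y - (ft x * g1 x - f1 x * gt x) =
  (ft y * g1 y - ft x * g1 x) - (gt y * f1 y - gt x * f1 x) by ring.
rewrite E1 E2.
have -> : crho D `[x, y[ (fun t => gt t * ft t) =
  crho D `[x, y[ (fun t => ft t * gt t).
  by apply: crho_eq => t _; rewrite mulrC.
ring.
Qed.

(** The classical Wronskian. For two solutions with parameter [z] it equals [V / z]; in general its
    increments involve [rho] alone, whereas those of [V] involve [sigma] and [chi] alone. *)
Definition Wr f f1 g g1 (x : R) : C := f x * g1 x - f1 x * g x.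

Lemma wronskian_incr f f1 ft g g1 gt x y :
  is_tau D f f1 ft -> is_tau D g g1 gt -> I x -> I y -> x <= y ->
  Wr f f1 g g1 y - Wr f f1 g g1 x =
  crho D `[x, y[ (fun t => g t * ft t - f t * gt t).
Proof.
move=> tf tg Ix Iy xy.
have E1 := tau_prod (tau_ac tf) tg Ix Iy xy.
have E2 := tau_prod (tau_ac tg) tf Ix Iy xy.
have lf := tau_locb H tf; have lg := tau_locb H tg.
have [fp fn] := tau_rho tf; have [gp gn] := tau_rho tg.
have -> : crho D `[x, y[ (fun t => g t * ft t - f t * gt t) =
    crho D `[x, y[ (fun t => g t * ft t) - crho D `[x, y[ (fun t => f t * gt t).
  have bL m (p q : R -> C) : locb D p -> L1loc D m q ->
      cintegrable m `[x, y[ (fun t => p t * q t).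
    by move=> lp lq; exact: (L1loc_co (locb_L1locM H lp lq) Ix Iy).
  rewrite /crho !cintB; try exact: measurable_itv; try exact: bL; ring.
rewrite /Wr.
have -> : f y * g1 y - f1 y * g y - (f x * g1 x - f1 x * g x) =
  (f y * g1 y - f x * g1 x) - (g y * f1 y - g x * f1 x) by ring.
rewrite E1 E2.
rewrite (_ : cint (sigma D) _ (fun t => f1 t * g1 t) =
  cint (sigma D) `[x, y[ (fun t => g1 t * f1 t)); last first.
  by apply: cint_eq => t _; rewrite mulrC.
rewrite (_ : cint (chi D) _ (fun t => f t * g t) =
  cint (chi D) `[x, y[ (fun t => g t * f t)); last first.
  by apply: cint_eq => t _; rewrite mulrC.
ring.
Qed.

Lemma crho0 (A : set R) h : (forall t, A t -> h t = 0) -> crho D A h = 0.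
Proof.
move=> h0; rewrite (crho_eq D h0) /crho.
suff E (m : {measure set R -> \bar R}) : cint m A (fun=> 0 : C) = 0.
  by rewrite !E subr0.
by apply: eqCx; rewrite ?Re_cint ?Im_cint /Rintegral/= integral0.
Qed.

(** Cramer's rule; the determinant [z^-1] is the normalisation [V(th, ph) = 1]. *)
Lemma fundamental_reconstruct (z : C) th th1 ph ph1 u u1 (x : R) :
  z != 0 -> Wr th th1 ph ph1 x = z^-1 ->
  u x = z * (Wr u u1 ph ph1 x * th x - Wr u u1 th th1 x * ph x) /\
  u1 x = z * (Wr u u1 ph ph1 x * th1 x - Wr u u1 th th1 x * ph1 x).
Proof.
move=> z0 W.
have e1 : u x = z * (u x * Wr th th1 ph ph1 x) by rewrite W mulrCA divff// mulr1.
have e2 : u1 x = z * (u1 x * Wr th th1 ph ph1 x) by rewrite W mulrCA divff// mulr1.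
by split; [rewrite {1}e1|rewrite {1}e2]; rewrite /Wr; ring.
Qed.

End Lagrange.

(** * Limits of complex functions along a filter *)

Section ComplexLimits.
Context {R : realType}.
Local Notation C := (Cx R).

Lemma cvgCxP {T : Type} (G : set_system T) {FG : Filter G} (F : T -> C) (l : C) :
  F @ G --> l <-> forall e : R, 0 < e -> \forall x \near G, nrm (F x - l) < e.
Proof.
split.
- move=> Fl e e0.
  have e0' : 0 < RtoC e by rewrite -[0]/(RtoC 0) RtoC_lt.
  move/cvgrPdist_lt: Fl => /(_ _ e0').
  apply: filterS => x; rewrite nrmE RtoC_lt => h.
  by rewrite -nrmN opprB.
- move=> h; apply/cvgrPdist_lt => e e0.
  have [r r0 re] : exists2 r : R, 0 < r & RtoC r = e.
    exists (ReC e).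
      by move: e0; case: e => x y /=; rewrite ltcE => /andP[].
    move: e0; case: e => x y /=; rewrite ltcE => /andP[/= /eqP -> _].
    by apply: eqCx.
  near=> x; rewrite nrmE -re RtoC_lt -nrmN opprB.
  by near: x; exact: h.
Unshelve. all: by end_near. Qed.

Lemma cvgCx_lin0 {T : Type} (G : set_system T) {FG : Filter G} (F F1 F2 : T -> C) (m k l : C) :
  F1 @ G --> k -> F2 @ G --> l -> k + m * l = 0 -> (forall x, F x = F1 x + m * F2 x) ->
  F @ G --> (0 : C).
Proof.
move=> /cvgCxP hF /cvgCxP hG kl FE; apply/cvgCxP => e e0.
have e2 : 0 < e / 2 by rewrite divr_gt0.
have m0 : 0 < nrm m + 1 by rewrite ltr_wpDl// nrm_ge0.
have e3 : 0 < e / 2 / (nrm m + 1) by rewrite divr_gt0.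
move: (hF _ e2) (hG _ e3); apply: filterS2 => x h1 h2.
have -> : F x - 0 = (F1 x - k) + m * (F2 x - l) by rewrite FE -[X in _ - X]kl; ring.
apply: (le_lt_trans (le_nrmD _ _)); rewrite (splitr e); apply: ltr_leD => //.
rewrite nrmM; move: h2; rewrite ltr_pdivlMr// => h2.
apply: le_trans (ltW h2); rewrite mulrC ler_wpM2l ?nrm_ge0// lerDl//.
Qed.

Lemma cvg0_conj {T : Type} (G : set_system T) {FG : Filter G} (F : T -> C) (l : C) :
  F @ G --> l -> (fun x => cconj (F x)) @ G --> cconj l.
Proof.
move=> /cvgCxP h; apply/cvgCxP => e /h.
by apply: filterS => x; rewrite -cconjB nrm_conj.
Qed.

(* If [P Q + X Y + Z W = 0] with [Q] bounded away from 0, the factor [P] inherits the limit 0. *)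
Lemma pluecker_cvg0 {T : Type} (G : set_system T) {FG : ProperFilter G}
   (P Q X Y Z W : T -> C) (q x w : C) :
  (forall t, P t * Q t + X t * Y t + Z t * W t = 0) ->
  Q @ G --> q -> q != 0 -> X @ G --> x -> Y @ G --> (0 : C) ->
  Z @ G --> (0 : C) -> W @ G --> w -> P @ G --> (0 : C).
Proof.
move=> E Qq q0 Xx Y0 Z0 Ww.
have Qn0 : \forall t \near G, Q t != 0.
  have nq : 0 < nrm q by rewrite lt_def nrm_eq0 q0 nrm_ge0.
  move/cvgCxP: Qq => /(_ _ nq); apply: filterS => t; apply: contraTneq => ->.
  by rewrite sub0r nrmN ltxx.
have l3 := cvgN (cvgM (cvgD (cvgM Xx Y0) (cvgM Z0 Ww)) (cvgV q0 Qq)).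
rewrite mulr0 mul0r add0r mul0r oppr0 in l3.
have {}l3 : (fun t => - ((X t * Y t + Z t * W t) / Q t)) @ G --> (0 : C) by exact: l3.
apply/cvgCxP => e e0; move/cvgCxP: l3 => /(_ e e0).
apply: filterS2 Qn0 => t Qt; rewrite /=.
suff -> : - ((X t * Y t + Z t * W t) / Q t) = P t by [].
apply: (mulIf Qt); rewrite mulNr -mulrA mulVf// mulr1.
by have /eqP := E t; rewrite -addrA addr_eq0 => /eqP ->.
Qed.

End ComplexLimits.

(** * Tails of integrals at the endpoints *)

Section Vanish.
Context {R : realType} (m : {measure set R -> \bar R}).

(** Dominated convergence with majorant [|g|]: every point of [A] eventually leaves the sets
    [B n]. *)
Lemma Rint_vanish (A : set R) (B : nat -> set R) (g : R -> R) :
  measurable A -> (forall n, measurable (B n)) ->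
  (forall t, A t -> exists N, forall n, (N <= n)%N -> ~ B n t) ->
  rint m A g -> Rintegral m (A `&` B n) g @[n --> \oo] --> (0 : R).
Proof.
move=> mA mB AB gi.
have mg := rint_meas gi.
have mf n : measurable_fun A (fun t => ((g \_ (B n)) t)%:E).
  apply/measurable_EFinP.
  apply/(measurable_restrict g (mB n) mA).
  by apply: measurable_funS mg => //; exact: subIset; left.
have := @dominated_convergence _ _ _ m A mA
  (fun n t => ((g \_ (B n)) t)%:E) (fun=> 0%E) (fun t => `|g t|%:E) mf.
case.
- exact: measurable_cst.
- apply: aeW => t At; have [N NB] := AB t At.
  apply: cvg_near_cst; exists N => // n /= Nn.
  by rewrite patchE ifF//; apply/negbTE/negP; rewrite inE; exact: NB.
- exact: rint_norm.
- apply: aeW => t n At; rewrite /= lee_fin patchE.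
  by case: ifP => _ //=; rewrite normr0.
move=> _ _; rewrite integral0 => /fine_cvgP[_ h].
apply: cvg_trans h; apply: near_eq_cvg; apply: nearW => n /=.
by rewrite Rintegral_mkcondr.
Qed.

End Vanish.

Section NearEnds.
Context {R : realType} (D : sldata R).
Hypothesis H : sl_hyp D.
Local Notation C := (Cx R).
Local Notation b := (sl_b D).
Local Notation I := (Iab D).
Implicit Types (m : {measure set R -> \bar R}) (f g h u : R -> C).

Lemma tail_a m (c : R) (g : R -> R) (e : R) : I c -> rint m (Iac D c) g ->
  (forall t, 0 <= g t) -> 0 < e ->
  exists d, [/\ I d, d <= c & forall x, I x -> x <= d ->
    rint m (Iac D x) g /\ Rintegral m (Iac D x) g < e].
Proof.
move=> Ic gi g0 e0; have [l [Il lc ldec lex _]] := Iac_bigcup Ic.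
have mc := measurable_Iac Ic.
have := Rint_vanish mc (fun n => measurable_Iac (Il n)) _ gi.
have hyp : forall t, Iac D c t -> exists N, forall n, (N <= n)%N -> ~ Iac D (l n) t.
  move=> t At; have It := Iac_sub Ic At.
  have [N lN] := lex t It; exists N => n Nn [_ tl].
  have := lt_le_trans (lt_trans tl (le_lt_trans (ldec _ _ Nn) lN)) (lexx t).
  by rewrite ltxx.
move=> /(_ hyp)/cvgr0_norm_lt/(_ e e0)[N _ /(_ N (leqnn N))].
have sub (x y : R) : x <= y -> Iac D x `<=` Iac D y.
  by move=> xy t [at_ tx]; split => //; exact: lt_le_trans tx xy.
rewrite /= (setIidr (sub _ _ (lc N))) => hN.
exists (l N); split => // x Ix xl.
have mx := measurable_Iac Ix.
have gx : rint m (Iac D x) g by apply: rint_sub gi => //; apply: sub; exact: le_trans (lc N).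
split=> //; apply: le_lt_trans hN; apply: le_trans (ler_norm _).
apply: Rint_ge0_sub => //; [exact: measurable_Iac|exact: sub|].
apply: rint_sub gi => //; [exact: measurable_Iac|exact: sub].
Qed.

(** The point [c] is included, unlike in [Icb]: the intervals [[c, x[] exhaust this set, and [c] may
    be an atom. *)
Definition Ibc (c : R) : set R := [set x | c <= x /\ (x%:E < b)%E].

Lemma Ibc_sub c : I c -> Ibc c `<=` I.
Proof.
move=> [ac _] t [ct tb]; split => //.
by apply: lt_le_trans ac _; rewrite lee_fin.
Qed.

Lemma measurable_Ibc c : I c -> measurable (Ibc c).
Proof.
move=> Ic; rewrite (_ : Ibc c = [set c] `|` Icb D c).
  by apply: measurableU => //; exact: measurable_Icb.
apply/seteqP; split => [t [ct tb]|t [->|[ct tb]]]; last 2 first.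
- by case: Ic.
- by split=> //; exact: ltW.
- by move: ct; rewrite le_eqVlt => /predU1P[->|ct]; [left|right].
Qed.

Lemma tail_b m (c : R) (g : R -> R) (e : R) : I c -> rint m (Ibc c) g ->
  (forall t, 0 <= g t) -> 0 < e ->
  exists d, [/\ I d, c <= d & forall x, I x -> d <= x ->
    rint m (Ibc x) g /\ Rintegral m (Ibc x) g < e].
Proof.
move=> Ic gi g0 e0; have [l [Il lc ldec lex _]] := Icb_bigcup Ic.
have mc := measurable_Ibc Ic.
have := Rint_vanish mc (fun n => measurable_Ibc (Il n)) _ gi.
have hyp : forall t, Ibc c t -> exists N, forall n, (N <= n)%N -> ~ Ibc (l n) t.
  move=> t At; have It := Ibc_sub Ic At.
  have [N lN] := lex t It; exists N => n Nn [tl _].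
  have := le_lt_trans (le_trans (ldec _ _ Nn) tl) lN.
  by rewrite ltxx.
move=> /(_ hyp)/cvgr0_norm_lt/(_ e e0)[N _ /(_ N (leqnn N))].
have sub (x y : R) : y <= x -> Ibc x `<=` Ibc y.
  by move=> xy t [at_ tx]; split => //; exact: le_trans xy at_.
rewrite /= (setIidr (sub _ _ (lc N))) => hN.
exists (l N); split => // x Ix xl.
have mx := measurable_Ibc Ix.
have gx : rint m (Ibc x) g.
  by apply: rint_sub gi => //; apply: sub; exact: le_trans (lc N) xl.
split=> //; apply: le_lt_trans hN; apply: le_trans (ler_norm _).
apply: Rint_ge0_sub => //; [exact: measurable_Ibc|exact: sub|].
apply: rint_sub gi => //; [exact: measurable_Ibc|exact: sub].
Qed.

Lemma prim_cvg_a m c h : I c -> L1loc D m h -> cintegrable m (Iac D c) h ->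
  (fun x => cint m `[x, c[ h) @ near_a D --> cint m (Iac D c) h.
Proof.
move=> Ic hl hi; have FF := near_a_proper H; apply/cvgCxP => e e0.
pose g t := `|ReC (h t)| + `|ImC (h t)|.
have gi : rint m (Iac D c) g.
  have [h1 h2] := hi; apply: rintD; [exact: measurable_Iac|exact: rint_norm|exact: rint_norm].
have e2 : 0 < e / 2 by rewrite divr_gt0.
have [d [Id dc dP]] := tail_a Ic gi (fun t => addr_ge0 (normr_ge0 _) (normr_ge0 _)) e2.
apply/(near_aP H); exists d; split => // x Ix xd.
have [gx ltx] := dP x Ix (ltW xd).
have xc := le_trans (ltW xd) dc.
have mx := measurable_Iac Ix.
have E : Iac D c = `[x, c[ `|` Iac D x.
  apply/seteqP; split => [t [at_ tc]|t []] /=.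
  - by have [xt|tx] := leP x t; [left; rewrite in_itv/= xt|right].
  - rewrite in_itv/= => /andP[xt tc]; split=> //.
    by case: Ix => ax _; apply: (lt_le_trans ax); rewrite lee_fin.
  - by move=> [at_ tx]; split => //; exact: lt_le_trans tx xc.
have hx : cintegrable m (Iac D x) h.
  apply: cable_sub hi => //; first exact: measurable_Iac.
  by rewrite E; right.
rewrite [X in _ - X](_ : _ = cint m `[x, c[ h + cint m (Iac D x) h); last first.
  rewrite [in LHS]E cint_setU//; first by rewrite -E.
  by move=> t /= []; rewrite in_itv/= => /andP[xt _] [_ /(le_lt_trans xt)]; rewrite ltxx.
rewrite opprD addNKr nrmN.
apply: (@le_lt_trans _ _ (2 * Rintegral m (Iac D x) g)).
  by apply: nrm_cint_le => // t _; exact: nrm_le_ReIm.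
by rewrite mulrC -ltr_pdivlMr.
Qed.

Lemma prim_cvg_b m c h : I c -> L1loc D m h -> cintegrable m (Ibc c) h ->
  (fun x => cint m `[c, x[ h) @ near_b D --> cint m (Ibc c) h.
Proof.
move=> Ic hl hi; have FF := near_b_proper H; apply/cvgCxP => e e0.
pose g t := `|ReC (h t)| + `|ImC (h t)|.
have gi : rint m (Ibc c) g.
  have [h1 h2] := hi; apply: rintD; [exact: measurable_Ibc|exact: rint_norm|exact: rint_norm].
have e2 : 0 < e / 2 by rewrite divr_gt0.
have [d [Id dc dP]] := tail_b Ic gi (fun t => addr_ge0 (normr_ge0 _) (normr_ge0 _)) e2.
apply/(near_bP H); exists d; split => // x Ix xd.
have [gx ltx] := dP x Ix (ltW xd).
have xc := le_trans dc (ltW xd).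
have mx := measurable_Ibc Ix.
have E : Ibc c = `[c, x[ `|` Ibc x.
  apply/seteqP; split => [t [ct tb]|t []] /=.
  - by have [xt|tx] := leP x t; [right|left; rewrite in_itv/= ct].
  - rewrite in_itv/= => /andP[xt tc]; split=> //.
    by case: Ix => _; apply: lt_trans; rewrite lte_fin.
  - by move=> [xt tb]; split => //; exact: le_trans xc xt.
have hx : cintegrable m (Ibc x) h.
  apply: cable_sub hi => //; first exact: measurable_Ibc.
  by rewrite E; right.
rewrite [X in _ - X](_ : _ = cint m `[c, x[ h + cint m (Ibc x) h); last first.
  rewrite [in LHS]E cint_setU//; first by rewrite -E.
  by move=> t /= []; rewrite in_itv/= => /andP[_ tx] [xt _]; move: (lt_le_trans tx xt); rewrite ltxx.
rewrite opprD addNKr nrmN.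
apply: (@le_lt_trans _ _ (2 * Rintegral m (Ibc x) g)).
  by apply: nrm_cint_le => // t _; exact: nrm_le_ReIm.
by rewrite mulrC -ltr_pdivlMr.
Qed.

End NearEnds.

(** * Behaviour at the endpoints *)

Section NearEndpoints.
Context {R : realType} (D : sldata R).
Hypothesis H : sl_hyp D.
Local Notation C := (Cx R).
Local Notation I := (Iab D).
Implicit Types (m : {measure set R -> \bar R}) (f g h u : R -> C).

Lemma locb_L2 m f x y : locfin D m -> locb D f -> I x -> I y -> L2 m `[x, y[ f.
Proof.
move=> lm lf Ix Iy; have [B fB] := locb_itv lf Ix Iy.
apply: (@L2_bounded _ _ _ _ B) => //; first exact: (locfin_co lm Ix Iy).
by case: lf => mf _; apply: cmeas_sub mf; [exact: measurable_Iab|exact: Iab_subo].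
Qed.

Lemma Iac_le (x y : R) : x <= y -> Iac D x `<=` Iac D y.
Proof. by move=> xy t [at_ tx]; split => //; exact: lt_le_trans tx xy. Qed.

Lemma Icb_le (x y : R) : x <= y -> Icb D y `<=` Icb D x.
Proof. by move=> xy t [yt tb]; split => //; exact: le_lt_trans xy yt. Qed.

Lemma L2_Iac_ext m f c d : locfin D m -> locb D f -> I c -> I d ->
  L2 m (Iac D c) f -> L2 m (Iac D d) f.
Proof.
move=> lm lf Ic Id fi.
have mc := measurable_Iac Ic; have md := measurable_Iac Id.
apply: (@L2_sub _ _ _ (Iac D c `|` `[c, d[%classic)) => //.
- exact: measurableU.
- by move=> t [at_ td]; have [ct|tc] := leP c t; [right; rewrite /= in_itv/= ct|left].
- by apply: L2_setU => //; exact: locb_L2.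
Qed.

Lemma L2_Icb_ext m f c d : locfin D m -> locb D f -> I c -> I d ->
  L2 m (Icb D c) f -> L2 m (Icb D d) f.
Proof.
move=> lm lf Ic Id fi.
(* The interval [[d, c'[] with [c' > c] also covers the point [c], which [Icb D c] omits. *)
have [c' [Ic' cc']] := Iab_right Ic.
have mc := measurable_Icb Ic; have md := measurable_Icb Id.
apply: (@L2_sub _ _ _ (Icb D c `|` `[d, c'[%classic)) => //.
- exact: measurableU.
- move=> t [dt tb]; have [ct|tc] := ltP c t; [by left|right].
  by rewrite /= in_itv/= (ltW dt) (le_lt_trans tc cc').
- by apply: L2_setU => //; exact: locb_L2.
Qed.

Lemma L2_full m f c : locfin D m -> locb D f -> I c ->
  L2 m (Iac D c) f -> L2 m (Icb D c) f -> L2 m I f.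
Proof.
move=> lm lf Ic fa fb.
have [c' [Ic' cc']] := Iab_right Ic.
have mc := measurable_Iac Ic; have md := measurable_Icb Ic.
have mI := measurable_Iab H.
apply: (@L2_sub _ _ _ (Iac D c `|` (Icb D c `|` `[c, c'[%classic))) => //.
- by apply: measurableU => //; exact: measurableU.
- move=> t [at_ tb]; have [tc|ct|tc] := ltgtP t c.
  + by left.
  + by right; left.
  + by right; right; rewrite tc /= in_itv/= lexx.
- apply: L2_setU => //; first exact: measurableU.
  by apply: L2_setU => //; exact: locb_L2.
Qed.

Lemma H1_near_a_ext u u1 c : H1_near_a D u u1 -> locb D u -> locb D u1 -> I c ->
  L2 (chi D) (Iac D c) u /\ L2 (sigma D) (Iac D c) u1.
Proof.
move=> [_ [d [Id [fi gi]]]] lu lu1 Ic.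
by split; apply: L2_Iac_ext Id Ic _ => //; [exact: locfin_chi|exact: locfin_sigma].
Qed.

Lemma H1_near_b_ext u u1 c : H1_near_b D u u1 -> locb D u -> locb D u1 -> I c ->
  L2 (chi D) (Icb D c) u /\ L2 (sigma D) (Icb D c) u1.
Proof.
move=> [_ [d [Id [fi gi]]]] lu lu1 Ic.
by split; apply: L2_Icb_ext Id Ic _ => //; [exact: locfin_chi|exact: locfin_sigma].
Qed.

Lemma H1_of_near u u1 : H1_near_a D u u1 -> H1_near_b D u u1 -> locb D u1 ->
  H1 D u u1.
Proof.
move=> ha hb lu1; have [ac _] := ha.
have lu := isAC_locb H (locfin_sigma H) ac.
have [c Ic] := Iab_nonempty H.
have [ca c1a] := H1_near_a_ext ha lu lu1 Ic.
have [cb c1b] := H1_near_b_ext hb lu lu1 Ic.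
split => //; split; apply: (L2_full _ _ Ic) => //.
- exact: locfin_chi.
- exact: locfin_sigma.
Qed.

Lemma H1_near_aW u u1 : H1 D u u1 -> H1_near_a D u u1.
Proof.
move=> [ac [fi gi]]; split => //; have [c Ic] := Iab_nonempty H.
have mI := measurable_Iab H; have mc := measurable_Iac Ic.
by exists c; split => //; split; [apply: L2_sub fi|apply: L2_sub gi] => //; exact: Iac_sub.
Qed.

Lemma H1_near_bW u u1 : H1 D u u1 -> H1_near_b D u u1.
Proof.
move=> [ac [fi gi]]; split => //; have [c Ic] := Iab_nonempty H.
have mI := measurable_Iab H; have mc := measurable_Icb Ic.
by exists c; split => //; split; [apply: L2_sub fi|apply: L2_sub gi] => //; exact: Icb_sub.
Qed.

Lemma H1_add f f1 g g1 (k : C) : H1 D f f1 -> H1 D g g1 ->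
  H1 D (fun x => f x + k * g x) (fun x => f1 x + k * g1 x).
Proof.
move=> [fa [f0 f1i]] [ga [g0 g1i]]; have mI := measurable_Iab H.
split; first exact: isAC_add.
by split; apply: L2D => //; exact: L2Z.
Qed.

Lemma H1_conj f f1 : H1 D f f1 ->
  H1 D (fun x => cconj (f x)) (fun x => cconj (f1 x)).
Proof.
move=> [fa [f0 f1i]]; split; first exact: isAC_conj.
by split; exact: L2_conj.
Qed.

Lemma H1_near_a_add f f1 g g1 (k : C) : H1_near_a D f f1 -> H1_near_a D g g1 ->
  H1_near_a D (fun x => f x + k * g x) (fun x => f1 x + k * g1 x).
Proof.
move=> [fa [c [Ic [f0 f1i]]]] [ga [d [Id [g0 g1i]]]].
split; first exact: isAC_add.
have Im := Iab_min Ic Id; have mm := measurable_Iac Im.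
have mc := measurable_Iac Ic; have md := measurable_Iac Id.
have sc : Iac D (Num.min c d) `<=` Iac D c by apply: Iac_le; rewrite ge_min lexx.
have sd : Iac D (Num.min c d) `<=` Iac D d by apply: Iac_le; rewrite ge_min lexx orbT.
exists (Num.min c d); split => //; split; apply: L2D => //; try apply: L2Z => //.
- exact: L2_sub f0. - exact: L2_sub g0. - exact: L2_sub f1i. - exact: L2_sub g1i.
Qed.

Lemma H1_near_b_add f f1 g g1 (k : C) : H1_near_b D f f1 -> H1_near_b D g g1 ->
  H1_near_b D (fun x => f x + k * g x) (fun x => f1 x + k * g1 x).
Proof.
move=> [fa [c [Ic [f0 f1i]]]] [ga [d [Id [g0 g1i]]]].
split; first exact: isAC_add.
have Im := Iab_max Ic Id; have mm := measurable_Icb Im.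
have mc := measurable_Icb Ic; have md := measurable_Icb Id.
have sc : Icb D (Num.max c d) `<=` Icb D c by apply: Icb_le; rewrite le_max lexx.
have sd : Icb D (Num.max c d) `<=` Icb D d by apply: Icb_le; rewrite le_max lexx orbT.
exists (Num.max c d); split => //; split; apply: L2D => //; try apply: L2Z => //.
- exact: L2_sub f0. - exact: L2_sub g0. - exact: L2_sub f1i. - exact: L2_sub g1i.
Qed.

Lemma H1_near_a_Z f f1 (k : C) : H1_near_a D f f1 ->
  H1_near_a D (fun x => k * f x) (fun x => k * f1 x).
Proof.
move=> [fa [c [Ic [f0 f1i]]]]; split; first exact: isAC_Z.
have mc := measurable_Iac Ic.
by exists c; split => //; split; exact: L2Z.
Qed.

Lemma H1_near_b_Z f f1 (k : C) : H1_near_b D f f1 ->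
  H1_near_b D (fun x => k * f x) (fun x => k * f1 x).
Proof.
move=> [fa [c [Ic [f0 f1i]]]]; split; first exact: isAC_Z.
have mc := measurable_Icb Ic.
by exists c; split => //; split; exact: L2Z.
Qed.

Lemma H1_near_a_conj f f1 : H1_near_a D f f1 ->
  H1_near_a D (fun x => cconj (f x)) (fun x => cconj (f1 x)).
Proof.
move=> [fa [c [Ic [f0 f1i]]]]; split; first exact: isAC_conj.
by exists c; split => //; split; exact: L2_conj.
Qed.

Lemma H1_near_b_conj f f1 : H1_near_b D f f1 ->
  H1_near_b D (fun x => cconj (f x)) (fun x => cconj (f1 x)).
Proof.
move=> [fa [c [Ic [f0 f1i]]]]; split; first exact: isAC_conj.
by exists c; split => //; split; exact: L2_conj.
Qed.

Definition Tnear_a f f1 ft ft1 :=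
  [/\ is_tau D f f1 ft, H1_near_a D f f1 & H1_near_a D ft ft1].
Definition Tnear_b f f1 ft ft1 :=
  [/\ is_tau D f f1 ft, H1_near_b D f f1 & H1_near_b D ft ft1].

Lemma Tmax_near_a f f1 ft ft1 : Tmax D f f1 ft ft1 -> Tnear_a f f1 ft ft1.
Proof. by move=> [tf [hf hft]]; split => //; exact: H1_near_aW. Qed.
Lemma Tmax_near_b f f1 ft ft1 : Tmax D f f1 ft ft1 -> Tnear_b f f1 ft ft1.
Proof. by move=> [tf [hf hft]]; split => //; exact: H1_near_bW. Qed.

Lemma Tnear_a_conj f f1 ft ft1 : Tnear_a f f1 ft ft1 ->
  Tnear_a (fun x => cconj (f x)) (fun x => cconj (f1 x))
    (fun x => cconj (ft x)) (fun x => cconj (ft1 x)).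
Proof.
by move=> [tf hf hft]; split; [exact: tau_conj|exact: H1_near_a_conj|exact: H1_near_a_conj].
Qed.
Lemma Tnear_b_conj f f1 ft ft1 : Tnear_b f f1 ft ft1 ->
  Tnear_b (fun x => cconj (f x)) (fun x => cconj (f1 x))
    (fun x => cconj (ft x)) (fun x => cconj (ft1 x)).
Proof.
by move=> [tf hf hft]; split; [exact: tau_conj|exact: H1_near_b_conj|exact: H1_near_b_conj].
Qed.

Lemma Tnear_a_sol z u u1 : is_sol D z u u1 -> H1_near_a D u u1 ->
  Tnear_a u u1 (fun x => z * u x) (fun x => z * u1 x).
Proof. by move=> su hu; split => //; exact: H1_near_a_Z. Qed.
Lemma Tnear_b_sol z u u1 : is_sol D z u u1 -> H1_near_b D u u1 ->
  Tnear_b u u1 (fun x => z * u x) (fun x => z * u1 x).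
Proof. by move=> su hu; split => //; exact: H1_near_b_Z. Qed.

(** By the Lagrange identity [V] at [x] is [V] at a fixed [c] minus integrals over [[x, c[] of
    products of square integrable functions, and these converge. *)
Lemma Vw_cvg_a f f1 ft ft1 g g1 gt gt1 : Tnear_a f f1 ft ft1 ->
  Tnear_a g g1 gt gt1 -> exists l : C, Vw f1 ft g1 gt @ near_a D --> l.
Proof.
move=> [tf [af [c1 [Ic1 [i1 j1]]]] [aft [c2 [Ic2 [i2 j2]]]]].
move=> [tg [ag [c3 [Ic3 [i3 j3]]]] [agt [c4 [Ic4 [i4 j4]]]]].
pose c := Num.min (Num.min c1 c2) (Num.min c3 c4).
have Ic : I c by do !apply: Iab_min.
have mc := measurable_Iac Ic.
have sub d : I d -> c <= d -> forall m h, L2 m (Iac D d) h -> L2 m (Iac D c) h.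
  by move=> Id cd m h; apply: L2_sub => //; [exact: measurable_Iac|exact: Iac_le].
have k1 : c <= c1 by rewrite /c !ge_min lexx.
have k2 : c <= c2 by rewrite /c !ge_min lexx !orbT.
have k3 : c <= c3 by rewrite /c !ge_min lexx !orbT.
have k4 : c <= c4 by rewrite /c !ge_min lexx !orbT.
pose hs t := ft1 t * g1 t - f1 t * gt1 t.
pose hc t := ft t * g t - f t * gt t.
have his : cintegrable (sigma D) (Iac D c) hs.
  apply: cableB => //; apply: L2_mul => //.
  - exact: sub k2 _ _ j2. - exact: sub k3 _ _ j3.
  - exact: sub k1 _ _ j1. - exact: sub k4 _ _ j4.
have hic : cintegrable (chi D) (Iac D c) hc.
  apply: cableB => //; apply: L2_mul => //.
  - exact: sub k2 _ _ i2. - exact: sub k3 _ _ i3.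
  - exact: sub k1 _ _ i1. - exact: sub k4 _ _ i4.
have lf := tau_locb H tf; have lg := tau_locb H tg.
have lf1 := tau_locb1 H tf; have lg1 := tau_locb1 H tg.
have lft := isAC_locb H (locfin_sigma H) aft.
have lgt := isAC_locb H (locfin_sigma H) agt.
have ls : L1loc D (sigma D) hs.
  move=> x y Ix Iy; apply: cableB => //.
  - apply: (@cable_eq _ _ _ (fun t => g1 t * ft1 t)) => //.
      by move=> t _; rewrite mulrC.
    by apply: (locb_L1locM H lg1) => //; case: aft.
  - by apply: (locb_L1locM H lf1) => //; case: agt.
have lc : L1loc D (chi D) hc.
  apply: locb_L1loc => //; first exact: locfin_chi.
  by apply: locbD; [exact: locbM|apply: locbN; exact: locbM].
have FF := near_a_proper H.
have cs := prim_cvg_a H Ic ls his; have cc := prim_cvg_a H Ic lc hic.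
exists (Vw f1 ft g1 gt c - (cint (sigma D) (Iac D c) hs + cint (chi D) (Iac D c) hc)).
apply/cvgCxP => e e0; have e2 : 0 < e / 2 by rewrite divr_gt0.
move/cvgCxP: cs => /(_ _ e2) => /(near_aP H)[d [Id dP]].
move/cvgCxP: cc => /(_ _ e2) => /(near_aP H)[d' [Id' dP']].
apply/(near_aP H); exists (Num.min c (Num.min d d')); split; first by do !apply: Iab_min.
move=> x Ix; rewrite lt_min => /andP[xc]; rewrite lt_min => /andP[xd xd'].
have := lagrange_identity H tf aft tg agt Ix Ic (ltW xc).
rewrite -/hs -/hc => E.
have -> : Vw f1 ft g1 gt x = Vw f1 ft g1 gt c -
    (cint (sigma D) `[x, c[ hs + cint (chi D) `[x, c[ hc) by rewrite -E; ring.
have -> (V p q r s : C) : V - (p + q) - (V - (r + s)) = (- (p - r)) + (- (q - s)) by ring.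
apply: (le_lt_trans (le_nrmD _ _)); rewrite !nrmN (splitr e).
by apply: ltrD; [exact: dP|exact: dP'].
Qed.

Lemma Vw_cvg_b f f1 ft ft1 g g1 gt gt1 : Tnear_b f f1 ft ft1 ->
  Tnear_b g g1 gt gt1 -> exists l : C, Vw f1 ft g1 gt @ near_b D --> l.
Proof.
move=> [tf [af [c1 [Ic1 [i1 j1]]]] [aft [c2 [Ic2 [i2 j2]]]]].
move=> [tg [ag [c3 [Ic3 [i3 j3]]]] [agt [c4 [Ic4 [i4 j4]]]]].
pose c0 := Num.max (Num.max c1 c2) (Num.max c3 c4).
have Ic0 : I c0 by do !apply: Iab_max.
have [c [Ic c0c]] := Iab_right Ic0.
have mc := measurable_Ibc Ic.
have sub d : I d -> d <= c0 -> forall m h, L2 m (Icb D d) h -> L2 m (Ibc D c) h.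
  move=> Id cd m h; apply: L2_sub => //; first exact: measurable_Icb.
  by move=> t [ct tb]; split => //; apply: le_lt_trans cd _; exact: lt_le_trans c0c ct.
have k1 : c1 <= c0 by rewrite /c0 !le_max lexx.
have k2 : c2 <= c0 by rewrite /c0 !le_max lexx !orbT.
have k3 : c3 <= c0 by rewrite /c0 !le_max lexx !orbT.
have k4 : c4 <= c0 by rewrite /c0 !le_max lexx !orbT.
pose hs t := ft1 t * g1 t - f1 t * gt1 t.
pose hc t := ft t * g t - f t * gt t.
have his : cintegrable (sigma D) (Ibc D c) hs.
  apply: cableB => //; apply: L2_mul => //.
  - exact: sub k2 _ _ j2. - exact: sub k3 _ _ j3.
  - exact: sub k1 _ _ j1. - exact: sub k4 _ _ j4.
have hic : cintegrable (chi D) (Ibc D c) hc.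
  apply: cableB => //; apply: L2_mul => //.
  - exact: sub k2 _ _ i2. - exact: sub k3 _ _ i3.
  - exact: sub k1 _ _ i1. - exact: sub k4 _ _ i4.
have lf := tau_locb H tf; have lg := tau_locb H tg.
have lf1 := tau_locb1 H tf; have lg1 := tau_locb1 H tg.
have lft := isAC_locb H (locfin_sigma H) aft.
have lgt := isAC_locb H (locfin_sigma H) agt.
have ls : L1loc D (sigma D) hs.
  move=> x y Ix Iy; apply: cableB => //.
  - apply: (@cable_eq _ _ _ (fun t => g1 t * ft1 t)) => //.
      by move=> t _; rewrite mulrC.
    by apply: (locb_L1locM H lg1) => //; case: aft.
  - by apply: (locb_L1locM H lf1) => //; case: agt.
have lc : L1loc D (chi D) hc.
  apply: locb_L1loc => //; first exact: locfin_chi.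
  by apply: locbD; [exact: locbM|apply: locbN; exact: locbM].
have FF := near_b_proper H.
have cs := prim_cvg_b H Ic ls his; have cc := prim_cvg_b H Ic lc hic.
exists (Vw f1 ft g1 gt c + (cint (sigma D) (Ibc D c) hs + cint (chi D) (Ibc D c) hc)).
apply/cvgCxP => e e0; have e2 : 0 < e / 2 by rewrite divr_gt0.
move/cvgCxP: cs => /(_ _ e2) => /(near_bP H)[d [Id dP]].
move/cvgCxP: cc => /(_ _ e2) => /(near_bP H)[d' [Id' dP']].
apply/(near_bP H); exists (Num.max c (Num.max d d')); split; first by do !apply: Iab_max.
move=> x Ix; rewrite gt_max => /andP[xc]; rewrite gt_max => /andP[xd xd'].
have := lagrange_identity H tf aft tg agt Ic Ix (ltW xc).
rewrite -/hs -/hc => E.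
have -> : Vw f1 ft g1 gt x = Vw f1 ft g1 gt c +
    (cint (sigma D) `[c, x[ hs + cint (chi D) `[c, x[ hc) by rewrite -E; ring.
have -> (V p q r s : C) : V + (p + q) - (V + (r + s)) = (p - r) + (q - s) by ring.
apply: (le_lt_trans (le_nrmD _ _)); rewrite (splitr e).
by apply: ltrD; [exact: dP|exact: dP'].
Qed.

(* Pluecker relations at an endpoint: [G] is the endpoint filter, [v] the boundary
   pair and [g] a pair witnessing that [v] is nontrivial. *)
Section Boundary.
Variables (G : set_system R) (v1 vt g1 gt : R -> C) (l : C).
Hypothesis FG : ProperFilter G.
Hypothesis vv0 : Vc v1 vt v1 vt @ G --> (0 : C).
Hypothesis l0 : l != 0.
Hypothesis gv : Vc g1 gt v1 vt @ G --> l.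
Let w1 x := cconj (v1 x).
Let wt x := cconj (vt x).

Lemma Vw_swap (f1 ft h1 ht : R -> C) (k : C) : Vw f1 ft h1 ht @ G --> k ->
  Vw h1 ht f1 ft @ G --> - k.
Proof.
move=> /cvgCxP h; apply/cvgCxP => e /h; apply: filterS => t.
suff -> : Vw h1 ht f1 ft t - - k = - (Vw f1 ft h1 ht t - k) by rewrite nrmN.
by rewrite /Vw; ring.
Qed.

Lemma Vw_swap0 (f1 ft h1 ht : R -> C) : Vw f1 ft h1 ht @ G --> (0 : C) ->
  Vw h1 ht f1 ft @ G --> (0 : C).
Proof. by move=> /Vw_swap h; rewrite -[X in _ --> X]oppr0. Qed.

(** Boundary values form a two-dimensional symplectic space, which is what the Pluecker identity
    expresses; the condition cuts out a line, and [V] vanishes on a line. *)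
Lemma boundary_Vw0 (f1 ft p1 pt : R -> C) (x w : C) :
  Vc f1 ft v1 vt @ G --> (0 : C) -> Vc p1 pt v1 vt @ G --> (0 : C) ->
  Vw f1 ft g1 gt @ G --> x -> Vw p1 pt g1 gt @ G --> w ->
  Vw f1 ft p1 pt @ G --> (0 : C).
Proof.
move=> fv pv fg pg.
have vp : Vw w1 wt p1 pt @ G --> (0 : C) by exact: (@Vw_swap0 p1 pt w1 wt pv).
apply: (@pluecker_cvg0 _ _ _ FG _ (Vc g1 gt v1 vt) (Vw f1 ft g1 gt)
  (Vw w1 wt p1 pt) (Vc f1 ft v1 vt) (Vw p1 pt g1 gt)
  _ _ _ _ gv l0 fg vp fv pg).
by move=> t; rewrite /Vc /Vw /w1 /wt; ring.
Qed.

(** Since [v] satisfies its own condition, the Pluecker identity turns [V(f, vbar) -> 0] into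
    [V(f, v) -> 0], with [vbar] the conjugate of [v]; conjugating the latter gives the claim. *)
Lemma boundary_conj (f1 ft : R -> C) (x w : C) :
  Vc f1 ft v1 vt @ G --> (0 : C) ->
  Vw f1 ft g1 gt @ G --> x -> Vw g1 gt v1 vt @ G --> w ->
  Vc (fun t => cconj (f1 t)) (fun t => cconj (ft t)) v1 vt @ G --> (0 : C).
Proof.
move=> fv fg gv'.
have P : Vw f1 ft v1 vt @ G --> (0 : C).
  have l0' : - l != 0 by rewrite oppr_eq0.
  apply: (@pluecker_cvg0 _ _ _ FG _ (Vw w1 wt g1 gt) (Vw f1 ft g1 gt)
    (Vc v1 vt v1 vt) (Vc f1 ft v1 vt) (Vw g1 gt v1 vt)
    _ _ _ _ (Vw_swap gv) l0' fg vv0 fv gv').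
  by move=> t; rewrite /Vc /Vw /w1 /wt; ring.
have E : (fun x => cconj (Vw f1 ft v1 vt x)) =
  Vc (fun t => cconj (f1 t)) (fun t => cconj (ft t)) v1 vt.
  by apply/funext => t; rewrite /Vc /Vw cconjB !cconjM.
have Q := cvg0_conj P; rewrite cconj0 E in Q; exact: Q.
Qed.

End Boundary.

End NearEndpoints.

(** * The space H^1 *)

Section CauchySchwarz.
Context {R : realType} (m : {measure set R -> \bar R}).

Lemma cnorm2_cint_le (A : set R) (h : R -> Cx R) : measurable A -> (m A < +oo)%E ->
  L2 m A h -> cintegrable m A h /\
  cnorm2 (cint m A h) <= fine (m A) * Rintegral m A (fun t => cnorm2 (h t)).
Proof.
move=> mA fA [m1 [m2 hi]].
have i1 : rint m A (fun t => ReC (h t) ^+ 2).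
  apply: rint_le hi => //; first exact: measurable_funX.
  by move=> t _; rewrite ger0_norm ?sqr_ge0// lerDl sqr_ge0.
have i2 : rint m A (fun t => ImC (h t) ^+ 2).
  apply: rint_le hi => //; first exact: measurable_funX.
  by move=> t _; rewrite ger0_norm ?sqr_ge0// lerDr sqr_ge0.
have [j1 k1] := Rint_sqr_le mA fA m1 i1.
have [j2 k2] := Rint_sqr_le mA fA m2 i2.
split=> //; rewrite {1}/cnorm2 Re_cint Im_cint.
rewrite [X in _ * X](_ : _ = Rintegral m A (fun t => ReC (h t) ^+ 2) +
   Rintegral m A (fun t => ImC (h t) ^+ 2)).
  by rewrite mulrDr; exact: lerD.
by rewrite -RintegralD.
Qed.

End CauchySchwarz.

(** * Point evaluations on H^1 *)

Section Evaluation.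
Context {R : realType} (D : sldata R).
Hypothesis H : sl_hyp D.
Local Notation C := (Cx R).
Local Notation I := (Iab D).
Implicit Types (m : {measure set R -> \bar R}) (f g h u : R -> C).

Definition hn f f1 : R := Num.sqrt (H1norm2 D f f1).

Lemma H1norm2_ge0 f f1 : 0 <= H1norm2 D f f1.
Proof.
by apply: addr_ge0; apply: Rintegral_ge0 => t _; exact: cnorm2_ge0.
Qed.
Lemma hn_ge0 f f1 : 0 <= hn f f1. Proof. exact: sqrtr_ge0. Qed.
Lemma sqr_hn f f1 : hn f f1 ^+ 2 = H1norm2 D f f1.
Proof. by rewrite sqr_sqrtr// H1norm2_ge0. Qed.

(** [chi] may give no mass to [[x, y]], so the interval is enlarged until it does; [y < q] is strict
    because [[p, q[] omits its right end. *)
Lemma chi_itv_gt0 x y : I x -> I y -> exists p q,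
  [/\ I p, I q, p <= x, y < q & (0 < chi D `[p, q[%classic)%E].
Proof.
move=> Ix Iy; have [l [r [Il Ir _ _ IE]]] := Iab_bigcup H.
have [y' [Iy' yy']] := Iab_right Iy.
have [[n n0]|none] := pselect (exists n, chi D `[l n, r n[%classic <> 0%E).
  exists (Num.min (l n) x), (Num.max (r n) y').
  split; [exact: Iab_min|exact: Iab_max|by rewrite ge_min lexx orbT| |].
    by rewrite lt_max yy' orbT.
  rewrite lt_neqAle measure_ge0 andbT eq_sym; apply/eqP => e0; apply: n0.
  apply/eqP; rewrite eq_le measure_ge0 andbT -e0.
  apply: le_measure; rewrite ?inE//.
  move=> t /=; rewrite !in_itv/= => /andP[lt tr].
  by rewrite ge_min lt lt_max tr.
exfalso; case: H => _ _ _ [_ +] _; apply; rewrite IE.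
apply/negligibleP; first by apply: bigcup_measurable => n _; exact: measurable_itv.
apply: negligible_bigcup => n; apply/negligibleP; first exact: measurable_itv.
by apply: contrapT => n0; apply: none; exists n.
Qed.

Lemma H1_subnorm f f1 (A : set R) : measurable A -> A `<=` I -> H1 D f f1 ->
  Rintegral (chi D) A (fun t => cnorm2 (f t)) <= H1norm2 D f f1 /\
  Rintegral (sigma D) A (fun t => cnorm2 (f1 t)) <= H1norm2 D f f1.
Proof.
move=> mA AI [_ [fi gi]]; have mI := measurable_Iab H.
have e1 : Rintegral (chi D) A (fun t => cnorm2 (f t)) <=
    Rintegral (chi D) I (fun t => cnorm2 (f t)).
  by apply: Rint_ge0_sub => //; [exact: L2_rint|move=> t _; exact: cnorm2_ge0].
have e2 : Rintegral (sigma D) A (fun t => cnorm2 (f1 t)) <=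
    Rintegral (sigma D) I (fun t => cnorm2 (f1 t)).
  by apply: Rint_ge0_sub => //; [exact: L2_rint|move=> t _; exact: cnorm2_ge0].
have p1 : 0 <= Rintegral (chi D) I (fun t => cnorm2 (f t)).
  by apply: Rintegral_ge0 => t _; exact: cnorm2_ge0.
have p2 : 0 <= Rintegral (sigma D) I (fun t => cnorm2 (f1 t)).
  by apply: Rintegral_ge0 => t _; exact: cnorm2_ge0.
rewrite /H1norm2; split; lra.
Qed.

(** By Cauchy-Schwarz [f] varies on [[p, q[] by at most the root of [Sg] times its H^1 norm.
    Averaging this over the base point against [chi], of mass [X > 0], brings in the L^2 norm of
    [f]. *)
Lemma eval_bound x y : I x -> I y -> exists2 K : R, 0 <= K &
  forall f f1, H1 D f f1 -> forall t, x <= t -> t <= y -> nrm (f t) <= K * hn f f1.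
Proof.
move=> Ix Iy; have [p [q [Ip Iq px yq chi0]]] := chi_itv_gt0 Ix Iy.
have fc := locfin_co (locfin_chi H) Ip Iq.
have fs := locfin_co (locfin_sigma H) Ip Iq.
set A := `[p, q[%classic in chi0 fc fs.
have mA : measurable A by exact: measurable_itv.
have AI : A `<=` I by exact: Iab_subo.
set X := fine (chi D A); set Sg := fine (sigma D A).
have X0 : 0 < X by rewrite fine_gt0// chi0 fc.
have S0 : 0 <= Sg by rewrite fine_ge0// measure_ge0.
have K0 : 0 <= 2 / X + 2 * Sg by rewrite addr_ge0 ?divr_ge0 ?mulr_ge0// ltW.
exists (Num.sqrt (2 / X + 2 * Sg)) => [|f f1 hf t xt ty]; first exact: sqrtr_ge0.
have [ac [fi gi]] := hf; have mI := measurable_Iab H.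
have [N1 N2] := H1_subnorm mA AI hf.
have At : A t by rewrite /A /= in_itv/= (le_trans px xt) (le_lt_trans ty yq).
have It := AI _ At.
have dist (u v : R) : A u -> A v -> u <= v -> cnorm2 (f v - f u) <= Sg * H1norm2 D f f1.
  move=> Au Av uv; rewrite (isAC_incr ac (AI _ Au) (AI _ Av) uv).
  have sub : `[u, v[ `<=` A.
    move=> s /=; rewrite in_itv/= => /andP[us sv]; rewrite /A /= in_itv/=.
    move: Au Av; rewrite /A /= !in_itv/= => /andP[pu _] /andP[_ vq].
    by rewrite (le_trans pu us) (lt_trans sv vq).
  have fB : (sigma D `[u, v[%classic < +oo)%E.
    by apply: le_lt_trans fs; apply: le_measure; rewrite ?inE.
  have gB : L2 (sigma D) `[u, v[ f1.
    by apply: L2_sub gi => //; exact: subset_trans sub AI.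
  have [_ e] := cnorm2_cint_le (measurable_itv _) fB gB.
  apply: (le_trans e); apply: ler_pM.
  - by rewrite fine_ge0// measure_ge0.
  - by apply: Rintegral_ge0 => s _; exact: cnorm2_ge0.
  - rewrite fine_le ?ge0_fin_numE ?measure_ge0//.
    by apply: le_measure; rewrite ?inE.
  - apply: le_trans N2; apply: Rint_ge0_sub => //; last by move=> s _; exact: cnorm2_ge0.
    by apply: L2_rint; exact: L2_sub gi.
have dist' s : A s -> cnorm2 (f t - f s) <= Sg * H1norm2 D f f1.
  move=> As; have [st|ts] := leP s t; first exact: dist.
  by rewrite -cnorm2N opprB; apply: dist => //; exact: ltW.
have pt s : A s -> cnorm2 (f t) <= 2 * cnorm2 (f s) + 2 * (Sg * H1norm2 D f f1).
  move=> As; rewrite -(subrK (f s) (f t)) addrC.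
  apply: (le_trans (cnorm2D _ _)); rewrite lerD2l ler_pM2l//; exact: dist'.
have fiA : rint (chi D) A (fun s => cnorm2 (f s)) by apply: L2_rint; exact: L2_sub fi.
have : X * cnorm2 (f t) <=
    2 * Rintegral (chi D) A (fun s => cnorm2 (f s)) + X * (2 * (Sg * H1norm2 D f f1)).
  rewrite mulrC [X * (2 * _)]mulrC -!Rintegral_cst// -RintegralZl// -RintegralD//; last 2 first.
    exact: rintZ.
    exact: rint_cst.
  apply: Rint_le => //; first exact: rint_cst.
  by apply: rintD => //; [exact: rintZ|exact: rint_cst].
move=> le; rewrite /nrm /hn -sqrtrM//; apply: ler_wsqrtr.
rewrite -(ler_pM2l X0); apply: (le_trans le).
have -> : X * ((2 / X + 2 * Sg) * H1norm2 D f f1) =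
  2 * H1norm2 D f f1 + X * (2 * (Sg * H1norm2 D f f1)).
  by field; rewrite gt_eqF.
by rewrite lerD2r ler_pM2l.
Qed.

Lemma sigma_itv_gt0 x y : I x -> I y -> x < y -> 0 < fine (sigma D `[x, y[%classic).
Proof.
move=> Ix Iy xy; have fs := locfin_co (locfin_sigma H) Ix Iy.
rewrite fine_gt0// fs andbT.
case: H => _ _ _ [/(_ x y Ix Iy xy) h _] _; apply: (lt_le_trans h).
apply: le_measure; rewrite ?inE//.
by move=> t /=; rewrite !in_itv/= => /andP[/ltW -> ->].
Qed.

Lemma nrm_crho_bound x y h (B : R) : I x -> I y -> L1loc_rho D h ->
  (forall t, x <= t -> t < y -> nrm (h t) <= B) ->
  nrm (crho D `[x, y[ h) <=
    2 * B * (fine (rho_p D `[x, y[%classic) + fine (rho_n D `[x, y[%classic)).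
Proof.
move=> Ix Iy [hp hn'] hB.
have hB' t : `[x, y[%classic t -> nrm (h t) <= B.
  by rewrite /= in_itv/= => /andP[]; exact: hB.
apply: (le_trans (le_nrmD _ _)); rewrite nrmN mulrDr; apply: lerD.
- by apply: nrm_cint_bound => //; [exact: (locfin_co (locfin_rho_p H) Ix Iy)|exact: (L1loc_co hp Ix Iy)].
- by apply: nrm_cint_bound => //; [exact: (locfin_co (locfin_rho_n H) Ix Iy)|exact: (L1loc_co hn' Ix Iy)].
Qed.

(* [f1] at the left end is read off from [f y - f x = int f1 dsigma], the variation
   of [f1] being controlled by [f] and [ft]. *)
Lemma eval1_bound x y : I x -> I y -> x < y -> exists2 K : R, 0 <= K &
  forall f f1 ft ft1, is_tau D f f1 ft -> H1 D f f1 -> H1 D ft ft1 ->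
  forall t, x <= t -> t <= y -> nrm (f1 t) <= K * (hn f f1 + hn ft ft1).
Proof.
move=> Ix Iy xy; have [K K0 ev] := eval_bound Ix Iy.
set A := `[x, y[%classic.
set s := fine (sigma D A); set c := fine (chi D A).
set r := fine (rho_p D A) + fine (rho_n D A).
have s0 : 0 < s by exact: sigma_itv_gt0.
have c0 : 0 <= c by rewrite fine_ge0// measure_ge0.
have r0 : 0 <= r by rewrite addr_ge0// fine_ge0// measure_ge0.
have mA : measurable A by exact: measurable_itv.
have fs : (sigma D A < +oo)%E by exact: (locfin_co (locfin_sigma H) Ix Iy).
(* [Q * N] bounds the variation of [f1] on [[x, y]]: [f] and [ft] are at most [K * N] there, and the
   factors 2 come from the complex integral bounds. *)
pose Q := 2 * K * c + 2 * K * r.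
have Q0 : 0 <= Q by rewrite addr_ge0// !mulr_ge0.
exists (2 * K / s + 2 * Q + Q) => [|f f1 ft ft1 tf hf hft].
  by rewrite !addr_ge0 ?mulr_ge0// invr_ge0 ltW.
set N := hn f f1 + hn ft ft1.
have N1 : hn f f1 <= N by rewrite lerDl hn_ge0.
have N2 : hn ft ft1 <= N by rewrite lerDr hn_ge0.
have N0 : 0 <= N by rewrite addr_ge0 ?hn_ge0.
have evf t : x <= t -> t <= y -> nrm (f t) <= K * N.
  by move=> xt ty; apply: (le_trans (ev _ _ hf t xt ty)); exact: ler_wpM2l.
have evft t : x <= t -> t <= y -> nrm (ft t) <= K * N.
  by move=> xt ty; apply: (le_trans (ev _ _ hft t xt ty)); exact: ler_wpM2l.
have KN : 0 <= K * N by rewrite mulr_ge0.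
have lf := tau_locb H tf; have lf1 := tau_locb1 H tf.
have var t : x <= t -> t <= y -> nrm (f1 t - f1 x) <= Q * N.
  move=> xt ty; have It := Iab_conv Ix Iy xt ty.
  have sub : `[x, t[ `<=` A.
    by move=> u /=; rewrite /A /= !in_itv/= => /andP[-> ut]/=; exact: lt_le_trans ut ty.
  have le m : locfin D m -> fine (m `[x, t[%classic) <= fine (m A).
    move=> lm; rewrite fine_le ?ge0_fin_numE ?measure_ge0//.
    - exact: (locfin_co lm Ix It).
    - exact: (locfin_co lm Ix Iy).
    - by apply: le_measure; rewrite ?inE.
  rewrite (tau_incr tf Ix It xt); apply: (le_trans (le_nrmD _ _)); rewrite nrmN.
  have -> : Q * N = 2 * (K * N) * c + 2 * (K * N) * r by rewrite /Q; ring.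
  apply: lerD.
  - apply: (@le_trans _ _ (2 * (K * N) * fine (chi D `[x, t[%classic))).
      apply: nrm_cint_bound => //.
      + exact: (locfin_co (locfin_chi H) Ix It).
      + exact: (L1loc_co (locb_L1loc H (locfin_chi H) lf) Ix It).
      + move=> u /=; rewrite in_itv/= => /andP[xu ut]; apply: evf => //.
        exact: le_trans (ltW ut) ty.
    by apply: ler_wpM2l; [rewrite mulr_ge0|apply: le; exact: locfin_chi].
  - apply: (le_trans (nrm_crho_bound Ix It (tau_rho tf) (B := K * N) _)).
      move=> u xu ut; apply: evft => //.
      exact: le_trans (ltW ut) ty.
    apply: ler_wpM2l; first by rewrite mulr_ge0.
    by apply: lerD; apply: le; [exact: locfin_rho_p|exact: locfin_rho_n].
have base : nrm (f1 x) <= (2 * K / s + 2 * Q) * N.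
  have i1 : cintegrable (sigma D) A f1.
    exact: (L1loc_co (locb_L1loc H (locfin_sigma H) lf1) Ix Iy).
  have ic : cintegrable (sigma D) A (fun=> f1 x) by exact: cable_cst.
  have ir : cintegrable (sigma D) A (fun t => f1 t - f1 x) by exact: cableB.
  have E : RtoC s * f1 x = f y - f x - cint (sigma D) A (fun t => f1 t - f1 x).
    rewrite (isAC_incr (tau_ac tf) Ix Iy (ltW xy)) cintB// opprB addrCA subrr addr0.
    apply: eqCx; rewrite ?Re_cint ?Im_cint !reimE mul0r ?subr0 ?addr0;
      by rewrite Rintegral_cst// mulrC.
  have nv : nrm (cint (sigma D) A (fun t => f1 t - f1 x)) <= 2 * (Q * N) * s.
    apply: nrm_cint_bound => // t; rewrite /A /= in_itv/= => /andP[xt ty].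
    by apply: var => //; exact: ltW.
  have nrm_s : nrm (RtoC s) = s.
    by rewrite /nrm /cnorm2 !reimE expr0n addr0 sqrtr_sqr ger0_norm// ltW.
  have : s * nrm (f1 x) <= 2 * K * N + 2 * (Q * N) * s.
    rewrite -{1}nrm_s -nrmM E; apply: (le_trans (le_nrmD _ _)); rewrite nrmN.
    apply: lerD => //; apply: (le_trans (le_nrmD _ _)); rewrite nrmN.
    have := evf _ (ltW xy) (lexx y); have := evf _ (lexx x) (ltW xy); lra.
  move=> le; rewrite -(ler_pM2l s0); apply: (le_trans le).
  rewrite le_eqVlt; apply/orP; left; apply/eqP.
  by field; rewrite gt_eqF.
move=> t xt ty; rewrite -(subrK (f1 x) (f1 t)); apply: (le_trans (le_nrmD _ _)).
by rewrite mulrDl addrC; apply: lerD => //; exact: var.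
Qed.

End Evaluation.

(** * Sequences with geometrically decreasing increments *)

Section GeometricLimits.
Context {R : realType}.
Local Notation C := (Cx R).
Local Notation hf n := ((2 : R)^-1 ^+ n).

Lemma hf_gt0 n : 0 < hf n. Proof. by rewrite exprn_gt0// invr_gt0. Qed.

Lemma hf_cvg0 (c e : R) : 0 < e -> exists N, forall n, (N <= n)%N -> c * hf n < e.
Proof.
move=> e0; have l : `|(2:R)^-1| < 1 by rewrite gtr0_norm ?invr_gt0// invf_lt1// ltr1n.
have := cvg_geometric c l => /cvgr0_norm_lt/(_ e e0)[N _ NP]; exists N => n Nn.
by have := NP n Nn; apply: le_lt_trans; rewrite /geometric /= ler_norm.
Qed.

(** Identities pass to the limit of the iteration in this form: their defect is below every
    [c * hf n], hence 0. *)
Lemma le_hf (X Y c : R) : (forall n, X <= Y + c * hf n) -> X <= Y.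
Proof.
move=> h; apply/ler_addgt0Pr => e e0; have [N NP] := hf_cvg0 c e0.
by apply: (le_trans (h N)); rewrite lerD2l; apply/ltW/NP.
Qed.

(** Nested intervals: [u n - 2 B 2^-n] increases, [u n + 2 B 2^-n] decreases, and the supremum of
    the former lies below all of the latter. *)
Lemma geo_real (u : nat -> R) (B : R) : (forall n, `|u n.+1 - u n| <= B * hf n) ->
  exists l, forall n, `|l - u n| <= 2 * B * hf n.
Proof.
move=> uB; pose lo n := u n - 2 * B * hf n; pose up n := u n + 2 * B * hf n.
have B0 : 0 <= B by have := uB 0; rewrite expr0 mulr1; exact: le_trans.
have hS n : hf n.+1 = 2^-1 * hf n by rewrite exprS.
have step n : lo n <= lo n.+1 /\ up n.+1 <= up n.
  have := uB n; rewrite ler_norml /lo /up hS => /andP[h1 h2]; split; lra.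
have lom : nondecreasing_seq lo by apply/nondecreasing_seqP => n; case: (step n).
have upm : nonincreasing_seq up by apply/nonincreasing_seqP => n; case: (step n).
have lu m n : lo m <= up n.
  apply: (@le_trans _ _ (lo (maxn m n))); first by apply: lom; rewrite leq_maxl.
  apply: (@le_trans _ _ (up (maxn m n))); last by apply: upm; rewrite leq_maxr.
  rewrite /lo /up; have : 0 <= 2 * B * hf (maxn m n).
    by rewrite mulr_ge0 ?mulr_ge0// ltW// hf_gt0.
  lra.
have ub n : ubound (range lo) (up n) by move=> _ [m _ <-].
have sl : has_sup (range lo) by split; [exists (lo 0%N), 0%N|exists (up 0%N); exact: ub].
exists (sup (range lo)) => n; rewrite ler_norml.
have h1 : lo n <= sup (range lo) by apply: (sup_upper_bound sl); exists n.
have h2 : sup (range lo) <= up n by apply: ge_sup => //; exact: sl.1.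
move: h1 h2; rewrite /lo /up => h1 h2; apply/andP; split; lra.
Qed.

Lemma geo_complex (u : nat -> C) (B : R) : (forall n, nrm (u n.+1 - u n) <= B * hf n) ->
  exists l, forall n, nrm (l - u n) <= 4 * B * hf n.
Proof.
move=> uB.
have [l1 h1] : exists l, forall n, `|l - ReC (u n)| <= 2 * B * hf n.
  apply: geo_real => n; apply: le_trans (uB n).
  by apply: le_trans (Re_le_nrm _); rewrite ReCD ReCN.
have [l2 h2] : exists l, forall n, `|l - ImC (u n)| <= 2 * B * hf n.
  apply: geo_real => n; apply: le_trans (uB n).
  by apply: le_trans (Im_le_nrm _); rewrite ImCD ImCN.
exists (RtoC l1 + iC * RtoC l2) => n; apply: (le_trans (nrm_le_ReIm _)).
have -> : ReC (RtoC l1 + iC * RtoC l2 - u n) = l1 - ReC (u n) by rewrite !reimE; ring.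
have -> : ImC (RtoC l1 + iC * RtoC l2 - u n) = l2 - ImC (u n) by rewrite !reimE; ring.
by have := h1 n; have := h2 n; lra.
Qed.

(** The constant [B'] may depend on the point at which a sequence of functions is evaluated;
    uniqueness of the limit trades it for the constant of the increments, which is locally
    uniform. *)
Lemma geo_uniform (u : nat -> C) (l : C) (B B' : R) :
  (forall n, nrm (u n.+1 - u n) <= B * hf n) ->
  (forall n, nrm (l - u n) <= B' * hf n) -> forall n, nrm (l - u n) <= 4 * B * hf n.
Proof.
move=> uB lB; have [l' l'B] := geo_complex uB; suff -> : l = l' by [].
apply/eqP; rewrite -subr_eq0 -nrm_eq0 eq_le nrm_ge0 andbT.
apply: (@le_hf _ _ (B' + 4 * B)) => n; rewrite add0r.
have -> : l - l' = (l - u n) - (l' - u n) by ring.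
apply: (le_trans (le_nrmD _ _)); rewrite nrmN mulrDl; exact: lerD.
Qed.

End GeometricLimits.

Section Norm.
Context {R : realType} (D : sldata R).
Hypothesis H : sl_hyp D.
Local Notation C := (Cx R).
Local Notation I := (Iab D).
Local Notation hf n := ((2 : R)^-1 ^+ n).
Implicit Types (m : {measure set R -> \bar R}) (f g h u : R -> C).

Lemma cnorm2D_weighted (z w : C) (s : R) : 0 < s ->
  cnorm2 (z + w) <= (1 + s) * cnorm2 z + (1 + s^-1) * cnorm2 w.
Proof.
move=> s0; rewrite /cnorm2 !reimE.
have e (p q : R) : 2 * (p * q) <= s * p ^+ 2 + s^-1 * q ^+ 2.
  have := sqr_ge0 (s * p - q).
  have -> : (s * p - q) ^+ 2 = s * (s * p ^+ 2 + s^-1 * q ^+ 2 - 2 * (p * q)).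
    by field; rewrite gt_eqF.
  by rewrite pmulr_rge0// subr_ge0.
have := e (ReC z) (ReC w); have := e (ImC z) (ImC w).
rewrite !sqrrD; lra.
Qed.

Lemma H1norm2_lin_le f f1 g g1 (s t : R) h h1 : H1 D f f1 -> H1 D g g1 ->
  cmeas I h -> cmeas I h1 ->
  (forall x, cnorm2 (h x) <= s * cnorm2 (f x) + t * cnorm2 (g x)) ->
  (forall x, cnorm2 (h1 x) <= s * cnorm2 (f1 x) + t * cnorm2 (g1 x)) ->
  H1norm2 D h h1 <= s * H1norm2 D f f1 + t * H1norm2 D g g1.
Proof.
move=> [_ [fi f1i]] [_ [gi g1i]] mh mh1 le0 le1; have mI := measurable_Iab H.
have key m (p q r : R -> C) : L2 m I p -> L2 m I q -> cmeas I r ->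
    (forall x, cnorm2 (r x) <= s * cnorm2 (p x) + t * cnorm2 (q x)) ->
    Rintegral m I (fun x => cnorm2 (r x)) <=
    s * Rintegral m I (fun x => cnorm2 (p x)) + t * Rintegral m I (fun x => cnorm2 (q x)).
  move=> pi qi mr le.
  have i1 := L2_rint pi; have i2 := L2_rint qi.
  have i3 : rint m I (fun x => s * cnorm2 (p x)) by exact: rintZ.
  have i4 : rint m I (fun x => t * cnorm2 (q x)) by exact: rintZ.
  rewrite -!RintegralZl// -RintegralD//; apply: Rint_le => //; last exact: rintD.
  apply: (@rint_le _ _ _ _ (fun x => s * cnorm2 (p x) + t * cnorm2 (q x))) => //.
  - exact: cmeas_cnorm2.
  - by move=> x _; rewrite ger0_norm ?cnorm2_ge0.
  - exact: rintD.
have e0 := key _ _ _ _ fi gi mh le0; have e1 := key _ _ _ _ f1i g1i mh1 le1.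
rewrite /H1norm2; lra.
Qed.

Lemma H1_meas f f1 : H1 D f f1 -> cmeas I f /\ cmeas I f1.
Proof. by move=> [_ [fi gi]]; split; [exact: (L2_meas fi)|exact: (L2_meas gi)]. Qed.

Lemma H1norm2_add f f1 g g1 (k l : C) : H1 D f f1 -> H1 D g g1 ->
  H1norm2 D (fun x => k * f x + l * g x) (fun x => k * f1 x + l * g1 x) <=
  2 * cnorm2 k * H1norm2 D f f1 + 2 * cnorm2 l * H1norm2 D g g1.
Proof.
move=> hf hg; have [mf mf1] := H1_meas hf; have [mg mg1] := H1_meas hg.
apply: H1norm2_lin_le => //.
- by apply: cmeasD; exact: cmeasZ.
- by apply: cmeasD; exact: cmeasZ.
- by move=> x; apply: (le_trans (cnorm2D _ _)); rewrite !cnorm2M !mulrA.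
- by move=> x; apply: (le_trans (cnorm2D _ _)); rewrite !cnorm2M !mulrA.
Qed.

(** The weighted inequality for squares is integrated and then used with the optimal weight
    [G' / F']; adding [e / 2] keeps both norms positive. *)
Lemma hn_triangle f f1 g g1 : H1 D f f1 -> H1 D g g1 ->
  hn D (fun x => f x + g x) (fun x => f1 x + g1 x) <= hn D f f1 + hn D g g1.
Proof.
move=> hf hg; have [mf mf1] := H1_meas hf; have [mg mg1] := H1_meas hg.
have key s : 0 < s -> H1norm2 D (fun x => f x + g x) (fun x => f1 x + g1 x) <=
    (1 + s) * H1norm2 D f f1 + (1 + s^-1) * H1norm2 D g g1.
  move=> s0; apply: H1norm2_lin_le => //; try exact: cmeasD.
  - by move=> x; exact: cnorm2D_weighted.
  - by move=> x; exact: cnorm2D_weighted.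
set F := hn D f f1; set G := hn D g g1.
have F0 : 0 <= F by exact: hn_ge0. have G0 : 0 <= G by exact: hn_ge0.
apply/ler_addgt0Pr => e e0; set F' := F + e / 2; set G' := G + e / 2.
have F'0 : 0 < F' by rewrite ltr_wpDl// divr_gt0.
have G'0 : 0 < G' by rewrite ltr_wpDl// divr_gt0.
have -> : F + G + e = F' + G' by rewrite /F' /G' addrACA -splitr.
have FG0 : 0 <= F' + G' by exact/ltW/addr_gt0.
rewrite -(@ler_pXn2r _ 2%N)// ?nnegrE ?hn_ge0//.
have s0 : 0 < G' / F' by rewrite divr_gt0.
rewrite sqr_hn; apply: (le_trans (key _ s0)).
have -> : (F' + G') ^+ 2 = (1 + G' / F') * F' ^+ 2 + (1 + (G' / F')^-1) * G' ^+ 2.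
  by field; rewrite (gt_eqF F'0) (gt_eqF G'0).
apply: lerD; apply: ler_wpM2l.
- by rewrite addr_ge0// ltW.
- rewrite -(sqr_hn D f f1) ler_pXn2r ?nnegrE ?hn_ge0 ?(ltW F'0)//.
  by rewrite lerDl; apply: divr_ge0 => //; exact: ltW.
- by rewrite addr_ge0// invr_ge0 ltW.
- rewrite -(sqr_hn D g g1) ler_pXn2r ?nnegrE ?hn_ge0 ?(ltW G'0)//.
  by rewrite lerDl; apply: divr_ge0 => //; exact: ltW.
Qed.

(* Fatou *)
Lemma L2_limit m (A : set R) (F : nat -> R -> C) f (M : R) : measurable A ->
  (forall n, L2 m A (F n)) ->
  (forall n, Rintegral m A (fun t => cnorm2 (F n t)) <= M) ->
  (forall t, A t -> exists B, forall n, nrm (f t - F n t) <= B * hf n) ->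
  L2 m A f /\ Rintegral m A (fun t => cnorm2 (f t)) <= M.
Proof.
move=> mA Fi FM Ff.
have cR t : A t -> (fun n => ReC (F n t)) @ \oo --> ReC (f t).
  move=> /Ff[B fB]; apply/cvgrPdist_lt => e e0; have [N NP] := hf_cvg0 B e0.
  exists N => // n /= Nn; apply: le_lt_trans (NP n Nn); apply: le_trans (fB n).
  by apply: le_trans (Re_le_nrm _); rewrite ReCD ReCN.
have cI t : A t -> (fun n => ImC (F n t)) @ \oo --> ImC (f t).
  move=> /Ff[B fB]; apply/cvgrPdist_lt => e e0; have [N NP] := hf_cvg0 B e0.
  exists N => // n /= Nn; apply: le_lt_trans (NP n Nn); apply: le_trans (fB n).
  by apply: le_trans (Im_le_nrm _); rewrite ImCD ImCN.
have mf : cmeas A f.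
  split.
  - by apply: (measurable_fun_cvg (h := fun n t => ReC (F n t))) => // n; case: (Fi n).
  - by apply: (measurable_fun_cvg (h := fun n t => ImC (F n t))) => // n; case: (Fi n) => _ [].
have c2 t : A t -> (fun n => (cnorm2 (F n t))%:E) @ \oo --> (cnorm2 (f t))%:E.
  move=> At; apply/fine_cvgP; split; first exact: nearW.
  have h1 := cvgM (cR t At) (cR t At); have h2 := cvgM (cI t At) (cI t At).
  have h3 : (fun n => ReC (F n t) * ReC (F n t) + ImC (F n t) * ImC (F n t)) @ \oo -->
      ReC (f t) * ReC (f t) + ImC (f t) * ImC (f t).
    by apply: cvgD; [exact: h1|exact: h2].
  exact: h3.
have mF n : measurable_fun A (fun t => (cnorm2 (F n t))%:E).
  by apply/measurable_EFinP; apply: cmeas_cnorm2; exact: (L2_meas (Fi n)).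
have := @fatou _ _ _ m A mA (fun n t => (cnorm2 (F n t))%:E) mF
  (fun n t _ => cnorm2_ge0 (F n t)).
rewrite (_ : (\int[m]_(x in A) limn_einf _ = \int[m]_(x in A) (cnorm2 (f x))%:E)%E); last first.
  apply: eq_integral => t /set_mem At.
  by rewrite is_cvg_limn_einfE; [exact: cvg_lim (c2 t At)|apply: cvgP; exact: c2 t At].
have FE n : (\int[m]_(x in A) (cnorm2 (F n x))%:E =
    (Rintegral m A (fun x => cnorm2 (F n x)))%:E)%E.
  by rewrite /Rintegral fineK// integrable_fin_num//; exact: (L2_rint (Fi n)).
have leM : (limn_einf (fun n => \int[m]_(x in A) (cnorm2 (F n x))%:E) <= M%:E)%E.
  rewrite limn_einf_lim; apply: lime_le; first exact: is_cvg_einfs.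
  apply: nearW => n; apply: (@le_trans _ _ (\int[m]_(x in A) (cnorm2 (F n x))%:E)%E).
    by apply: ereal_inf_lbound; exists n => //=.
  by rewrite FE lee_fin.
move=> /le_trans/(_ leM) le.
have mc : measurable_fun A (fun t => cnorm2 (f t)) by exact: cmeas_cnorm2.
have fi : rint m A (fun t => cnorm2 (f t)).
  apply/integrableP; split; first exact/measurable_EFinP.
  under eq_integral do rewrite /= ger0_norm ?cnorm2_ge0//.
  by apply: (le_lt_trans le); rewrite ltry.
split; first exact: L2I.
by rewrite -lee_fin /Rintegral fineK// integrable_fin_num.
Qed.

End Norm.

(** * Continuity of the boundary form in the graph norm *)

Section BoundaryForm.
Context {R : realType} (D : sldata R).
Hypothesis H : sl_hyp D.
Local Notation C := (Cx R).
Local Notation I := (Iab D).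
Local Notation hf n := ((2 : R)^-1 ^+ n).
Implicit Types (m : {measure set R -> \bar R}) (f g h u : R -> C).

Lemma nrmM_weighted (z w : C) (d : R) : 0 < d ->
  nrm (z * w) <= d^-1 * cnorm2 z + d * cnorm2 w.
Proof.
move=> d0; rewrite nrmM -!sqr_nrm.
set p := nrm z; set q := nrm w.
have p0 : 0 <= p by exact: nrm_ge0.
have q0 : 0 <= q by exact: nrm_ge0.
have -> : d^-1 * p ^+ 2 + d * q ^+ 2 = d^-1 * ((p - d * q) ^+ 2) + 2 * (p * q).
  by field; rewrite gt_eqF.
have : 0 <= d^-1 * (p - d * q) ^+ 2 by rewrite mulr_ge0 ?sqr_ge0// invr_ge0 ltW.
have : 0 <= p * q by rewrite mulr_ge0.
lra.
Qed.

Lemma cint_cross_bound m (p q r s : R -> C) (x y d : R) : I x -> I y -> 0 < d ->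
  L2 m I p -> L2 m I q -> L2 m I r -> L2 m I s ->
  nrm (cint m `[x, y[ (fun t => p t * q t - r t * s t)) <=
  2 * (d^-1 * (Rintegral m I (fun t => cnorm2 (p t)) + Rintegral m I (fun t => cnorm2 (r t)))
     + d * (Rintegral m I (fun t => cnorm2 (q t)) + Rintegral m I (fun t => cnorm2 (s t)))).
Proof.
move=> Ix Iy d0 pi qi ri si; have mI := measurable_Iab H.
have mA : measurable (`[x, y[%classic : set R) by exact: measurable_itv.
have AI : `[x, y[ `<=` I by exact: Iab_subo.
have c1 : cintegrable m I (fun t => p t * q t) by exact: L2_mul.
have c2 : cintegrable m I (fun t => r t * s t) by exact: L2_mul.
have c3 : cintegrable m `[x, y[ (fun t => p t * q t - r t * s t).
  by apply: cable_sub AI _ => //; exact: cableB.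
have jp := L2_rint pi; have jq := L2_rint qi; have jr := L2_rint ri; have js := L2_rint si.
pose g t := d^-1 * (cnorm2 (p t) + cnorm2 (r t)) + d * (cnorm2 (q t) + cnorm2 (s t)).
have i1 : rint m I (fun t => d^-1 * (cnorm2 (p t) + cnorm2 (r t))).
  by apply: rintZ => //; exact: rintD.
have i2 : rint m I (fun t => d * (cnorm2 (q t) + cnorm2 (s t))).
  by apply: rintZ => //; exact: rintD.
have ig : rint m I g by exact: rintD.
have igA : rint m `[x, y[ g by exact: rint_sub ig.
apply: (@le_trans _ _ (2 * Rintegral m `[x, y[ g)).
  apply: nrm_cint_le => // t _.
  apply: (le_trans (le_nrmD _ _)); rewrite nrmN.
  have := nrmM_weighted (p t) (q t) d0; have := nrmM_weighted (r t) (s t) d0.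
  by rewrite /g !mulrDr; lra.
rewrite ler_pM2l//.
apply: (@le_trans _ _ (Rintegral m I g)).
  apply: Rint_ge0_sub => // t _.
  have cc (z w : C) : 0 <= cnorm2 z + cnorm2 w by rewrite addr_ge0 // cnorm2_ge0.
  by apply: addr_ge0; apply: mulr_ge0; rewrite ?invr_ge0 ?(ltW d0) ?cc.
rewrite /g RintegralD//.
rewrite RintegralZl//; last exact: rintD.
rewrite RintegralZl//; last exact: rintD.
rewrite RintegralD// RintegralD//.
Qed.

(** The free weight [d] does the work of Cauchy-Schwarz: a small [d] damps the fixed pair [g], after
    which a pair [f] of small norm makes the whole bound small, uniformly in [x] and [y]. *)
Lemma Vw_diff_bound f f1 ft ft1 g g1 gt gt1 (x y d : R) :
  Tmax D f f1 ft ft1 -> Tmax D g g1 gt gt1 -> I x -> I y -> 0 < d ->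
  nrm (Vw f1 ft g1 gt y - Vw f1 ft g1 gt x) <=
  2 * (d^-1 * (H1norm2 D f f1 + H1norm2 D ft ft1) +
       d * (H1norm2 D g g1 + H1norm2 D gt gt1)).
Proof.
wlog xy : x y / x <= y => [hw|].
  have [xy|/ltW yx] := leP x y; first exact: hw.
  by move=> tf tg Ix Iy d0; rewrite nrm_sub; exact: hw.
move=> [tf [[_ [f0 f1i]] [aft [ft0 ft1i]]]] [tg [[_ [g0 g1i]] [agt [gt0 gt1i]]]] Ix Iy d0.
rewrite (lagrange_identity H tf aft tg agt Ix Iy xy).
apply: (le_trans (le_nrmD _ _)).
have e1 := cint_cross_bound Ix Iy d0 ft1i g1i f1i gt1i.
have e2 := cint_cross_bound Ix Iy d0 ft0 g0 f0 gt0.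
apply: (le_trans (lerD e1 e2)); rewrite /H1norm2.
by rewrite le_eqVlt; apply/orP; left; apply/eqP; ring.
Qed.

(* The boundary condition is closed under graph-norm limits, by the estimate above. *)
Lemma Vw_limit0 (G : set_system R) {FG : Filter G} (c B : R)
  f f1 ft ft1 g g1 gt gt1 (u u1 ut ut1 : nat -> R -> C) :
  (forall P : R -> Prop, (forall x, I x -> P x) -> \forall x \near G, P x) ->
  I c -> Tmax D g g1 gt gt1 ->
  (forall n, Tmax D (fun x => f x - u n x) (fun x => f1 x - u1 n x)
    (fun x => ft x - ut n x) (fun x => ft1 x - ut1 n x)) ->
  (forall n, Vw (u1 n) (ut n) g1 gt @ G --> (0 : C)) ->
  (forall n, H1norm2 D (fun x => f x - u n x) (fun x => f1 x - u1 n x) +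
    H1norm2 D (fun x => ft x - ut n x) (fun x => ft1 x - ut1 n x) <= B * hf n) ->
  (forall n, nrm (Vw (fun x => f1 x - u1 n x) (fun x => ft x - ut n x) g1 gt c) <= B * hf n) ->
  Vw f1 ft g1 gt @ G --> (0 : C).
Proof.
move=> GI Ic Tg Td V0 NB VB; apply/cvgCxP => e e0.
set Ng := H1norm2 D g g1 + H1norm2 D gt gt1.
have Ng0 : 0 <= Ng by rewrite addr_ge0 ?H1norm2_ge0.
(* With this weight the fixed pair contributes at most [e / 4]; the [+ 1] covers [Ng = 0]. *)
pose d := e / (8 * (Ng + 1)).
have d0 : 0 < d by rewrite divr_gt0// mulr_gt0// ltr_wpDl.
have dN : 2 * (d * Ng) <= e / 4.
  have -> : e / 4 = 2 * (d * (Ng + 1)).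
    by rewrite /d; field; rewrite gt_eqF// ltr_wpDl.
  by rewrite ler_pM2l// ler_pM2l// lerDl.
have e4 : 0 < e / 4 by rewrite divr_gt0.
have [N1 N1P] := hf_cvg0 B e4.
have [N2 N2P] := hf_cvg0 (2 * d^-1 * B) e4.
pose n := maxn N1 N2.
have h1 := N1P n (leq_maxl _ _); have h2 := N2P n (leq_maxr _ _).
pose E x := Vw (fun x => f1 x - u1 n x) (fun x => ft x - ut n x) g1 gt x.
have Vx : \forall x \near G, nrm (E x - E c) <= 2 * (d^-1 * (B * hf n) + d * Ng).
  apply: GI => x Ix; apply: (le_trans (Vw_diff_bound (Td n) Tg Ic Ix d0)).
  by rewrite -/Ng ler_pM2l// lerD2r ler_pM2l ?invr_gt0.
move/cvgCxP: (V0 n) => /(_ _ e4).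
move: Vx; apply: filterS2 => x hx; rewrite !subr0 => hu.
have -> : Vw f1 ft g1 gt x = Vw (u1 n) (ut n) g1 gt x + ((E x - E c) + E c).
  by rewrite /E /Vw; ring.
apply: (le_lt_trans (le_nrmD _ _)).
have := le_nrmD (E x - E c) (E c).
have := VB n; rewrite -/(E c).
move: h2; rewrite -!mulrA => h2.
lra.
Qed.

End BoundaryForm.

(** * The resolvent set is open *)

Lemma cmeas_geo {R : realType} (A : set R) (F : nat -> R -> Cx R) (f : R -> Cx R) :
  (forall n, cmeas A (F n)) ->
  (forall t, A t -> exists B, forall n, nrm (f t - F n t) <= B * (2 : R)^-1 ^+ n) ->
  cmeas A f.
Proof.
move=> mF Ff; split.
- apply: (measurable_fun_cvg (h := fun n t => ReC (F n t))) => [n|t At]; first by case: (mF n).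
  have [B fB] := Ff t At; apply/cvgrPdist_lt => e e0; have [N NP] := hf_cvg0 B e0.
  exists N => // n /= Nn; apply: le_lt_trans (NP n Nn); apply: le_trans (fB n).
  by apply: le_trans (Re_le_nrm _); rewrite ReCD ReCN.
- apply: (measurable_fun_cvg (h := fun n t => ImC (F n t))) => [n|t At]; first by case: (mF n).
  have [B fB] := Ff t At; apply/cvgrPdist_lt => e e0; have [N NP] := hf_cvg0 B e0.
  exists N => // n /= Nn; apply: le_lt_trans (NP n Nn); apply: le_trans (fB n).
  by apply: le_trans (Im_le_nrm _); rewrite ImCD ImCN.
Qed.

Section Relation.
Context {R : realType} (D : sldata R).
Hypothesis H : sl_hyp D.
Local Notation C := (Cx R).
Local Notation I := (Iab D).
Local Notation hf n := ((2 : R)^-1 ^+ n).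
Implicit Types (m : {measure set R -> \bar R}) (f g h u : R -> C).
Variables (va va1 vat vat1 vb vb1 vbt vbt1 : R -> C).
Hypothesis (Ba : bfun_a D va va1 vat vat1) (Bb : bfun_b D vb vb1 vbt vbt1).
Local Notation inS := (inS D va1 vat vb1 vbt).
Local Notation resolvent := (resolvent D va1 vat vb1 vbt).

Lemma Vc_add0 (G : set_system R) {FG : Filter G} (f1 ft g1 gt v1 vt : R -> C) (k : C) :
  Vc f1 ft v1 vt @ G --> (0 : C) -> Vc g1 gt v1 vt @ G --> (0 : C) ->
  Vc (fun x => f1 x + k * g1 x) (fun x => ft x + k * gt x) v1 vt @ G --> (0 : C).
Proof.
move=> fv gv; apply: (cvgCx_lin0 (m := k) fv gv).
  by rewrite mulr0 addr0.
by move=> x; rewrite /Vc /Vw; ring.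
Qed.

Lemma Vc_ext0 (G : set_system R) {FG : Filter G} (f1 ft g1 gt v1 vt : R -> C) :
  (forall P : R -> Prop, (forall x, I x -> P x) -> \forall x \near G, P x) ->
  (forall x, I x -> f1 x = g1 x) -> (forall x, I x -> ft x = gt x) ->
  Vc f1 ft v1 vt @ G --> (0 : C) -> Vc g1 gt v1 vt @ G --> (0 : C).
Proof.
move=> GI e1 et /cvgCxP hF; apply/cvgCxP => e /hF.
have E : \forall x \near G, Vc f1 ft v1 vt x = Vc g1 gt v1 vt x.
  by apply: GI => x Ix; rewrite /Vc /Vw e1// et.
by move: E; apply: filterS2 => x ->.
Qed.

Lemma near_a_Iab (P : R -> Prop) : (forall x, I x -> P x) -> \forall x \near near_a D, P x.
Proof.
move=> h; apply/(near_aP H); have [c Ic] := Iab_nonempty H.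
by exists c; split => // x Ix _; exact: h.
Qed.
Lemma near_b_Iab (P : R -> Prop) : (forall x, I x -> P x) -> \forall x \near near_b D, P x.
Proof.
move=> h; apply/(near_bP H); have [c Ic] := Iab_nonempty H.
by exists c; split => // x Ix _; exact: h.
Qed.

Lemma Tmax_add f f1 ft ft1 g g1 gt gt1 (k : C) :
  Tmax D f f1 ft ft1 -> Tmax D g g1 gt gt1 ->
  Tmax D (fun x => f x + k * g x) (fun x => f1 x + k * g1 x)
    (fun x => ft x + k * gt x) (fun x => ft1 x + k * gt1 x).
Proof.
move=> [tf [hF hft]] [tg [hg hgt]].
by split; [exact: tau_add|split; exact: H1_add].
Qed.

Lemma inS_add f f1 ft ft1 g g1 gt gt1 (k : C) :
  inS f f1 ft ft1 -> inS g g1 gt gt1 ->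
  inS (fun x => f x + k * g x) (fun x => f1 x + k * g1 x)
    (fun x => ft x + k * gt x) (fun x => ft1 x + k * gt1 x).
Proof.
move=> [Tf fa fb] [Tg ga gb]; split; first exact: Tmax_add.
- move=> la; have FF := near_a_proper H.
  by apply: Vc_add0; [exact: fa|exact: ga].
- move=> lb; have FF := near_b_proper H.
  by apply: Vc_add0; [exact: fb|exact: gb].
Qed.

(** The resolvent set provides a second component known only on [(a, b)]; this exchanges it for the
    literal function [h + z f]. *)
Lemma inS_rep f f1 ft ft1 gt gt1 : inS f f1 ft ft1 ->
  (forall x, I x -> ft x = gt x) -> H1 D gt gt1 -> inS f f1 gt gt1.
Proof.
move=> [[tf [hF hft]] fa fb] e hgt; split.
- by split => //; exact: tau_eq tf.
- move=> la; have FF := near_a_proper H.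
  by apply: (Vc_ext0 near_a_Iab _ e) (fa la).
- move=> lb; have FF := near_b_proper H.
  by apply: (Vc_ext0 near_b_Iab _ e) (fb lb).
Qed.

Lemma inS_H1 f f1 ft ft1 : inS f f1 ft ft1 -> H1 D f f1.
Proof. by case=> -[_ []]. Qed.

(** The graph of [(S - z)^-1]: [h] is mapped to [f], and the second component of the pair in [S] is
    forced to be [h + z f]. *)
Definition Res z h h1 f f1 :=
  inS f f1 (fun x => h x + z * f x) (fun x => h1 x + z * f1 x).

Lemma Res_ex z h h1 : resolvent z -> H1 D h h1 -> exists p : (R -> C) * (R -> C),
  Res z h h1 p.1 p.2.
Proof.
move=> [ex _ _] hh; have [f [f1 [ft [ft1 [S e]]]]] := ex _ _ hh.
exists (f, f1); apply: (inS_rep S) => /=.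
  by move=> x Ix; rewrite -e// subrK.
by apply: H1_add => //; exact: inS_H1 S.
Qed.

Lemma Res_bound z : resolvent z -> exists2 K : R, 0 < K &
  forall h h1 f f1, Res z h h1 f f1 -> H1norm2 D f f1 <= K * H1norm2 D h h1.
Proof.
move=> [_ _ [K KP]]; exists (Num.max K 1); first by rewrite lt_max ltr01 orbT.
move=> h h1 f f1 S; have := KP _ _ _ _ S.
have -> : (fun x => h x + z * f x - z * f x) = h by apply/funext => x; rewrite addrK.
have -> : (fun x => h1 x + z * f1 x - z * f1 x) = h1 by apply/funext => x; rewrite addrK.
move=> le; apply: (le_trans le); apply: ler_wpM2r; first exact: H1norm2_ge0.
by rewrite le_max lexx.
Qed.

Lemma Tmax_conj f f1 ft ft1 : Tmax D f f1 ft ft1 ->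
  Tmax D (fun x => cconj (f x)) (fun x => cconj (f1 x))
    (fun x => cconj (ft x)) (fun x => cconj (ft1 x)).
Proof.
move=> [tf [hF hft]]; split; [exact: tau_conj|split; exact: H1_conj].
Qed.

(* [F n.+1 = (S - z0)^-1 (h + (z - z0) (F n))] converges geometrically in H^1; point
   evaluations of [f] and [f1] are bounded on H^1, so the pointwise limit is the
   H^1-limit and solves [(S - z) f = h]. *)
Section Neumann.
Variables (z0 z : C) (h h1 : R -> C) (F F1 : nat -> R -> C) (B : R).
Let ze := z - z0.
Hypothesis (hh : H1 D h h1) (B0 : 0 <= B).
Hypothesis F_H1 : forall n, H1 D (F n) (F1 n).
Hypothesis F_S : forall n, inS (F n.+1) (F1 n.+1)
  (fun x => (h x + ze * F n x) + z0 * F n.+1 x)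
  (fun x => (h1 x + ze * F1 n x) + z0 * F1 n.+1 x).
Let d n x := F n.+1 x - F n x.
Let d1 n x := F1 n.+1 x - F1 n x.
Hypothesis dB : forall n, hn D (d n) (d1 n) <= B * hf n.

Let d_H1 n : H1 D (d n) (d1 n).
Proof.
have := H1_add H (-1) (F_H1 n.+1) (F_H1 n).
rewrite (_ : (fun x => F n.+1 x + -1 * F n x) = d n); last first.
  by apply/funext => x; rewrite mulN1r.
by rewrite (_ : (fun x => F1 n.+1 x + -1 * F1 n x) = d1 n)//; apply/funext => x; rewrite mulN1r.
Qed.

(** This is [tau] applied to [d n.+1]. The shift in the index occurs because only the iterates from
    [F 1] on are known to lie in [S]; [F 0] is merely in H^1, and so [F1] is compared pointwise from
    index 1 on. *)
Let dt n x := ze * d n x + z0 * d n.+1 x.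
Let dt1 n x := ze * d1 n x + z0 * d1 n.+1 x.

Let dt_H1 n : H1 D (dt n) (dt1 n).
Proof.
have Z : H1 D (fun x => ze * d n x) (fun x => ze * d1 n x).
  have [ac [i1 i2]] := d_H1 n; have mI := measurable_Iab H.
  by split; [exact: isAC_Z|split; exact: L2Z].
exact: H1_add.
Qed.

Let d_tau n : is_tau D (d n.+1) (d1 n.+1) (dt n).
Proof.
have [[t1 _] _ _] := F_S n.+1; have [[t0 _] _ _] := F_S n.
apply: (tau_eq H _ _ _ (tau_add H (-1) t1 t0)) => x _.
- by rewrite /d mulN1r.
- by rewrite /d1 mulN1r.
- by rewrite /dt /d; ring.
Qed.

Let dtB : exists2 B' : R, 0 <= B' & forall n, hn D (dt n) (dt1 n) <= B' * hf n.
Proof.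
exists (Num.sqrt (2 * cnorm2 ze + 2 * cnorm2 z0) * B) => [|n].
  by rewrite mulr_ge0// sqrtr_ge0.
set q := 2 * cnorm2 ze + 2 * cnorm2 z0.
have q0 : 0 <= q by rewrite addr_ge0// mulr_ge0// cnorm2_ge0.
have h0 := ltW (hf_gt0 n : 0 < hf n).
rewrite -(@ler_pXn2r _ 2%N)// ?nnegrE ?hn_ge0//; last first.
  by rewrite !mulr_ge0// sqrtr_ge0.
rewrite sqr_hn; apply: (le_trans (H1norm2_add H ze z0 (d_H1 n) (d_H1 n.+1))).
have b1 : H1norm2 D (d n) (d1 n) <= (B * hf n) ^+ 2.
  by rewrite -sqr_hn ler_pXn2r ?nnegrE ?hn_ge0 ?mulr_ge0.
have b2 : H1norm2 D (d n.+1) (d1 n.+1) <= (B * hf n) ^+ 2.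
  rewrite -sqr_hn ler_pXn2r ?nnegrE ?hn_ge0 ?mulr_ge0//.
  apply: (le_trans (dB _)); apply: ler_wpM2l => //.
  by rewrite exprS; lra.
have -> : (Num.sqrt q * B * hf n) ^+ 2 = q * (B * hf n) ^+ 2.
  by rewrite -mulrA exprMn sqr_sqrtr.
rewrite /q [leRHS]mulrDl; apply: lerD; apply: ler_wpM2l => //;
  by rewrite mulr_ge0// cnorm2_ge0.
Qed.

Let incr x y : I x -> I y -> exists2 E : R, 0 <= E & forall t, x <= t -> t <= y -> forall n,
  nrm (F n.+1 t - F n t) <= E * hf n /\ nrm (F1 n.+2 t - F1 n.+1 t) <= E * hf n.
Proof.
move=> Ix Iy; have [K K0 KP] := eval_bound H Ix Iy.
(* [eval1_bound] needs a nondegenerate interval, while [x = y] is allowed here. *)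
have [y' [Iy' yy']] := Iab_right Iy.
have [xy|yx] := leP x y; last first.
  exists 0 => // t xt ty; exfalso; move: (lt_le_trans yx (le_trans xt ty)).
  by rewrite ltxx.
have [K1 K10 KP1] := eval1_bound H Ix Iy' (le_lt_trans xy yy').
have [B' B'0 B'P] := dtB.
exists (K * B + K1 * (B + B')).
  by rewrite addr_ge0 ?mulr_ge0// addr_ge0.
move=> t xt ty n; have h0 := ltW (hf_gt0 n : 0 < hf n).
split.
- apply: (le_trans (KP _ _ (d_H1 n) t xt ty)).
  apply: (le_trans (ler_wpM2l K0 (dB n))); rewrite mulrA; apply: ler_wpM2r => //.
  by rewrite lerDl mulr_ge0// addr_ge0.
- apply: (le_trans (KP1 _ _ _ _ (d_tau n) (d_H1 n.+1) (dt_H1 n) t xt (le_trans ty (ltW yy')))).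
  have dB' : hn D (d n.+1) (d1 n.+1) <= B * hf n.
    apply: (le_trans (dB _)); apply: ler_wpM2l => //.
    by rewrite exprS; lra.
  apply: (le_trans (ler_wpM2l K10 (lerD dB' (B'P n)))).
  rewrite -mulrDl mulrA; apply: ler_wpM2r => //.
  by rewrite lerDr mulr_ge0.
Qed.

(** The limits are chosen point by point, with a rate depending on the point; [geo_uniform] then
    makes the rate uniform on compact intervals. *)
Lemma neumann_pointwise : exists f f1 : R -> C, forall x y, I x -> I y ->
  exists2 E : R, 0 <= E & forall t, x <= t -> t <= y -> forall n,
    nrm (f t - F n t) <= E * hf n /\ nrm (f1 t - F1 n.+1 t) <= E * hf n.
Proof.
have ex t : exists p : C * C, I t -> exists E, forall n,
    nrm (p.1 - F n t) <= E * hf n /\ nrm (p.2 - F1 n.+1 t) <= E * hf n.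
  have [It|nIt] := pselect (I t); last by exists (0, 0).
  have [E E0 EP] := incr It It.
  have [l lP] := geo_complex (fun n => (EP t (lexx _) (lexx _) n).1).
  have [l1 l1P] := geo_complex (u := fun n => F1 n.+1 t) (fun n => (EP t (lexx _) (lexx _) n).2).
  by exists (l, l1) => _; exists (4 * E) => n; split; [exact: lP|exact: l1P].
have [p pP] := choice ex.
exists (fun t => (p t).1), (fun t => (p t).2) => x y Ix Iy.
have [E E0 EP] := incr Ix Iy; exists (4 * E); first by rewrite mulr_ge0.
move=> t xt ty n.
have [E' E'P] := pP t (Iab_conv Ix Iy xt ty); split.
- by apply: (geo_uniform (fun n => (EP t xt ty n).1) (fun n => (E'P n).1)).
- by apply: (geo_uniform (u := fun n => F1 n.+1 t) (fun n => (EP t xt ty n).2) (fun n => (E'P n).2)).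
Qed.


Section Limit.
Variables (f f1 : R -> C).
Hypothesis fP : forall x y, I x -> I y ->
  exists2 E : R, 0 <= E & forall t, x <= t -> t <= y -> forall n,
    nrm (f t - F n t) <= E * hf n /\ nrm (f1 t - F1 n.+1 t) <= E * hf n.

Let hfS n : hf n.+1 <= (hf n : R).
Proof. by rewrite exprS; have := hf_gt0 n : 0 < hf n :> R; lra. Qed.

Let mf : cmeas I f.
Proof.
apply: (@cmeas_geo _ _ F) => [n|t It]; first by have [] := H1_meas (F_H1 n).
have [E _ EP] := fP It It; exists E => n.
by have [] := EP t (lexx _) (lexx _) n.
Qed.

Let mf1 : cmeas I f1.
Proof.
apply: (@cmeas_geo _ _ (fun n => F1 n.+1)) => [n|t It]; first by have [] := H1_meas (F_H1 n.+1).
have [E _ EP] := fP It It; exists E => n.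
by have [] := EP t (lexx _) (lexx _) n.
Qed.

Let lF n : locb D (F n).
Proof. by have [ac _] := F_H1 n; exact: isAC_locb (locfin_sigma H) ac. Qed.

Let lF1 n : locb D (F1 n.+1).
Proof. by have [[t1 _] _ _] := F_S n; exact: tau_locb1 t1. Qed.

Let lh : locb D h.
Proof. by have [ac _] := hh; exact: isAC_locb (locfin_sigma H) ac. Qed.

Let lf : locb D f.
Proof.
split => // x y Ix Iy; have [E E0 EP] := fP Ix Iy.
have [_ /(_ x y Ix Iy)[B' FB]] := lF 0.
exists (E + B') => t xt ty; rewrite -(subrK (F 0%N t) (f t)).
apply: (le_trans (le_nrmD _ _)); apply: lerD; last exact: FB.
by have [] := EP t xt ty 0%N; rewrite expr0 mulr1.
Qed.

Let lf1 : locb D f1.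
Proof.
split => // x y Ix Iy; have [E E0 EP] := fP Ix Iy.
have [_ /(_ x y Ix Iy)[B' FB]] := lF1 0.
exists (E + B') => t xt ty; rewrite -(subrK (F1 1%N t) (f1 t)).
apply: (le_trans (le_nrmD _ _)); apply: lerD; last exact: FB.
by have [] := EP t xt ty 0%N; rewrite expr0 mulr1.
Qed.

Let locbB (p q : R -> C) : locb D p -> locb D q -> locb D (fun t => p t - q t).
Proof. by move=> lp lq; apply: locbD => //; exact: locbN. Qed.

(** The identity is exact for [F n.+1], and replacing it by [f] costs three errors of order [2^-n],
    uniformly on [[x, y]]. The same scheme proves [f_tau]. *)
Let f_ac : isAC D (sigma D) f f1.
Proof.
apply: isAC_intro => //; first by apply: locb_L1loc => //; exact: locfin_sigma.
move=> x y Ix Iy xy; have [E E0 EP] := fP Ix Iy.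
set s := fine (sigma D `[x, y[%classic).
apply/eqP; rewrite -subr_eq0 -nrm_eq0 eq_le nrm_ge0 andbT.
apply: (@le_hf _ _ _ (E + E + 2 * E * s)) => n; rewrite add0r.
have [[[ac _] _] _ _] := F_S n.
have i1 := L1loc_co (locb_L1loc H (locfin_sigma H) lf1) Ix Iy.
have i2 := L1loc_co (locb_L1loc H (locfin_sigma H) (lF1 n)) Ix Iy.
have i3 := cableB (measurable_itv _) i1 i2.
have -> : f y - f x - cint (sigma D) `[x, y[ f1 =
  (f y - F n.+1 y) + (- (f x - F n.+1 x) +
    - cint (sigma D) `[x, y[ (fun t => f1 t - F1 n.+1 t)).
  by rewrite cintB// -(isAC_incr ac Ix Iy xy); ring.
apply: (le_trans (le_nrmD _ _)); rewrite [leRHS]mulrDl [(E + E) * _]mulrDl -addrA; apply: lerD.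
  have [e1 _] := EP y xy (lexx y) n.+1; apply: (le_trans e1).
  exact: ler_wpM2l.
apply: (le_trans (le_nrmD _ _)); rewrite !nrmN; apply: lerD.
  have [e1 _] := EP x (lexx x) xy n.+1; apply: (le_trans e1).
  exact: ler_wpM2l.
have -> : 2 * E * s * hf n = 2 * (E * hf n) * s by ring.
apply: nrm_cint_bound => //; first exact: (locfin_co (locfin_sigma H) Ix Iy).
move=> t /=; rewrite in_itv/= => /andP[xt ty].
by have [] := EP t xt (ltW ty) n.
Qed.

Let ft x := h x + z * f x.
Let ft1 x := h1 x + z * f1 x.
Let Ft n x := (h x + ze * F n x) + z0 * F n.+1 x.
Let Ft1 n x := (h1 x + ze * F1 n x) + z0 * F1 n.+1 x.

Let ftE n x : ft x - Ft n x = ze * (f x - F n x) + z0 * (f x - F n.+1 x).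
Proof. by rewrite /ft /Ft /ze; ring. Qed.

Let lft : locb D ft. Proof. by apply: locbD => //; exact: locbZ. Qed.
Let lFt n : locb D (Ft n).
Proof. by apply: locbD; [apply: locbD => //|]; exact: locbZ. Qed.

Let ft_diff E n x : nrm (f x - F n x) <= E * hf n -> nrm (f x - F n.+1 x) <= E * hf n ->
  nrm (ft x - Ft n x) <= (nrm ze + nrm z0) * E * hf n.
Proof.
move=> e1 e2; rewrite ftE; apply: (le_trans (le_nrmD _ _)); rewrite !nrmM.
by rewrite -mulrA mulrDl; apply: lerD; apply: ler_wpM2l => //; exact: nrm_ge0.
Qed.

Let f_tau : is_tau D f f1 ft.
Proof.
apply: tau_intro => //; first exact: locb_rho.
move=> x y Ix Iy xy; have [E E0 EP] := fP Ix Iy.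
set s := fine (chi D `[x, y[%classic).
set r := fine (rho_p D `[x, y[%classic) + fine (rho_n D `[x, y[%classic).
apply/eqP; rewrite -subr_eq0 -nrm_eq0 eq_le nrm_ge0 andbT.
pose Q := (nrm ze + nrm z0) * E.
apply: (@le_hf _ _ _ (E + E + (2 * E * s + 2 * Q * r))) => n; rewrite add0r.
have [[tF _] _ _] := F_S n.
have EP1 t : x <= t -> t <= y -> nrm (f t - F n.+1 t) <= E * hf n.
  move=> xt ty; have [e _] := EP t xt ty n.+1; apply: (le_trans e).
  exact: ler_wpM2l.
have i1 := L1loc_co (locb_L1loc H (locfin_chi H) lf) Ix Iy.
have i2 := L1loc_co (locb_L1loc H (locfin_chi H) (lF n.+1)) Ix Iy.
have i3 := cableB (measurable_itv _) i1 i2.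
have [p1 p2] := locb_rho H lft; have [p3 p4] := locb_rho H (lFt n).
have j1 := L1loc_co p1 Ix Iy; have j2 := L1loc_co p2 Ix Iy.
have j3 := L1loc_co p3 Ix Iy; have j4 := L1loc_co p4 Ix Iy.
have -> : f1 y - f1 x - (cint (chi D) `[x, y[ f - crho D `[x, y[ ft) =
  (f1 y - F1 n.+1 y) + (- (f1 x - F1 n.+1 x) +
    (- cint (chi D) `[x, y[ (fun t => f t - F n.+1 t) +
     crho D `[x, y[ (fun t => ft t - Ft n t))).
  rewrite /crho !cintB//.
  have := tau_incr tF Ix Iy xy; rewrite /crho -/(Ft n) => /eqP.
  by rewrite subr_eq => /eqP ->; ring.
apply: (le_trans (le_nrmD _ _)); rewrite [leRHS]mulrDl [(E + E) * _]mulrDl -addrA.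
apply: lerD; first by have [_ e1] := EP y xy (lexx y) n.
apply: (le_trans (le_nrmD _ _)); rewrite nrmN; apply: lerD.
  by have [_ e1] := EP x (lexx x) xy n.
apply: (le_trans (le_nrmD _ _)); rewrite nrmN mulrDl; apply: lerD.
  have -> : 2 * E * s * hf n = 2 * (E * hf n) * s by ring.
  apply: nrm_cint_bound => //; first exact: (locfin_co (locfin_chi H) Ix Iy).
  move=> t /=; rewrite in_itv/= => /andP[xt ty].
  exact: EP1 (ltW ty).
have -> : 2 * Q * r * hf n = 2 * (Q * hf n) * r by ring.
apply: nrm_crho_bound => //.
  by apply: (locb_rho H); exact: locbB.
move=> t xt ty; apply: ft_diff; first by have [] := EP t xt (ltW ty) n.
exact: EP1 (ltW ty).
Qed.

(** Telescoping; [2 B (2^-n - 2^-(n + k))] is the exact geometric partial sum, which the induction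
    on [k] requires. *)
Let FB n k : H1 D (fun x => F (n + k)%N x - F n x) (fun x => F1 (n + k)%N x - F1 n x) /\
  hn D (fun x => F (n + k)%N x - F n x) (fun x => F1 (n + k)%N x - F1 n x) <=
    2 * B * (hf n - hf (n + k)%N).
Proof.
elim: k => [|k [hk bk]].
  rewrite addn0 subrr mulr0.
  have E (p : R -> C) : (fun x => p x - p x) = fun=> 0.
    by apply/funext => x; rewrite subrr.
  rewrite !E; have mI := measurable_Iab H; split.
    split; last by split; exact: L2_0.
    apply: isAC_intro => // [x y Ix Iy|x y Ix Iy xy].
      by apply: cable_cst => //; exact: locfin_sigma.
    rewrite subrr; apply: eqCx; rewrite ?Re_cint ?Im_cint /Rintegral/= integral0//.
  rewrite /hn (_ : H1norm2 _ _ _ = 0) ?sqrtr0//.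
  rewrite /H1norm2 /Rintegral; under eq_integral do rewrite cnorm20.
  by rewrite integral0; under eq_integral do rewrite cnorm20; rewrite integral0 addr0.
have E (p : nat -> R -> C) : (fun x => p (n + k.+1)%N x - p n x) =
   (fun x => (p (n + k)%N x - p n x) + (p (n + k).+1 x - p (n + k)%N x)).
  by apply/funext => x; rewrite addnS; ring.
rewrite (E F) (E F1); split.
  have := H1_add H 1 hk (d_H1 (n + k)).
  rewrite (_ : (fun x => _ + 1 * d _ x) = (fun x => (F (n + k)%N x - F n x) +
    (F (n + k).+1 x - F (n + k)%N x))); last by apply/funext => x; rewrite mul1r.
  rewrite (_ : (fun x => _ + 1 * d1 _ x) = (fun x => (F1 (n + k)%N x - F1 n x) +
    (F1 (n + k).+1 x - F1 (n + k)%N x)))//; by apply/funext => x; rewrite mul1r.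
apply: (le_trans (hn_triangle H hk (d_H1 (n + k)))).
apply: (le_trans (lerD bk (dB (n + k)))).
by rewrite addnS exprS; lra.
Qed.

(** Fatou's lemma in [k] for [F (n + k) - F n], with [n] fixed. The outer factor 2 arises because
    each of the two integrals is bounded by the full squared norm. *)
Let f_diff n : H1 D (fun x => f x - F n x) (fun x => f1 x - F1 n x) /\
  H1norm2 D (fun x => f x - F n x) (fun x => f1 x - F1 n x) <= 2 * (2 * B * hf n) ^+ 2.
Proof.
have mI := measurable_Iab H.
have h0 := ltW (hf_gt0 n : 0 < hf n).
have b k : H1norm2 D (fun x => F (n + k)%N x - F n x) (fun x => F1 (n + k)%N x - F1 n x)
    <= (2 * B * hf n) ^+ 2.
  have [_ bk] := FB n k; rewrite -sqr_hn ler_pXn2r ?nnegrE ?hn_ge0 ?mulr_ge0//.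
  apply: (le_trans bk); apply: ler_wpM2l; first by rewrite mulr_ge0.
  by rewrite gerBl ltW// hf_gt0.
have hle k : hf (n + k)%N <= (hf k : R).
  elim: {h0 b} n => [|n' IH]; first by rewrite add0n.
  by rewrite addSn; exact: le_trans (hfS _) IH.
have [i1 n1] : L2 (chi D) I (fun x => f x - F n x) /\
    Rintegral (chi D) I (fun t => cnorm2 (f t - F n t)) <= (2 * B * hf n) ^+ 2.
  apply: (L2_limit (F := fun k x => F (n + k)%N x - F n x)) => // [k|k|t It].
  - by have [[_ []]] := FB n k.
  - by have [hk _] := FB n k; apply: le_trans (b k); have [] := H1_subnorm H mI (@subset_refl _ I) hk.
  - have [E E0 EP] := fP It It; exists E => k.
    have -> : f t - F n t - (F (n + k)%N t - F n t) = f t - F (n + k)%N t by ring.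
    have [e _] := EP t (lexx _) (lexx _) (n + k)%N; apply: (le_trans e).
    by apply: ler_wpM2l.
have [i2 n2] : L2 (sigma D) I (fun x => f1 x - F1 n x) /\
    Rintegral (sigma D) I (fun t => cnorm2 (f1 t - F1 n t)) <= (2 * B * hf n) ^+ 2.
  apply: (L2_limit (F := fun k x => F1 (n + k.+1)%N x - F1 n x)) => // [k|k|t It].
  - by have [[_ []]] := FB n k.+1.
  - by have [hk _] := FB n k.+1; apply: le_trans (b k.+1); have [] := H1_subnorm H mI (@subset_refl _ I) hk.
  - have [E E0 EP] := fP It It; exists E => k.
    have -> : f1 t - F1 n t - (F1 (n + k.+1)%N t - F1 n t) = f1 t - F1 (n + k).+1 t.
      by rewrite addnS; ring.
    have [_ e] := EP t (lexx _) (lexx _) (n + k)%N; apply: (le_trans e).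
    by apply: ler_wpM2l.
split.
  split => //; have [ac _] := F_H1 n.
  have := isAC_add H (-1) f_ac ac.
  rewrite (_ : (fun x => f x + -1 * F n x) = (fun x => f x - F n x)); last first.
    by apply/funext => x; rewrite mulN1r.
  by rewrite (_ : (fun x => f1 x + -1 * F1 n x) = (fun x => f1 x - F1 n x))//;
    apply/funext => x; rewrite mulN1r.
by rewrite /H1norm2; lra.
Qed.

Let f_H1 : H1 D f f1.
Proof.
have [hd _] := f_diff 0; have := H1_add H 1 hd (F_H1 0).
rewrite (_ : (fun x => f x - F 0%N x + 1 * F 0%N x) = f); last first.
  by apply/funext => x; rewrite mul1r subrK.
by rewrite (_ : (fun x => f1 x - F1 0%N x + 1 * F1 0%N x) = f1)//;
  apply/funext => x; rewrite mul1r subrK.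
Qed.

Let ft_H1 : H1 D ft ft1. Proof. exact: H1_add. Qed.

Let diff_Tmax n : Tmax D (fun x => f x - F n.+1 x) (fun x => f1 x - F1 n.+1 x)
  (fun x => ft x - Ft n x) (fun x => ft1 x - Ft1 n x).
Proof.
have E (p q : R -> C) : (fun x => p x - q x) = (fun x => p x + -1 * q x).
  by apply/funext => x; rewrite mulN1r.
by have [TF _ _] := F_S n; rewrite !E; apply: Tmax_add => //; split.
Qed.

Let Bs : R := 2 * (2 * B) ^+ 2.
Let Q : R := Bs + (2 * cnorm2 ze * Bs + 2 * cnorm2 z0 * Bs).

Let diff_norm n : H1norm2 D (fun x => f x - F n.+1 x) (fun x => f1 x - F1 n.+1 x) +
  H1norm2 D (fun x => ft x - Ft n x) (fun x => ft1 x - Ft1 n x) <= Q * hf n.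
Proof.
have h0 := ltW (hf_gt0 n : 0 < hf n).
have h1' : hf n <= 1 :> R.
  elim: n {h0} => [|k IH]; first by rewrite expr0.
  exact: le_trans (hfS k) IH.
have Bs0 : 0 <= Bs by rewrite mulr_ge0// sqr_ge0.
have b k : 2 * (2 * B * hf k) ^+ 2 = Bs * hf k ^+ 2 by rewrite /Bs exprMn; ring.
have e1 : H1norm2 D (fun x => f x - F n x) (fun x => f1 x - F1 n x) <= Bs * hf n.
  have [_ e] := f_diff n; apply: (le_trans e); rewrite b; apply: ler_wpM2l => //.
  by rewrite expr2 ler_piMr.
have e2 : H1norm2 D (fun x => f x - F n.+1 x) (fun x => f1 x - F1 n.+1 x) <= Bs * hf n.
  have [_ e] := f_diff n.+1; apply: (le_trans e); rewrite b; apply: ler_wpM2l => //.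
  have := hfS n; have := ltW (hf_gt0 n.+1 : 0 < hf n.+1 :> R) => p q.
  rewrite expr2; apply: le_trans q; rewrite ler_piMr//.
  exact: le_trans (hfS n) h1'.
have [hd1 _] := f_diff n; have [hd2 _] := f_diff n.+1.
have := H1norm2_add H ze z0 hd1 hd2.
rewrite (_ : (fun x => _ + z0 * (f x - F n.+1 x)) = (fun x => ft x - Ft n x)); last first.
  by apply/funext => x; rewrite ftE.
rewrite (_ : (fun x => _ + z0 * (f1 x - F1 n.+1 x)) = (fun x => ft1 x - Ft1 n x)); last first.
  by apply/funext => x; rewrite /ft1 /Ft1 /ze; ring.
move=> e3; have -> : Q * hf n = Bs * hf n +
    (2 * cnorm2 ze * (Bs * hf n) + 2 * cnorm2 z0 * (Bs * hf n)) by rewrite /Q; ring.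
apply: lerD => //; apply: (le_trans e3).
by apply: lerD; apply: ler_wpM2l => //; rewrite mulr_ge0// cnorm2_ge0.
Qed.

Let bc (G : set_system R) (FG : Filter G) (v v1 vt vt1 : R -> C) :
  (forall P : R -> Prop, (forall x, I x -> P x) -> \forall x \near G, P x) ->
  Tmax D v v1 vt vt1 ->
  (forall n, Vc (F1 n.+1) (Ft n) v1 vt @ G --> (0 : C)) ->
  Vc f1 ft v1 vt @ G --> (0 : C).
Proof.
move=> GI Tv V0; have [c Ic] := Iab_nonempty H.
have [E E0 EP] := fP Ic Ic.
pose Y := (nrm ze + nrm z0) * E * nrm (v1 c) + E * nrm (vt c).
have Y0 : 0 <= Y.
  by rewrite addr_ge0 ?mulr_ge0 ?nrm_ge0// addr_ge0 ?nrm_ge0.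
apply: (@Vw_limit0 _ _ H G FG c (Num.max Q Y) f f1 ft ft1 _ _ _ _ (fun n => F n.+1)
  (fun n => F1 n.+1) Ft Ft1 GI Ic (Tmax_conj Tv) diff_Tmax V0) => n.
- apply: (le_trans (diff_norm n)); apply: ler_wpM2r; first exact/ltW/hf_gt0.
  by rewrite le_max lexx.
- have h0 := ltW (hf_gt0 n : 0 < hf n).
  apply: (@le_trans _ _ (Y * hf n)); last first.
    by apply: ler_wpM2r => //; rewrite le_max lexx orbT.
  rewrite /Vw; apply: (le_trans (le_nrmD _ _)); rewrite nrmN !nrmM !nrm_conj.
  rewrite /Y mulrDl; have [e1 e2] := EP c (lexx _) (lexx _) n.
  apply: lerD.
    rewrite -[leRHS]mulrA [nrm (v1 c) * _]mulrC mulrA; apply: ler_wpM2r; first exact: nrm_ge0.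
    apply: ft_diff => //.
    have [e3 _] := EP c (lexx _) (lexx _) n.+1; apply: (le_trans e3).
    exact: ler_wpM2l.
  rewrite -[leRHS]mulrA [nrm (vt c) * _]mulrC mulrA; apply: ler_wpM2r => //.
  exact: nrm_ge0.
Qed.

Lemma neumann_limit : Res z h h1 f f1.
Proof.
split; first by split.
- move=> la; have [Tv _ _] := Ba la; have FF := near_a_proper H.
  apply: (bc _ near_a_Iab Tv) => n; by have [_ + _] := F_S n; exact.
- move=> lb; have [Tv _ _] := Bb lb; have FF := near_b_proper H.
  apply: (bc _ near_b_Iab Tv) => n; by have [_ _] := F_S n; exact.
Qed.

End Limit.

End Neumann.

End Relation.

(** * Perturbation of the spectral parameter *)

Section Resolvent.
Context {R : realType} (D : sldata R).
Hypothesis H : sl_hyp D.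
Local Notation C := (Cx R).
Local Notation I := (Iab D).
Local Notation hf n := ((2 : R)^-1 ^+ n).
Implicit Types (m : {measure set R -> \bar R}) (f g h u : R -> C).
Variables (va va1 vat vat1 vb vb1 vbt vbt1 : R -> C).
Hypothesis (Ba : bfun_a D va va1 vat vat1) (Bb : bfun_b D vb vb1 vbt vbt1).
Local Notation inS := (inS D va1 vat vb1 vbt).
Local Notation resolvent := (resolvent D va1 vat vb1 vbt).
Local Notation Res := (Res D va1 vat vb1 vbt).

Lemma cnorm2_1 : cnorm2 (1 : C) = 1.
Proof. by rewrite /cnorm2 !reimE expr0n addr0 expr1n. Qed.

Lemma H1_Z f f1 (k : C) : H1 D f f1 -> H1 D (fun x => k * f x) (fun x => k * f1 x).
Proof.
move=> [ac [i1 i2]]; have mI := measurable_Iab H.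
by split; [exact: isAC_Z|split; exact: L2Z].
Qed.

Lemma H1_0 : H1 D (fun=> 0) (fun=> 0).
Proof.
have mI := measurable_Iab H; split; last by split; exact: L2_0.
apply: isAC_intro => // [x y Ix Iy|x y Ix Iy xy].
  by apply: cable_cst => //; exact: locfin_sigma.
by rewrite subrr; apply: eqCx; rewrite ?Re_cint ?Im_cint /Rintegral/= integral0.
Qed.

Lemma H1norm2_Z f f1 (k : C) : H1 D f f1 ->
  H1norm2 D (fun x => k * f x) (fun x => k * f1 x) <= 2 * cnorm2 k * H1norm2 D f f1.
Proof.
move=> hF; have := H1norm2_add H k 0 hF hF.
rewrite (_ : (fun x => k * f x + 0 * f x) = (fun x => k * f x)); last first.
  by apply/funext => x; rewrite mul0r addr0.
rewrite (_ : (fun x => k * f1 x + 0 * f1 x) = (fun x => k * f1 x)); last first.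
  by apply/funext => x; rewrite mul0r addr0.
by rewrite cnorm20 mulr0 mul0r addr0.
Qed.

Lemma Res_shift z z0 h h1 f f1 : Res z h h1 f f1 ->
  Res z0 (fun x => h x + (z - z0) * f x) (fun x => h1 x + (z - z0) * f1 x) f f1.
Proof.
rewrite /Res.
rewrite (_ : (fun x => h x + (z - z0) * f x + z0 * f x) = (fun x => h x + z * f x)); last first.
  by apply/funext => x; ring.
by rewrite (_ : (fun x => h1 x + (z - z0) * f1 x + z0 * f1 x) = (fun x => h1 x + z * f1 x))//;
  apply/funext => x; ring.
Qed.

(** The first resolvent identity. *)
Lemma Res_sub z w h h1 f f1 g g1 : Res z h h1 f f1 -> Res w h h1 g g1 ->
  Res w (fun x => (z - w) * f x) (fun x => (z - w) * f1 x)
    (fun x => f x - g x) (fun x => f1 x - g1 x).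
Proof.
move=> Sf Sg; have := inS_add H (-1) Sf Sg; rewrite /Res.
have E (p q : R -> C) : (fun x => p x + -1 * q x) = (fun x => p x - q x).
  by apply/funext => x; rewrite mulN1r.
rewrite !E.
have E' (p q r : R -> C) : (fun x => r x + z * p x - (r x + w * q x)) =
  (fun x => (z - w) * p x + w * (p x - q x)).
  by apply/funext => x; ring.
by rewrite !E'.
Qed.

Lemma H1norm2_eq0 f f1 : H1 D f f1 -> H1norm2 D f f1 = 0 -> forall x, I x -> f x = 0.
Proof.
move=> hF n0 x Ix; have [K _ KP] := eval_bound H Ix Ix.
have := KP _ _ hF x (lexx _) (lexx _); rewrite /hn n0 sqrtr0 mulr0 => le.
by apply/eqP; rewrite -nrm_eq0 eq_le le nrm_ge0.
Qed.

Lemma resolvent_open z0 : resolvent z0 -> exists e K : R, [/\ 0 < e, 0 < K &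
  forall z, cnorm2 (z - z0) <= e -> resolvent z /\
    forall h h1 f f1, H1 D h h1 -> Res z h h1 f f1 ->
      H1norm2 D f f1 <= K * H1norm2 D h h1].
Proof.
move=> r0; have [K0 K0p KP] := Res_bound r0.
have e0 : 0 < (8 * K0)^-1 by rewrite invr_gt0 mulr_gt0.
(* For [q <= 1 / (8 K0)] the iteration contracts squared norms by [2 q K0 <= 1/4], hence norms by
   1/2, the rate [hf] of the limit lemmas. The same estimate gives [N <= 2 K0 N' + N / 4] for the
   squared norms [N] of [f] and [N'] of [h], whence the bound [4 K0]. *)
exists (8 * K0)^-1, (4 * K0); split => //; first by rewrite mulr_gt0.
move=> z; set q := cnorm2 (z - z0) => qe.
have qK : 2 * q * K0 <= 4^-1.
  have : q * (8 * K0) <= 1 by rewrite -ler_pdivlMr ?mulr_gt0// mul1r.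
  lra.
have q0 : 0 <= q by exact: cnorm2_ge0.
have bound h h1 f f1 : H1 D h h1 -> Res z h h1 f f1 ->
    H1norm2 D f f1 <= 4 * K0 * H1norm2 D h h1.
  move=> hh S; have hF := inS_H1 S.
  have le := KP _ _ _ _ (Res_shift z0 S).
  have := H1norm2_add H 1 (z - z0) hh hF.
  rewrite (_ : (fun x => 1 * h x + _ * f x) = (fun x => h x + (z - z0) * f x)); last first.
    by apply/funext => x; rewrite mul1r.
  rewrite (_ : (fun x => 1 * h1 x + _ * f1 x) = (fun x => h1 x + (z - z0) * f1 x)); last first.
    by apply/funext => x; rewrite mul1r.
  rewrite cnorm2_1 mulr1 -/q => le2.
  have N0 := H1norm2_ge0 D f f1; have N1 := H1norm2_ge0 D h h1.
  have := ler_wpM2l (ltW K0p) le2; have := ler_wpM2r N0 qK; nra.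
split=> //; split.
- move=> h h1 hh.
  have ex (p : (R -> C) * (R -> C)) : exists p' : (R -> C) * (R -> C), H1 D p.1 p.2 ->
      Res z0 (fun x => h x + (z - z0) * p.1 x) (fun x => h1 x + (z - z0) * p.2 x) p'.1 p'.2.
    have [hp|nhp] := pselect (H1 D p.1 p.2); last by exists p.
    by have [p' p'P] := Res_ex H r0 (H1_add H (z - z0) hh hp); exists p'.
  have [s sP] := choice ex.
  pose P n := iter n s ((fun=> 0), (fun=> 0)).
  have PH n : H1 D (P n).1 (P n).2.
    elim: n => [|n IH]; first exact: H1_0.
    exact: inS_H1 (sP _ IH).
  have PS n := sP _ (PH n).
  pose d n x := (P n.+1).1 x - (P n).1 x.
  pose d1 n x := (P n.+1).2 x - (P n).2 x.
  have E (p p' : R -> C) : (fun x => p x + -1 * p' x) = (fun x => p x - p' x).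
    by apply/funext => x; rewrite mulN1r.
  have dH n : H1 D (d n) (d1 n).
    by have := H1_add H (-1) (PH n.+1) (PH n); rewrite !E.
  pose B := hn D (d 0%N) (d1 0%N).
  have B0 : 0 <= B by exact: hn_ge0.
  have dS n : Res z0 (fun x => (z - z0) * d n x) (fun x => (z - z0) * d1 n x) (d n.+1) (d1 n.+1).
    have := inS_add H (-1) (PS n.+1) (PS n); rewrite !E /Res.
    have E' (p p' r r' k : R -> C) :
      (fun x => k x + (z - z0) * p x + z0 * r x - (k x + (z - z0) * p' x + z0 * r' x)) =
      (fun x => (z - z0) * (p x - p' x) + z0 * (r x - r' x)).
      by apply/funext => x; ring.
    by rewrite !E'.
  have dB n : hn D (d n) (d1 n) <= B * hf n.
    elim: n => [|n IH]; first by rewrite expr0 mulr1.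
    have h0 := ltW (hf_gt0 n : 0 < hf n).
    rewrite -(@ler_pXn2r _ 2%N)// ?nnegrE ?hn_ge0//; last first.
      by rewrite mulr_ge0// exprn_ge0// invr_ge0.
    rewrite sqr_hn; apply: (le_trans (KP _ _ _ _ (dS n))).
    apply: (le_trans (ler_wpM2l (ltW K0p) (H1norm2_Z (z - z0) (dH n)))).
    rewrite -/q -sqr_hn mulrA [K0 * _]mulrC.
    have sq : hn D (d n) (d1 n) ^+ 2 <= (B * hf n) ^+ 2.
      by rewrite ler_pXn2r ?nnegrE ?hn_ge0 ?mulr_ge0.
    apply: (@le_trans _ _ (4^-1 * (B * hf n) ^+ 2)).
      by apply: ler_pM => //; rewrite ?sqr_ge0// mulr_ge0 ?mulr_ge0// ltW.
    have -> : hf n.+1 = 2^-1 * hf n :> R by rewrite exprS.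
    by rewrite le_eqVlt; apply/orP; left; apply/eqP; field.
  have [f [f1 fP]] := neumann_pointwise H (F := fun n => (P n).1) (F1 := fun n => (P n).2) B0 PH PS dB.
  have S := neumann_limit H Ba Bb (F := fun n => (P n).1) (F1 := fun n => (P n).2) hh B0 PH PS dB fP.
  exists f, f1, (fun x => h x + z * f x), (fun x => h1 x + z * f1 x); split => // x _.
  by rewrite addrK.
- move=> f f1 ft ft1 S e x Ix.
  have S' : Res z (fun=> 0) (fun=> 0) f f1.
    apply: (inS_rep H S) => [y Iy|]; first by rewrite add0r e.
    have E (p : R -> C) : (fun x => 0 + z * p x) = (fun x => z * p x).
      by apply/funext => y; rewrite add0r.
    by rewrite !E; apply: H1_Z; exact: inS_H1 S.
  have := bound _ _ _ _ H1_0 S'.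
  have -> : H1norm2 D (fun=> 0) (fun=> 0) = 0.
    rewrite /H1norm2 /Rintegral; under eq_integral do rewrite cnorm20.
    by rewrite integral0; under eq_integral do rewrite cnorm20; rewrite integral0 addr0.
  rewrite mulr0 => le; apply: (H1norm2_eq0 (inS_H1 S)) Ix.
  by apply/eqP; rewrite eq_le le H1norm2_ge0.
- exists (4 * K0) => f f1 ft ft1 S.
  have [[_ [_ hft]] _ _] := S; have hF := inS_H1 S.
  apply: bound.
    have E (p p' : R -> C) : (fun x => p x + (- z) * p' x) = (fun x => p x - z * p' x).
      by apply/funext => x; rewrite mulNr.
    by have := H1_add H (- z) hft hF; rewrite !E.
  rewrite /Res.
  have E (p p' : R -> C) : (fun x => p x - z * p' x + z * p' x) = p.
    by apply/funext => x; rewrite subrK.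
  by rewrite !E.
Qed.

(** By the resolvent identity the difference is [(z - z0) (S - z0)^-1 p], where [p] is bounded
    uniformly for [z] near [z0] by [resolvent_open]; then point values are estimated by norms. *)
Lemma Res_continuous z0 h h1 f f1 x0 : resolvent z0 -> H1 D h h1 ->
  Res z0 h h1 f f1 -> I x0 -> exists e L : R, [/\ 0 < e, 0 <= L &
  forall z p p1, cnorm2 (z - z0) <= e -> Res z h h1 p p1 ->
    nrm (p x0 - f x0) <= L * nrm (z - z0) /\ nrm (p1 x0 - f1 x0) <= L * nrm (z - z0)].
Proof.
move=> r0 hh Sf Ix0; have [e [K [e0 Kp KP]]] := resolvent_open r0.
have [K0 K0p KP0] := Res_bound r0.
have [y0 [Iy0 xy]] := Iab_right Ix0.
have [Ke Ke0 KeP] := eval_bound H Ix0 Iy0.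
have [K1 K10 K1P] := eval1_bound H Ix0 Iy0 xy.
set N := H1norm2 D h h1; have N0 : 0 <= N by exact: H1norm2_ge0.
(* [A1] and [A2] bound the squared norms of the two components of the difference pair, divided by
   [cnorm2 (z - z0)]; the quasi-derivative at [x0] depends on both. *)
pose A1 := K0 * (2 * (K * N)).
pose A2 := 2 * (K * N) + 2 * cnorm2 z0 * A1.
have A10 : 0 <= A1 by rewrite !mulr_ge0// ltW.
have A20 : 0 <= A2 by rewrite addr_ge0 ?mulr_ge0 ?cnorm2_ge0// ltW.
exists e, (Ke * Num.sqrt A1 + K1 * (Num.sqrt A1 + Num.sqrt A2)); split => //.
  by rewrite addr_ge0 ?mulr_ge0 ?addr_ge0 ?sqrtr_ge0.
move=> z p p1 ze Sp; have [rz bz] := KP z ze.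
have Np := bz _ _ _ _ hh Sp; rewrite -/N in Np.
have hp := inS_H1 Sp; have hF := inS_H1 Sf.
have Sd := Res_sub Sp Sf.
set q := cnorm2 (z - z0).
have q0 : 0 <= q by exact: cnorm2_ge0.
have b1 : H1norm2 D (fun x => p x - f x) (fun x => p1 x - f1 x) <= q * A1.
  apply: (le_trans (KP0 _ _ _ _ Sd)).
  apply: (le_trans (ler_wpM2l (ltW K0p) (H1norm2_Z _ hp))); rewrite -/q /A1.
  have -> : q * (K0 * (2 * (K * N))) = K0 * (2 * q * (K * N)) by ring.
  by apply: ler_wpM2l; [exact: ltW|apply: ler_wpM2l => //; rewrite mulr_ge0].
have [Td _ _] := Sd; have [td [hd hdt]] := Td.
have b2 : H1norm2 D (fun x => (z - z0) * p x + z0 * (p x - f x))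
   (fun x => (z - z0) * p1 x + z0 * (p1 x - f1 x)) <= q * A2.
  apply: (le_trans (H1norm2_add H (z - z0) z0 hp hd)); rewrite -/q /A2.
  have -> : q * (2 * (K * N) + 2 * cnorm2 z0 * A1) =
    2 * q * (K * N) + 2 * cnorm2 z0 * (q * A1) by ring.
  by apply: lerD; apply: ler_wpM2l => //; rewrite mulr_ge0// cnorm2_ge0.
have h1' : hn D (fun x => p x - f x) (fun x => p1 x - f1 x) <= Num.sqrt A1 * nrm (z - z0).
  by rewrite /hn /nrm -sqrtrM// ler_wsqrtr// mulrC.
have h2' : hn D (fun x => (z - z0) * p x + z0 * (p x - f x))
   (fun x => (z - z0) * p1 x + z0 * (p1 x - f1 x)) <= Num.sqrt A2 * nrm (z - z0).
  by rewrite /hn /nrm -sqrtrM// ler_wsqrtr// mulrC.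
have n0 := nrm_ge0 (z - z0).
split.
- apply: (le_trans (KeP _ _ hd x0 (lexx _) (ltW xy))).
  apply: (le_trans (ler_wpM2l Ke0 h1')); rewrite mulrA; apply: ler_wpM2r => //.
  by rewrite lerDl mulr_ge0 ?addr_ge0 ?sqrtr_ge0.
- apply: (le_trans (K1P _ _ _ _ td hd hdt x0 (lexx _) (ltW xy))).
  apply: (le_trans (ler_wpM2l K10 (lerD h1' h2'))); rewrite -mulrDl mulrA.
  by apply: ler_wpM2r => //; rewrite lerDr mulr_ge0 ?sqrtr_ge0.
Qed.

End Resolvent.

(** * Weyl's alternative *)

Section Weyl.
Context {R : realType} (D : sldata R).
Hypothesis H : sl_hyp D.
Local Notation C := (Cx R).
Local Notation I := (Iab D).
Local Notation hf n := ((2 : R)^-1 ^+ n).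
Implicit Types (m : {measure set R -> \bar R}) (f g h u : R -> C).

Lemma L2_exhaust m (A : set R) (Bn : nat -> set R) f (M : R) : measurable A ->
  (forall n, measurable (Bn n)) -> cmeas A f -> (forall n, Bn n `<=` A) ->
  (forall t, A t -> exists N, forall n, (N <= n)%N -> Bn n t) ->
  (forall n, L2 m (Bn n) f) ->
  (forall n, Rintegral m (Bn n) (fun t => cnorm2 (f t)) <= M) -> L2 m A f.
Proof.
move=> mA mB mf BA ex fi fM.
pose F n t : C := if t \in Bn n then f t else 0.
have mF n : cmeas A (F n).
  have [m1 m2] := mf; have mI : measurable (A `&` Bn n) by exact: measurableI.
  split.
  - have h : measurable_fun A ((fun t => ReC (f t)) \_ (Bn n)).
      apply/(measurable_restrict _ (mB n) mA).
      by apply: measurable_funS m1 => //; exact: subIsetl.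
    by apply: eq_measurable_fun h => t _; rewrite /F patchE; case: ifP.
  - have h : measurable_fun A ((fun t => ImC (f t)) \_ (Bn n)).
      apply/(measurable_restrict _ (mB n) mA).
      by apply: measurable_funS m2 => //; exact: subIsetl.
    by apply: eq_measurable_fun h => t _; rewrite /F patchE; case: ifP.
have FE n t : cnorm2 (F n t) = ((fun t => cnorm2 (f t)) \_ (Bn n)) t.
  by rewrite /F patchE; case: ifP => _ //; exact: cnorm20.
have fin n : rint m A (fun t => cnorm2 (F n t)).
  have h : m.-integrable A ((fun t => (cnorm2 (f t))%:E) \_ (Bn n)).
    apply/(integrable_restrict m (mB n) mA); rewrite setIidr//; exact: L2_rint (fi n).
  apply: eq_integrable h => // t _; rewrite FE.
  by rewrite !patchE; case: ifP.
have [] // : L2 m A f /\ Rintegral m A (fun t => cnorm2 (f t)) <= M.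
apply: (L2_limit (F := F)) => // [n|n|t At].
- exact: L2I.
- apply: le_trans (fM n); rewrite -[X in _ <= Rintegral m X _](setIidr (BA n)).
  rewrite Rintegral_mkcondr le_eqVlt; apply/orP; left; apply/eqP.
  by apply: Rint_eq => t _; rewrite FE.
(* [L2_limit] asks for a geometric rate. The truncations equal [f t] from [N] on, and before that
   the error [nrm (f t)] is at most [nrm (f t) * 2^N * 2^-n]. *)
- have [N NP] := ex t At; exists (nrm (f t) * 2 ^+ N) => n.
  have h0 := ltW (hf_gt0 n : 0 < hf n).
  have [Nn|nN] := leqP N n.
    rewrite /F mem_set; last exact: NP.
    rewrite subrr nrm0; apply: mulr_ge0 => //.
    by rewrite mulr_ge0 ?nrm_ge0// exprn_ge0.
  have le1 : 1 <= 2 ^+ N * hf n.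
    rewrite exprVn -ler_pdivrMr ?invr_gt0 ?exprn_gt0// invrK mul1r.
    by rewrite ler_eXn2l ?ltr1n// ltnW.
  rewrite -mulrA; apply: (@le_trans _ _ (nrm (f t))); last by rewrite ler_peMr ?nrm_ge0.
  by rewrite /F; case: ifP => _; rewrite ?subrr ?nrm0 ?nrm_ge0 ?subr0.
Qed.

Lemma L2_bounded_a m c u (M : R) : locfin D m -> locb D u -> I c ->
  (forall y, I y -> y <= c -> Rintegral m `[y, c[ (fun t => cnorm2 (u t)) <= M) ->
  L2 m (Iac D c) u.
Proof.
move=> lm lu Ic uM; have [l [Il lc ldec lex E]] := Iac_bigcup Ic.
have mc := measurable_Iac Ic.
apply: (@L2_exhaust m _ (fun n => `[l n, c[%classic) _ M) => //.
- by case: lu => mu _; apply: cmeas_sub mu; [exact: measurable_Iab|exact: Iac_sub].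
- by move=> n; rewrite E => t ht; exists n.
- move=> t At; have [N lN] := lex t (Iac_sub Ic At); exists N => n Nn /=.
  case: At => _ tc; rewrite in_itv/= tc andbT.
  by apply: le_trans (ldec _ _ Nn) _; exact: ltW.
- by move=> n; exact: (locb_L2 H lm lu (Il n) Ic).
- by move=> n; exact: (uM _ (Il n) (lc n)).
Qed.

Lemma L2_bounded_b m c u (M : R) : locfin D m -> locb D u -> I c ->
  (forall y, I y -> c <= y -> Rintegral m `[c, y[ (fun t => cnorm2 (u t)) <= M) ->
  L2 m (Icb D c) u.
Proof.
move=> lm lu Ic uM; have [l [Il lc linc lex E]] := Icb_bigcup Ic.
have mc := measurable_Icb Ic; have mc' := measurable_Ibc Ic.
suff h : L2 m (Ibc D c) u.
  by apply: L2_sub h => // t [ct tb]; split => //; exact: ltW.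
apply: (@L2_exhaust m _ (fun n => `[c, l n[%classic) _ M) => //.
- by case: lu => mu _; apply: cmeas_sub mu; [exact: measurable_Iab|exact: Ibc_sub].
- move=> n t /=; rewrite in_itv/= => /andP[ct tl]; split => //.
  by case: (Il n) => _; apply: lt_trans; rewrite lte_fin.
- move=> t At; have [N lN] := lex t (Ibc_sub Ic At); exists N => n Nn /=.
  case: At => ct _; rewrite in_itv/= ct /=.
  by apply: lt_le_trans lN _; exact: linc.
- by move=> n; exact: (locb_L2 H lm lu Ic (Il n)).
- by move=> n; exact: (uM _ (Il n) (lc n)).
Qed.

(** The weight [d = 4 P / X] makes the first term [X / 2], which is absorbed on the left, without
    extracting roots. If [P = 0], a small [d] forces [X = 0]. *)
Lemma sqr_le_of_weighted (X P Q : R) : 0 <= X -> 0 <= P -> 0 <= Q ->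
  (forall d, 0 < d -> X <= 2 * (d^-1 * P + d * Q)) -> X ^+ 2 <= 16 * (P * Q).
Proof.
move=> X0 P0 Q0 h; have [Xz|Xp] := eqVneq X 0.
  by rewrite Xz expr0n !mulr_ge0.
have {Xp}Xp : 0 < X by rewrite lt_def Xp.
have [Pz|Pp] := eqVneq P 0.
  have d0 : 0 < X / (4 * (Q + 1)) by rewrite divr_gt0// mulr_gt0// ltr_wpDl.
  have := h _ d0; rewrite Pz mulr0 add0r.
  have -> : 2 * (X / (4 * (Q + 1)) * Q) = X / 2 * (Q / (Q + 1)).
    by field; rewrite gt_eqF// ltr_wpDl.
  have : Q / (Q + 1) <= 1 by rewrite ler_pdivrMr ?ltr_wpDl// mul1r lerDl.
  have : 0 <= Q / (Q + 1) by rewrite divr_ge0// addr_ge0.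
  nra.
have {Pp}Pp : 0 < P by rewrite lt_def Pp.
have d0 : 0 < 4 * P / X by rewrite divr_gt0// mulr_gt0.
have := h _ d0.
have -> : 2 * ((4 * P / X)^-1 * P + 4 * P / X * Q) = X / 2 + 8 * (P * Q) / X.
  by field; rewrite (gt_eqF Xp) (gt_eqF Pp).
move=> le.
have : X / 2 <= 8 * (P * Q) / X by lra.
by rewrite ler_pdivlMr//; nra.
Qed.

Definition energy (x c : R) f f1 : R := Rintegral (chi D) `[x, c[ (fun t => cnorm2 (f t)) +
  Rintegral (sigma D) `[x, c[ (fun t => cnorm2 (f1 t)).

Lemma energy_ge0 x c f f1 : 0 <= energy x c f f1.
Proof. by apply: addr_ge0; apply: Rintegral_ge0 => t _; exact: cnorm2_ge0. Qed.

Lemma cint_mul_bound m (p q : R -> C) (A : set R) (d : R) : measurable A -> 0 < d ->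
  L2 m A p -> L2 m A q ->
  nrm (cint m A (fun t => p t * q t)) <=
  2 * (d^-1 * Rintegral m A (fun t => cnorm2 (p t)) + d * Rintegral m A (fun t => cnorm2 (q t))).
Proof.
move=> mA d0 pi qi; have jp := L2_rint pi; have jq := L2_rint qi.
have i1 : rint m A (fun t => d^-1 * cnorm2 (p t)) by exact: rintZ.
have i2 : rint m A (fun t => d * cnorm2 (q t)) by exact: rintZ.
rewrite -!RintegralZl// -RintegralD//.
apply: nrm_cint_le => //; [exact: L2_mul|exact: rintD|].
by move=> t _; exact: nrmM_weighted.
Qed.

Lemma energy_cross f f1 g g1 x c : I x -> I c -> locb D f -> locb D f1 -> locb D g -> locb D g1 ->
  cnorm2 (cint (sigma D) `[x, c[ (fun t => f1 t * g1 t) +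
       cint (chi D) `[x, c[ (fun t => f t * g t)) <= 16 * (energy x c f f1 * energy x c g g1).
Proof.
move=> Ix Ic lf lf1 lg lg1; rewrite -sqr_nrm.
apply: sqr_le_of_weighted; [exact: nrm_ge0|exact: energy_ge0|exact: energy_ge0|move=> d d0].
have fs := locb_L2 H (locfin_sigma H); have fc := locb_L2 H (locfin_chi H).
have e1 := cint_mul_bound (measurable_itv _) d0 (fs _ _ _ lf1 Ix Ic) (fs _ _ _ lg1 Ix Ic).
have e2 := cint_mul_bound (measurable_itv _) d0 (fc _ _ _ lf Ix Ic) (fc _ _ _ lg Ix Ic).
apply: (le_trans (le_nrmD _ _)); apply: (le_trans (lerD e1 e2)).
by rewrite /energy le_eqVlt; apply/orP; left; apply/eqP; ring.
Qed.

(* Weyl's first theorem: a fundamental system at [z0] in H^1 near [a] forces every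
   solution at any other [z] into H^1 near [a].  Writing [u] through the coefficients
   [V] (variation of constants), the energy [N] of [u] on [[y, c[] satisfies
   [N <= const + N / 2] once the energies of [th] and [ph] on [(a, c)] are small. *)
Section AlternativeAtA.
Variables (z0 z : C) (th th1 ph ph1 u u1 : R -> C).
Hypotheses (z00 : z0 != 0) (z_0 : z != 0) (sth : is_sol D z0 th th1)
  (sph : is_sol D z0 ph ph1) (su : is_sol D z u u1)
  (W : forall x, I x -> Wr th th1 ph ph1 x = z0^-1)
  (hth : H1_near_a D th th1) (hph : H1_near_a D ph ph1).

Let V v v1 x := Vw u1 (fun t => z * u t) v1 (fun t => z0 * v t) x.

(** Variation of constants by Cramer's rule, for the vector [(u1, z u)] in the basis [(th1, z0 th)],
    [(ph1, z0 ph)]. The coefficients are values of [V], so by the Lagrange identity their increments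
    involve only [sigma] and [chi]. *)
Let u_eq x : I x -> u x = z0 / z * (V ph ph1 x * th x - V th th1 x * ph x) /\
  u1 x = V ph ph1 x * th1 x - V th th1 x * ph1 x.
Proof.
move=> Ix; have e : th x * ph1 x - th1 x * ph x = z0^-1 := W Ix.
have e1 : z0 * (th x * ph1 x - th1 x * ph x) = 1 by rewrite e mulfV.
split.
- rewrite (_ : V ph ph1 x * th x - V th th1 x * ph x =
    z * u x * (th x * ph1 x - th1 x * ph x)); last by rewrite /V /Vw; ring.
  by rewrite e; field; rewrite z00.
- rewrite (_ : V ph ph1 x * th1 x - V th th1 x * ph1 x =
    u1 x * (z0 * (th x * ph1 x - th1 x * ph x))); last by rewrite /V /Vw; ring.
  by rewrite e1 mulr1.
Qed.

Let lu := tau_locb H su.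
Let lu1 := tau_locb1 H su.

(** By the Lagrange identity [V] changes by [z - z0] times a mixed energy of [u] and [v]. The
    constant 32 is 2 from [cnorm2D] times 16 from [energy_cross]. *)
Let V_incr v v1 x c : is_sol D z0 v v1 -> I x -> I c -> x <= c ->
  cnorm2 (V v v1 x) <= 2 * cnorm2 (V v v1 c) +
    32 * cnorm2 (z - z0) * (energy x c u u1 * energy x c v v1).
Proof.
move=> sv Ix Ic xc.
have lv := tau_locb H sv; have lv1 := tau_locb1 H sv.
have := lagrange_identity H su (isAC_Z H z (tau_ac su)) sv (isAC_Z H z0 (tau_ac sv)) Ix Ic xc.
rewrite -/(V v v1 x) -/(V v v1 c).
have lc m p q : locfin D m -> locb D p -> locb D q ->
    cintegrable m `[x, c[ (fun t => p t * q t).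
  by move=> lm lp lq; exact: (L1loc_co (locb_L1loc H lm (locbM lp lq)) Ix Ic).
have -> : cint (sigma D) `[x, c[ (fun t => z * u1 t * v1 t - u1 t * (z0 * v1 t)) =
  (z - z0) * cint (sigma D) `[x, c[ (fun t => u1 t * v1 t).
  rewrite -cintZ//; last by apply: lc => //; exact: locfin_sigma.
  by apply: cint_eq => t _; ring.
have -> : cint (chi D) `[x, c[ (fun t => z * u t * v t - u t * (z0 * v t)) =
  (z - z0) * cint (chi D) `[x, c[ (fun t => u t * v t).
  rewrite -cintZ//; last by apply: lc => //; exact: locfin_chi.
  by apply: cint_eq => t _; ring.
rewrite -mulrDr; set X := (cint (sigma D) _ _ + cint (chi D) _ _) => E.
have -> : V v v1 x = V v v1 c + - ((z - z0) * X) by rewrite -E; ring.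
apply: (le_trans (cnorm2D _ _)); rewrite lerD2l cnorm2N cnorm2M.
have := energy_cross Ix Ic lu lu1 lv lv1; rewrite -/X => le.
have := ler_wpM2l (cnorm2_ge0 (z - z0)) le; lra.
Qed.

Lemma weyl_alternative_sol : H1_near_a D u u1.
Proof.
split; first exact: tau_ac su.
have lth := tau_locb H sth; have lth1 := tau_locb1 H sth.
have lph := tau_locb H sph; have lph1 := tau_locb1 H sph.
have [c0 Ic0] := Iab_nonempty H.
have [t0 t1] := H1_near_a_ext H hth lth lth1 Ic0.
have [p0 p1] := H1_near_a_ext H hph lph lph1 Ic0.
have mc0 := measurable_Iac Ic0.
pose g t := cnorm2 (th t) + cnorm2 (ph t).
pose g1 t := cnorm2 (th1 t) + cnorm2 (ph1 t).
have g0 t : 0 <= g t by rewrite addr_ge0 ?cnorm2_ge0.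
have g10 t : 0 <= g1 t by rewrite addr_ge0 ?cnorm2_ge0.
have gi : rint (chi D) (Iac D c0) g by apply: rintD => //; exact: L2_rint.
have g1i : rint (sigma D) (Iac D c0) g1 by apply: rintD => //; exact: L2_rint.
set q := cnorm2 (z - z0); have q0 : 0 <= q by exact: cnorm2_ge0.
(* [k] serves both expansions in [u_eq]: the one of [u] needs [2 |z0 / z|^2], the one of [u1] needs
   2. *)
pose k := 2 * (cnorm2 (z0 / z) + 1).
have k0 : 0 < k by rewrite mulr_gt0// ltr_wpDl// cnorm2_ge0.
have k2 : 2 <= k by rewrite /k; have := cnorm2_ge0 (z0 / z); lra.
have kz : 2 * cnorm2 (z0 / z) <= k by rewrite /k; lra.
clearbody k.
have k0' := ltW k0.
(* Chosen so that [64 k q e <= 1]; with [Ph < e <= 1] the feedback coefficient [32 k q Ph^2] is then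
   at most 1/2. *)
pose e := Num.min 1 (64 * k * (q + 1))^-1.
have e0 : 0 < e.
  rewrite lt_min ltr01 invr_gt0 mulr_gt0// ?ltr_wpDl//; first exact: mulr_gt0.
have e1 : e <= 1 by rewrite ge_min lexx.
have ke : 64 * k * q * e <= 1.
  apply: (@le_trans _ _ (64 * k * (q + 1) * (64 * k * (q + 1))^-1)).
    apply: ler_pM.
    - by rewrite !mulr_ge0.
    - exact: (ltW e0).
    - by rewrite ler_wpM2l ?lerDl// mulr_ge0.
    - by rewrite ge_min lexx orbT.
  by rewrite divff// gt_eqF// mulr_gt0// ?ltr_wpDl//; exact: mulr_gt0.
have e2 : 0 < e / 2 by rewrite divr_gt0.
have [d [Id dc dP]] := tail_a Ic0 gi g0 e2.
have [d' [Id' dc' dP']] := tail_a Ic0 g1i g10 e2.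
pose c := Num.min d d'.
have Ic : I c by exact: Iab_min.
have [ig Eg] := dP c Ic ltac:(by rewrite ge_min lexx).
have [ig1 Eg1] := dP' c Ic ltac:(by rewrite ge_min lexx orbT).
pose Ph := Rintegral (chi D) (Iac D c) g + Rintegral (sigma D) (Iac D c) g1.
have Phe : Ph < e by rewrite /Ph (splitr e) ltrD.
have mc := measurable_Iac Ic.
have Ph0 : 0 <= Ph.
  by apply: addr_ge0; apply: Rintegral_ge0 => t _; [exact: g0|exact: g10].
pose A := 2 * cnorm2 (V ph ph1 c) + 2 * cnorm2 (V th th1 c).
have A0 : 0 <= A.
  by rewrite /A; have := cnorm2_ge0 (V ph ph1 c); have := cnorm2_ge0 (V th th1 c); lra.
have sub y : I y -> `[y, c[ `<=` Iac D c.
  move=> [ay _] t /=; rewrite in_itv/= => /andP[yt tc]; split => //.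
  by apply: (lt_le_trans ay); rewrite lee_fin.
have EnPh y : I y -> energy y c th th1 + energy y c ph ph1 <= Ph.
  move=> Iy; have my : measurable (`[y, c[%classic : set R) by exact: measurable_itv.
  have s1 : Rintegral (chi D) `[y, c[ g <= Rintegral (chi D) (Iac D c) g.
    by apply: Rint_ge0_sub => //; exact: sub.
  have s2 : Rintegral (sigma D) `[y, c[ g1 <= Rintegral (sigma D) (Iac D c) g1.
    by apply: Rint_ge0_sub => //; exact: sub.
  have fs := locb_L2 H (locfin_sigma H); have fc := locb_L2 H (locfin_chi H).
  have : Rintegral (chi D) `[y, c[ g = Rintegral (chi D) `[y, c[ (fun t => cnorm2 (th t))
     + Rintegral (chi D) `[y, c[ (fun t => cnorm2 (ph t)).
    by rewrite -RintegralD//; apply: L2_rint; exact: fc.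
  have : Rintegral (sigma D) `[y, c[ g1 = Rintegral (sigma D) `[y, c[ (fun t => cnorm2 (th1 t))
     + Rintegral (sigma D) `[y, c[ (fun t => cnorm2 (ph1 t)).
    by rewrite -RintegralD//; apply: L2_rint; exact: fs.
  by rewrite /energy /Ph; lra.
have main y : I y -> y <= c -> energy y c u u1 <= 2 * k * A * Ph.
  move=> Iy yc; set N := energy y c u u1.
  have N0 : 0 <= N by exact: energy_ge0.
  have my : measurable (`[y, c[%classic : set R) by exact: measurable_itv.
  (* [T] bounds both coefficients on [[y, c[]. It contains the energy [N] that is being estimated,
     but multiplied by the small [Ph], so [N] can be absorbed. *)
  pose T := A + 32 * q * (N * Ph).
  have T0 : 0 <= T by rewrite addr_ge0// !mulr_ge0.
  have fs := locb_L2 H (locfin_sigma H); have fc := locb_L2 H (locfin_chi H).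
  have pt x : y <= x -> x < c ->
      cnorm2 (V ph ph1 x) <= T /\ cnorm2 (V th th1 x) <= T.
    move=> yx xc; have Ix := Iab_conv Iy Ic yx (ltW xc).
    have sb : `[x, c[ `<=` `[y, c[%classic.
      by move=> t /=; rewrite !in_itv/= => /andP[xt ->]; rewrite (le_trans yx xt).
    have Nx : energy x c u u1 <= N.
      by apply: lerD; apply: Rint_ge0_sub => //; try (by move=> t _; exact: cnorm2_ge0);
        apply: L2_rint; [exact: fc|exact: fs].
    have := EnPh x Ix; have t1' := energy_ge0 x c th th1; have t2' := energy_ge0 x c ph ph1.
    move=> tp; have tl : energy x c th th1 <= Ph by lra.
    have pl : energy x c ph ph1 <= Ph by lra.
    have Nx0 := energy_ge0 x c u u1.
    have vp := V_incr sph Ix Ic (ltW xc); have vt := V_incr sth Ix Ic (ltW xc).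
    have c1 := cnorm2_ge0 (V ph ph1 c); have c2 := cnorm2_ge0 (V th th1 c).
    have l1 : 32 * q * (energy x c u u1 * energy x c ph ph1) <= 32 * q * (N * Ph).
      by apply: ler_wpM2l; [rewrite mulr_ge0|apply: ler_pM].
    have l2 : 32 * q * (energy x c u u1 * energy x c th th1) <= 32 * q * (N * Ph).
      by apply: ler_wpM2l; [rewrite mulr_ge0|apply: ler_pM].
    by rewrite /T /A; split; [move: vp l1|move: vt l2]; rewrite -/q; lra.
  have bu x : `[y, c[%classic x -> cnorm2 (u x) <= k * T * g x.
    rewrite /= in_itv/= => /andP[yx xc]; have Ix := Iab_conv Iy Ic yx (ltW xc).
    have [b1 b2] := pt x yx xc; have [-> _] := u_eq Ix.
    rewrite cnorm2M; apply: (@le_trans _ _ (cnorm2 (z0 / z) * (2 * (T * g x)))).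
      apply: ler_wpM2l; first exact: cnorm2_ge0.
      apply: (le_trans (cnorm2D _ _)); rewrite cnorm2N !cnorm2M /g.
      have := ler_wpM2r (cnorm2_ge0 (th x)) b1; have := ler_wpM2r (cnorm2_ge0 (ph x)) b2.
      lra.
    have -> : k * T * g x = k * (T * g x) by ring.
    have Tg : 0 <= T * g x by rewrite mulr_ge0.
    by have := ler_wpM2r Tg kz; lra.
  have bu1 x : `[y, c[%classic x -> cnorm2 (u1 x) <= k * T * g1 x.
    rewrite /= in_itv/= => /andP[yx xc]; have Ix := Iab_conv Iy Ic yx (ltW xc).
    have [b1 b2] := pt x yx xc; have [_ ->] := u_eq Ix.
    apply: (@le_trans _ _ (2 * (T * g1 x))).
      apply: (le_trans (cnorm2D _ _)); rewrite cnorm2N !cnorm2M /g1.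
      have := ler_wpM2r (cnorm2_ge0 (th1 x)) b1; have := ler_wpM2r (cnorm2_ge0 (ph1 x)) b2.
      lra.
    have -> : k * T * g1 x = k * (T * g1 x) by ring.
    have Tg : 0 <= T * g1 x by rewrite mulr_ge0.
    by have := ler_wpM2r Tg k2; lra.
  have igy : rint (chi D) `[y, c[ g by apply: rint_sub ig => //; exact: sub.
  have ig1y : rint (sigma D) `[y, c[ g1 by apply: rint_sub ig1 => //; exact: sub.
  have s1 : Rintegral (chi D) `[y, c[ (fun t => cnorm2 (u t)) <=
      k * T * Rintegral (chi D) (Iac D c) g.
    apply: (@le_trans _ _ (Rintegral (chi D) `[y, c[ (fun t => k * T * g t))).
      by apply: Rint_le => //; [apply: L2_rint; exact: fc|exact: rintZ].
    rewrite RintegralZl//; apply: ler_wpM2l; first by rewrite mulr_ge0// ltW.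
    by apply: Rint_ge0_sub => //; exact: sub.
  have s2 : Rintegral (sigma D) `[y, c[ (fun t => cnorm2 (u1 t)) <=
      k * T * Rintegral (sigma D) (Iac D c) g1.
    apply: (@le_trans _ _ (Rintegral (sigma D) `[y, c[ (fun t => k * T * g1 t))).
      by apply: Rint_le => //; [apply: L2_rint; exact: fs|exact: rintZ].
    rewrite RintegralZl//; apply: ler_wpM2l; first by rewrite mulr_ge0// ltW.
    by apply: Rint_ge0_sub => //; exact: sub.
  have NT : N <= k * T * Ph by rewrite /N /energy /Ph mulrDr lerD.
  have small : 32 * k * q * (Ph * Ph) <= 2^-1.
    have PP : Ph * Ph <= e by rewrite -[leRHS]mulr1; apply: ler_pM => //;
      [exact: ltW|apply: le_trans e1; exact: ltW].
    have kq : 0 <= 32 * k * q by rewrite !mulr_ge0// ltW.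
    have := ler_wpM2l kq PP; lra.
  have := ler_wpM2r N0 small.
  move: NT; rewrite /T.
  have -> : k * (A + 32 * q * (N * Ph)) * Ph = k * A * Ph + 32 * k * q * (Ph * Ph) * N by ring.
  lra.
exists c; split => //; split.
- apply: (L2_bounded_a (locfin_chi H) lu Ic) => y Iy yc.
  apply: le_trans (main y Iy yc); rewrite lerDl.
  by apply: Rintegral_ge0 => t _; exact: cnorm2_ge0.
- apply: (L2_bounded_a (locfin_sigma H) lu1 Ic) => y Iy yc.
  apply: le_trans (main y Iy yc); rewrite lerDr.
  by apply: Rintegral_ge0 => t _; exact: cnorm2_ge0.
Qed.

End AlternativeAtA.

End Weyl.

(** * Weyl's disc argument at b for the parameter i *)

Section WeylDisc.
Context {R : realType} (D : sldata R).
Hypothesis H : sl_hyp D.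
Local Notation C := (Cx R).
Local Notation I := (Iab D).
Implicit Types (m : {measure set R -> \bar R}) (f g h u : R -> C).

Lemma sol_comb z u u1 v v1 (k l : C) : is_sol D z u u1 -> is_sol D z v v1 ->
  is_sol D z (fun x => k * u x + l * v x) (fun x => k * u1 x + l * v1 x).
Proof.
move=> su sv; have := tau_add H l (tau_Z H k su) sv.
by apply: tau_eq => // x _; ring.
Qed.

Lemma iC_neq0 : (iC : C) != 0.
Proof. by apply/eqP => /(congr1 ImC); rewrite !reimE => /eqP; rewrite oner_eq0. Qed.

(** Half the imaginary part of [V] of [u] and its conjugate, when [u] is a solution with parameter
    [i]. *)
Definition flux u u1 x : R := ReC (u x * cconj (u1 x)).

(* Green's identity for [z = i]: the flux of a solution is its energy. *)
Lemma flux_incr u u1 x y : is_sol D iC u u1 -> I x -> I y -> x <= y ->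
  flux u u1 y - flux u u1 x = energy D x y u u1.
Proof.
move=> su Ix Iy xy.
have ac := isAC_Z H iC (tau_ac su).
have := lagrange_identity H su ac (tau_conj H su) (isAC_conj H ac) Ix Iy xy.
move=> /(congr1 ImC); rewrite [ImC (_ - _)]ImCD ImCN [in RHS]ImCD !Im_cint.
have V t : ImC (Vw u1 (fun x => iC * u x) (fun x => cconj (u1 x)) (fun x => cconj (iC * u x)) t)
    = 2 * flux u u1 t by rewrite /Vw /flux !reimE; ring.
rewrite !V.
have lu := tau_locb H su; have lu1 := tau_locb1 H su.
have j m v : locfin D m -> locb D v -> rint m `[x, y[ (fun t => cnorm2 (v t)).
  by move=> lm lv; apply: L2_rint; exact: (locb_L2 H lm lv Ix Iy).
have E m v : locfin D m -> locb D v -> Rintegral m `[x, y[ (fun t => 2 * cnorm2 (v t)) =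
    2 * Rintegral m `[x, y[ (fun t => cnorm2 (v t)).
  by move=> lm lv; rewrite RintegralZl//; exact: j.
rewrite (_ : Rintegral (sigma D) _ _ =
    Rintegral (sigma D) `[x, y[ (fun t => 2 * cnorm2 (u1 t))); last first.
  by apply: Rint_eq => t _; rewrite /cnorm2 !reimE; ring.
rewrite (_ : Rintegral (chi D) _ _ =
    Rintegral (chi D) `[x, y[ (fun t => 2 * cnorm2 (u t))); last first.
  by apply: Rint_eq => t _; rewrite /cnorm2 !reimE; ring.
rewrite (E _ _ (locfin_sigma H) lu1) (E _ _ (locfin_chi H) lu) /energy => e.
lra.
Qed.

Section Disc.
Variables (c : R) (p p1 q q1 : R -> C).
Hypotheses (Ic : I c) (sp : is_sol D iC p p1) (sq : is_sol D iC q q1)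
  (pc : p c = 1) (p1c : p1 c = 0) (qc : q c = 0) (q1c : q1 c = 1).

Let um (k : C) x := p x + k * q x.
Let um1 (k : C) x := p1 x + k * q1 x.

Let um_sol k : is_sol D iC (um k) (um1 k).
Proof.
apply: (tau_eq H _ _ _ (sol_comb 1 k sp sq)) => x _.
- by rewrite /um mul1r.
- by rewrite /um1 mul1r.
- by rewrite /um mul1r.
Qed.


(** If [q] vanished at [y], the flux would vanish at both ends and the energy in between would be 0.
    Then [q = 0] on [[c, y]], so the equation keeps [q1] at its initial value 1, although its square
    has integral 0 and [sigma] charges [[c, y[]. *)
Lemma disc_q_neq0 y : I y -> c < y -> q y != 0.
Proof.
move=> Iy cy; apply/eqP => qy0.
have cy' := ltW cy.
have AB : energy D c y q q1 = 0.
  by rewrite -(flux_incr sq Ic Iy cy') /flux qy0 qc !mul0r subrr.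
have A0 : 0 <= Rintegral (chi D) `[c, y[ (fun t => cnorm2 (q t)).
  by apply: Rintegral_ge0 => t _; exact: cnorm2_ge0.
have B0 : 0 <= Rintegral (sigma D) `[c, y[ (fun t => cnorm2 (q1 t)).
  by apply: Rintegral_ge0 => t _; exact: cnorm2_ge0.
have Bz : Rintegral (sigma D) `[c, y[ (fun t => cnorm2 (q1 t)) = 0.
  by move: AB; rewrite /energy; lra.
have lq1 := tau_locb1 H sq.
have q0 t : c <= t -> t <= y -> q t = 0.
  move=> ct ty; have It := Iab_conv Ic Iy ct ty.
  have fB := locfin_co (locfin_sigma H) Ic It.
  have [_ e] := cnorm2_cint_le (measurable_itv _) fB (locb_L2 H (locfin_sigma H) lq1 Ic It).
  have : cnorm2 (q t) <= 0.
    rewrite -(subr0 (q t)) -qc (isAC_incr (tau_ac sq) Ic It ct); apply: (le_trans e).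
    rewrite (_ : Rintegral _ _ _ = 0) ?mulr0//.
    apply/eqP; rewrite eq_le Rintegral_ge0 ?andbT => [|s _]; last exact: cnorm2_ge0.
    rewrite -Bz; apply: Rint_ge0_sub => //.
    - by move=> s /=; rewrite !in_itv/= => /andP[-> st]; exact: lt_le_trans st ty.
    - by apply: L2_rint; exact: (locb_L2 H (locfin_sigma H) lq1 Ic Iy).
    - by move=> s _; exact: cnorm2_ge0.
  move=> le; apply/eqP; rewrite -cnorm2_eq0 eq_le le; exact: cnorm2_ge0.
have q11 t : c <= t -> t < y -> q1 t = 1.
  move=> ct ty; have It := Iab_conv Ic Iy ct (ltW ty).
  rewrite -(subrK (q1 c) (q1 t)) (tau_incr sq Ic It ct) q1c.
  have z s : `[c, t[%classic s -> q s = 0.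
    rewrite /= in_itv/= => /andP[cs st]; apply: q0 => //.
    exact: ltW (lt_trans st ty).
  rewrite (cint_eq _ z) crho0; last by move=> s /z ->; rewrite mulr0.
  rewrite (_ : cint _ _ _ = 0) ?subr0 ?add0r//.
  by apply: eqCx; rewrite ?Re_cint ?Im_cint /Rintegral/= integral0.
have := sigma_itv_gt0 H Ic Iy cy.
have E : Rintegral (sigma D) `[c, y[ (fun t => cnorm2 (q1 t)) =
  1 * fine (sigma D `[c, y[%classic).
  rewrite -Rintegral_cst//; apply: Rint_eq => t /=; rewrite in_itv/= => /andP[ct ty].
  by rewrite q11// cnorm2_1.
by move: E; rewrite Bz mul1r => <-; rewrite ltxx.
Qed.

(** The flux of [p + k q] at [x] as a real quadratic polynomial in [s = (Re k, Im k)]. Its leading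
    coefficient, the flux of [q], is positive to the right of [c], so [Fp x s <= 0] describes a
    disc. *)
Let Fp x (s : R * R) : R := flux p p1 x +
  s.1 * ReC (q x * cconj (p1 x) + p x * cconj (q1 x)) +
  s.2 * ReC (iC * (q x * cconj (p1 x)) - iC * (p x * cconj (q1 x))) +
  (s.1 * s.1 + s.2 * s.2) * flux q q1 x.

Let FpE k x : flux (um k) (um1 k) x = Fp x (ReC k, ImC k).
Proof. by rewrite /Fp /flux /um /um1 !reimE /=; ring. Qed.

Let flux_c k : flux (um k) (um1 k) c = ReC k.
Proof. by rewrite /flux /um /um1 pc qc p1c q1c !reimE; ring. Qed.

Let flux_q x : I x -> c < x -> 0 < flux q q1 x.
Proof.
move=> Ix cx; have := flux_incr sq Ic Ix (ltW cx).
rewrite [flux q q1 c]/flux qc mul0r subr0 => ->.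
rewrite lt_def energy_ge0 andbT; apply/eqP => e.
have lq1 := tau_locb1 H sq.
have cx' := ltW cx.
have Bz : Rintegral (sigma D) `[c, x[ (fun t => cnorm2 (q1 t)) = 0.
  have A0 : 0 <= Rintegral (chi D) `[c, x[ (fun t => cnorm2 (q t)).
    by apply: Rintegral_ge0 => t _; exact: cnorm2_ge0.
  have B0 : 0 <= Rintegral (sigma D) `[c, x[ (fun t => cnorm2 (q1 t)).
    by apply: Rintegral_ge0 => t _; exact: cnorm2_ge0.
  by move: e; rewrite /energy; lra.
have fB := locfin_co (locfin_sigma H) Ic Ix.
have [_ le] := cnorm2_cint_le (measurable_itv _) fB (locb_L2 H (locfin_sigma H) lq1 Ic Ix).
move: le; rewrite Bz mulr0 -(isAC_incr (tau_ac sq) Ic Ix cx') qc subr0 => le.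
move: (disc_q_neq0 Ix cx); rewrite -cnorm2_eq0; move=> /negP; apply.
by rewrite eq_le le cnorm2_ge0.
Qed.

(* With [k n] chosen so that [um (k n)] vanishes at [r n], the flux of [um (k n)] is
   nonpositive before [r n]; a cluster point of the bounded sequence [k] then has
   nonpositive flux everywhere, hence bounded energy. *)
Lemma weyl_disc : exists k : C, H1_near_b D (um k) (um1 k).
Proof.
(* The flux of [q] vanishes at [c]; only from some [x1 > c] on is the disc bounded. *)
have [x1 [Ix1 cx1]] := Iab_right Ic.
have [r [Ir x1r rinc rex]] := exhaust_right Ix1.
have cr n : c < r n by exact: lt_le_trans cx1 (x1r n).
pose k n : C := - p (r n) / q (r n).
have Fk n x : I x -> c <= x -> x <= r n -> Fp x (ReC (k n), ImC (k n)) <= 0.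
  move=> Ix cx xr; rewrite -FpE.
  have := flux_incr (um_sol (k n)) Ix (Ir n) xr.
  have -> : flux (um (k n)) (um1 (k n)) (r n) = 0.
    rewrite /flux (_ : um (k n) (r n) = 0) ?mul0r//.
    by rewrite /um /k divfK ?subrr// disc_q_neq0.
  by have := energy_ge0 D x (r n) (um (k n)) (um1 (k n)); lra.
set A := flux q q1 x1; have Ap : 0 < A by exact: flux_q.
set w1 := ReC (q x1 * cconj (p1 x1) + p x1 * cconj (q1 x1)).
set w2 := ReC (iC * (q x1 * cconj (p1 x1)) - iC * (p x1 * cconj (q1 x1))).
(* Completing squares in [Fp x1 s <= 0] gives [A |s|^2 <= M]. With [K = M / A + 1], the inequality
   [v^2 <= M / A] implies [|v| <= K] without a square root. *)
pose M := (w1 ^+ 2 + w2 ^+ 2) / A + 2 * `|flux p p1 x1|.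
pose K := M / A + 1.
have M0 : 0 <= M.
  apply: addr_ge0; last by apply: mulr_ge0.
  by apply: divr_ge0; [apply: addr_ge0; exact: sqr_ge0|exact: ltW].
have MA0 : 0 <= M / A by apply: divr_ge0 => //; exact: ltW.
have K1 : 1 <= K by rewrite /K; lra.
have bd n : `|ReC (k n)| <= K /\ `|ImC (k n)| <= K.
  have := Fk n x1 Ix1 (ltW cx1) (x1r n); rewrite /Fp /= -/A -/w1 -/w2.
  set s := ReC (k n); set t := ImC (k n) => le.
  have st : s ^+ 2 + t ^+ 2 <= M / A.
    rewrite ler_pdivlMr// /M.
    have e1 : 0 <= (A * s + w1) ^+ 2 by exact: sqr_ge0.
    have e2 : 0 <= (A * t + w2) ^+ 2 by exact: sqr_ge0.
    have e3 : - `|flux p p1 x1| <= flux p p1 x1 by rewrite lerNl -normrN ler_norm.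
    have d : (w1 ^+ 2 + w2 ^+ 2) / A * A = w1 ^+ 2 + w2 ^+ 2 by rewrite divfK// gt_eqF.
    rewrite -(ler_pM2r Ap) [leRHS]mulrDl d.
    have := ler_wpM2r (ltW Ap) le; have := ler_wpM2r (ltW Ap) e3.
    rewrite !expr2 in e1 e2 *; rewrite mul0r; nra.
  have sq1 (v : R) : v ^+ 2 <= M / A -> `|v| <= K.
    move=> h; rewrite leNgt; apply/negP => lt.
    have : `|v| ^+ 2 <= M / A by rewrite real_normK ?num_real.
    have : K <= `|v| ^+ 2 by have := ltW lt; rewrite expr2; nra.
    by rewrite /K; lra.
  by split; apply: sq1; have := sqr_ge0 s; have := sqr_ge0 t; lra.
pose g n : R * R := (ReC (k n), ImC (k n)).
have cK : compact (`[- K, K] `*` `[- K, K] : set (R * R)).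
  by apply: compact_setX; exact: segment_compact.
have PF : ProperFilter (g @ \oo) by exact: fmap_proper_filter.
have inK : (g @ \oo) (`[- K, K] `*` `[- K, K]).
  exists 0%N => // n _; have [b1 b2] := bd n.
  by split; rewrite /= in_itv/= -ler_norml.
have [s [_ cs]] := cK _ PF inK.
exists (RtoC s.1 + iC * RtoC s.2).
set ks := RtoC s.1 + iC * RtoC s.2.
have Rks : ReC ks = s.1 by rewrite /ks !reimE; ring.
have Iks : ImC ks = s.2 by rewrite /ks !reimE; ring.
have neg x : I x -> c <= x -> flux (um ks) (um1 ks) x <= 0.
  move=> Ix cx; rewrite FpE Rks Iks leNgt; apply/negP => pos.
  have cont : Fp x @ s --> Fp x s.
    have c1 : (fun s : R * R => s.1) @ s --> s.1 by exact: cvg_fst.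
    have c2 : (fun s : R * R => s.2) @ s --> s.2 by exact: cvg_snd.
    apply: cvgD.
      apply: cvgD; [apply: cvgD; first exact: cvg_cst|].
        by apply: cvgM => //; exact: cvg_cst.
      by apply: cvgM => //; exact: cvg_cst.
    apply: cvgM; last exact: cvg_cst.
    by apply: cvgD; apply: cvgM.
  have [N NP] := rex x Ix.
  have h1 : (g @ \oo) [set s | Fp x s <= 0].
    exists N => // n /= Nn; apply: Fk => //.
    by apply: ltW (lt_le_trans NP _); exact: rinc.
  have h2 : nbhs s [set s | 0 < Fp x s] by apply: (@cvgr_gt R _ (nbhs s) _ (Fp x) (Fp x s) cont).
  have [s' [/= l1 l2]] := cs _ _ h1 h2.
  by move: (le_lt_trans l1 l2); rewrite ltxx.
have uE : forall x, I x -> c <= x -> energy D c x (um ks) (um1 ks) <= `|s.1|.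
  move=> x Ix cx; rewrite -(flux_incr (um_sol ks) Ic Ix cx) flux_c Rks.
  have := neg x Ix cx; have := ler_norm (- s.1); rewrite normrN; lra.
split; first exact: tau_ac (um_sol ks).
have lu := tau_locb H (um_sol ks); have lu1 := tau_locb1 H (um_sol ks).
exists c; split => //; split.
- apply: (L2_bounded_b H (locfin_chi H) lu Ic) => y Iy cy.
  apply: le_trans (uE y Iy cy); rewrite /energy lerDl.
  by apply: Rintegral_ge0 => t _; exact: cnorm2_ge0.
- apply: (L2_bounded_b H (locfin_sigma H) lu1 Ic) => y Iy cy.
  apply: le_trans (uE y Iy cy); rewrite /energy lerDr.
  by apply: Rintegral_ge0 => t _; exact: cnorm2_ge0.
Qed.

End Disc.

End WeylDisc.

(** * Cutting functions off to the left *)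

Section Ramp.
Context {R : realType} (D : sldata R).
Hypothesis H : sl_hyp D.
Local Notation C := (Cx R).
Local Notation I := (Iab D).
Local Notation hf n := ((2 : R)^-1 ^+ n).
Implicit Types (m : {measure set R -> \bar R}) (f g h u : R -> C).

(** The intervals [[d, c[] shrink to the empty set as [d] tends to [c], so their mass tends to 0
    even if [c] is an atom. *)
Lemma mass_left m c y (e : R) : locfin D m -> I y -> I c -> y < c -> 0 < e ->
  exists2 d, y <= d < c & forall d', d <= d' -> d' < c -> fine (m `[d', c[%classic) < e.
Proof.
move=> lm Iy Ic yc e0; set A := `[y, c[%classic.
have fA := locfin_co lm Iy Ic.
have mA : measurable A by exact: measurable_itv.
pose l n : R := c - (c - y) * hf n.
have cy0 : 0 < c - y by rewrite subr_gt0.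
have lc n : l n < c by rewrite /l ltrBlDr ltrDl mulr_gt0// hf_gt0.
have hf1 n : hf n <= (1 : R) by rewrite exprn_ile1// ?invr_ge0// invf_le1// ler1n.
have yl n : y <= l n.
  rewrite /l; have : (c - y) * hf n <= (c - y) * 1 by rewrite ler_wpM2l// ltW.
  lra.
have := @Rint_vanish _ m A (fun n => `[l n, c[%classic) (fun=> 1) mA
  (fun n => measurable_itv _).
have hyp : forall t, A t -> exists N, forall n, (N <= n)%N -> ~ `[l n, c[%classic t.
  move=> t; rewrite /A /= in_itv/= => /andP[yt tc].
  have tc0 : 0 < c - t by rewrite subr_gt0.
  have [N NP] := hf_cvg0 (c - y) tc0.
  exists N => n /NP lt; rewrite /= in_itv/= => /andP[le _].
  by move: le lt; rewrite /l; lra.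
move=> /(_ hyp (rint_cst _ mA fA))/cvgr0_norm_lt/(_ e e0)[N _ /(_ N (leqnn N))] /=.
have sub d' : l N <= d' -> `[d', c[%classic `<=` A.
  move=> ld t; rewrite /A /= !in_itv/= => /andP[dt ->]; rewrite andbT.
  exact: le_trans (yl N) (le_trans ld dt).
rewrite (setIidr (sub _ (lexx _))) Rintegral_cst// mul1r => lt.
exists (l N); first by rewrite yl lc.
move=> d' ld dc; apply: le_lt_trans lt; apply: le_trans (ler_norm _).
apply: fine_le.
- by rewrite ge0_fin_numE//; apply: le_lt_trans fA; apply: le_measure; rewrite ?inE//; apply: sub.
- by rewrite ge0_fin_numE//; apply: le_lt_trans fA; apply: le_measure; rewrite ?inE//; apply: sub.
- apply: le_measure; rewrite ?inE// => t /=; rewrite !in_itv/= => /andP[dt ->].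
  by rewrite (le_trans ld dt).
Qed.

Lemma rho_mass_left c (e : R) : I c -> 0 < e -> exists2 d, I d /\ d < c &
  forall d', d <= d' -> d' < c ->
    fine (rho_p D `[d', c[%classic) + fine (rho_n D `[d', c[%classic) < e.
Proof.
move=> Ic e0; have [y [Iy yc]] := Iab_left Ic.
have e2 : 0 < e / 2 by rewrite divr_gt0.
have [d1 /andP[y1 d1c] P1] := mass_left (locfin_rho_p H) Iy Ic yc e2.
have [d2 /andP[y2 d2c] P2] := mass_left (locfin_rho_n H) Iy Ic yc e2.
exists (Num.max d1 d2).
  by split; [apply: (Iab_conv Iy Ic); rewrite ?le_max ?y1// ltW// gt_max d1c|rewrite gt_max d1c].
move=> d' dd dc; rewrite [ltRHS]splitr; apply: ltrD; [apply: P1|apply: P2] => //.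
  by move: dd; rewrite ge_max => /andP[].
by move: dd; rewrite ge_max => /andP[].
Qed.

(** On [[d, c[] the function grows linearly in [sigma] from 0 to [g c], which is possible because
    [sigma] charges [[d, c[]. Its derivative [h1] is prescribed separately on the three pieces. The
    bound by [nrm (g c)] does not depend on [d], so the ramp can be steepened. *)
Lemma ramp g g1 d c : isAC D (sigma D) g g1 -> locb D g1 -> I d -> I c -> d < c ->
  exists h h1, [/\ isAC D (sigma D) h h1 /\ locb D h1,
    forall x, I x -> x <= d -> h x = 0,
    forall x, I x -> x < d -> h1 x = 0,
    forall x, I x -> c <= x -> h x = g x /\ h1 x = g1 x &
    forall x, d <= x -> x < c -> nrm (h x) <= nrm (g c)].
Proof.
move=> ac lg1 Id Ic dc; set s := fine (sigma D `[d, c[%classic).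
have s0 : 0 < s by have := sigma_itv_gt0 H Id Ic dc.
have fs := locfin_co (locfin_sigma H) Id Ic.
pose k : C := g c * RtoC s^-1.
pose h1 x : C := if x < d then 0 else if x < c then k else g1 x.
have sD : locfin D (sigma D) := locfin_sigma H.
have cE x : d <= x -> x <= c -> forall t, `[d, x[%classic t -> k = h1 t.
  move=> dx xc t; rewrite /= in_itv/= => /andP[dt tx].
  by rewrite /h1 ltNge dt/= (lt_le_trans tx xc).
have zE x : x <= d -> forall t, `[x, d[%classic t -> 0 = h1 t.
  by move=> xd t; rewrite /= in_itv/= => /andP[_]; rewrite /h1 => ->.
have gE x : c <= x -> forall t, `[c, x[%classic t -> g1 t = h1 t.
  move=> cx t; rewrite /= in_itv/= => /andP[ct _].
  by rewrite /h1 ltNge (le_trans (ltW dc) ct)/= ltNge ct.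
have hlb : locb D h1.
  split; last first.
    move=> x y Ix Iy; have [_ /(_ x y Ix Iy)[B BP]] := lg1; exists (nrm k + `|B|) => t xt ty.
    have := BP t xt ty; have := ler_norm B; have := nrm_ge0 k; have := normr_ge0 B.
    by rewrite /h1; case: ifP => _; [rewrite nrm0; lra|case: ifP => _; lra].
  have mI := measurable_Iab H.
  have mm (i : interval R) : measurable (I `&` [set` i]).
    by apply: measurableI => //; exact: measurable_itv.
  have E : I = (I `&` `]-oo, d[%classic) `|`
     ((I `&` `[d, c[%classic) `|` (I `&` `[c, +oo[%classic)).
    apply/seteqP; split => t /=.
      rewrite !in_itv/= => It; have [dt|td] := leP d t; last by left.
      by right; have [ct|tc] := leP c t; [right|left].
    by case=> [[]|[[]|[]]].
  rewrite E; apply: cmeas_setU; [exact: mm|by apply: measurableU; exact: mm| |].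
    apply: (@cmeas_eq _ _ (fun=> 0)); last exact: cmeas_cst.
    by move=> t [_] /=; rewrite in_itv/= /h1 => ->.
  apply: cmeas_setU; [exact: mm|exact: mm| |].
    apply: (@cmeas_eq _ _ (fun=> k)); last exact: cmeas_cst.
    by move=> t [_] /=; rewrite in_itv/= /h1 => /andP[dt ->]; rewrite ltNge dt.
  apply: (@cmeas_eq _ _ g1).
    move=> t [_] /=; rewrite in_itv/= andbT /h1 => ct.
    by rewrite ltNge (le_trans (ltW dc) ct)/= ltNge ct.
  by have [mg1 _] := lg1; apply: cmeas_sub mg1 => //; exact: subIsetl.
have hl : L1loc D (sigma D) h1 by exact: locb_L1loc sD hlb.
pose h x := sint (sigma D) d x h1.
have hac : isAC D (sigma D) h h1 by exact: isAC_sint.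
have hd : h d = 0 by exact: sint_cc.
have hmid x : I x -> d <= x -> x <= c -> h x = k * RtoC (fine (sigma D `[d, x[%classic)).
  move=> Ix dx xc.
  rewrite -(subr0 (h x)) -hd (isAC_incr hac Id Ix dx) -(cint_eq _ (cE x dx xc)).
  apply: eqCx; rewrite ?Re_cint ?Im_cint Rintegral_cst ?reimE//; [ring|ring].
have hc : h c = g c.
  by rewrite (hmid c Ic (ltW dc) (lexx _)) -/s /k -mulrA -RtoCM mulVf ?gt_eqF// mulr1.
exists h, h1; split => //.
- move=> x Ix xd; have := isAC_incr hac Ix Id xd; rewrite hd sub0r.
  rewrite -(cint_eq _ (zE x xd)) (_ : cint _ _ _ = 0).
    by move/eqP; rewrite oppr_eq0 => /eqP.
  by apply: eqCx; rewrite ?Re_cint ?Im_cint /Rintegral/= integral0.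
- by move=> x _; rewrite /h1 => ->.
- move=> x Ix cx; split; last by rewrite /h1 ltNge (le_trans (ltW dc) cx)/= ltNge cx.
  rewrite -(subrK (h c) (h x)) (isAC_incr hac Ic Ix cx) -(cint_eq _ (gE x cx)).
  by rewrite -(isAC_incr ac Ic Ix cx) hc subrK.
- move=> x dx xc; have Ix := Iab_conv Id Ic dx (ltW xc).
  rewrite (hmid x Ix dx (ltW xc)) /k -mulrA -RtoCM nrmM -[leRHS]mulr1.
  apply: ler_wpM2l; first exact: nrm_ge0.
  have fx := locfin_co (locfin_sigma H) Id Ix.
  have le : fine (sigma D `[d, x[%classic) <= s.
    apply: fine_le; rewrite ?ge0_fin_numE//; apply: le_measure; rewrite ?inE//.
    by move=> t /=; rewrite !in_itv/= => /andP[-> tx]; exact: lt_trans tx xc.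
  rewrite /nrm /cnorm2 !reimE expr0n addr0 sqrtr_sqr ger0_norm.
    by rewrite mulrC ler_pdivrMr// mul1r.
  by apply: mulr_ge0; rewrite ?invr_ge0 ?fine_ge0// ltW.
Qed.

Lemma ramp_near_a d h h1 : I d -> isAC D (sigma D) h h1 ->
  (forall x, I x -> x <= d -> h x = 0) -> (forall x, I x -> x < d -> h1 x = 0) ->
  H1_near_a D h h1.
Proof.
move=> Id ac h0 h10; split => //; exists d; split => //.
have md := measurable_Iac Id.
split; apply: L2_eq (L2_0 _ md) => // x Ax; have Ix := Iac_sub Id Ax.
  by rewrite h0//; case: Ax => _ /ltW.
by rewrite h10//; case: Ax.
Qed.

Lemma H1_near_b_eq f f1 g g1 c : I c -> H1_near_b D f f1 -> locb D f -> locb D f1 ->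
  isAC D (sigma D) g g1 -> (forall x, I x -> c <= x -> f x = g x /\ f1 x = g1 x) ->
  H1_near_b D g g1.
Proof.
move=> Ic hf lf lf1 ac e; split => //; exists c; split => //.
have mc := measurable_Icb Ic.
have [i1 i2] := H1_near_b_ext H hf lf lf1 Ic.
split; [apply: L2_eq i1 => // x Ax|apply: L2_eq i2 => // x Ax];
 by have Ix := Icb_sub Ic Ax; have [cx _] := Ax; have [] := e x Ix (ltW cx).
Qed.

Lemma H1_near_a_eq f f1 g g1 c : I c -> H1_near_a D f f1 -> locb D f -> locb D f1 ->
  isAC D (sigma D) g g1 -> (forall x, I x -> x <= c -> f x = g x /\ f1 x = g1 x) ->
  H1_near_a D g g1.
Proof.
move=> Ic hf lf lf1 ac e; split => //; exists c; split => //.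
have mc := measurable_Iac Ic.
have [i1 i2] := H1_near_a_ext H hf lf lf1 Ic.
split; [apply: L2_eq i1 => // x Ax|apply: L2_eq i2 => // x Ax];
 by have Ix := Iac_sub Ic Ax; have [_ cx] := Ax; have [] := e x Ix (ltW cx).
Qed.

End Ramp.

(** * Existence of the Weyl solution *)

Section LocalSolutions.
Context {R : realType} (D : sldata R).
Hypothesis H : sl_hyp D.
Local Notation C := (Cx R).
Local Notation I := (Iab D).
Implicit Types (m : {measure set R -> \bar R}) (f g h u : R -> C).

Lemma Wr_const f f1 ft g g1 gt (w : C) x y : is_tau D f f1 ft -> is_tau D g g1 gt ->
  I x -> I y -> x <= y ->
  (forall t, x <= t -> t < y -> ft t = w * f t /\ gt t = w * g t) ->
  Wr f f1 g g1 y = Wr f f1 g g1 x.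
Proof.
move=> tf tg Ix Iy xy e; apply/eqP; rewrite -subr_eq0; apply/eqP.
rewrite (wronskian_incr H tf tg Ix Iy xy); apply: crho0 => t.
by rewrite /= in_itv/= => /andP[xt ty]; have [-> ->] := e t xt ty; ring.
Qed.

Lemma Vw_Wr (w : C) f f1 g g1 x :
  Vw f1 (fun t => w * f t) g1 (fun t => w * g t) x = w * Wr f f1 g g1 x.
Proof. by rewrite /Vw /Wr; ring. Qed.

Variables (z : C) (th th1 ph ph1 : R -> C).
Hypotheses (z_0 : z != 0) (sth : is_sol D z th th1) (sph : is_sol D z ph ph1)
  (W : forall x, I x -> Wr th th1 ph ph1 x = z^-1).

(** To the right of [c] the Wronskians of [f] with [th] and [ph] are constant, so Cramer's rule has
    constant coefficients. *)
Lemma local_sol_b f f1 ft c : is_tau D f f1 ft -> I c ->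
  (forall x, I x -> c <= x -> ft x = z * f x) ->
  exists k l : C, [/\ k = z * Wr f f1 ph ph1 c, l = - (z * Wr f f1 th th1 c) &
    forall x, I x -> c <= x -> f x = k * th x + l * ph x /\ f1 x = k * th1 x + l * ph1 x].
Proof.
move=> tf Ic e; exists (z * Wr f f1 ph ph1 c), (- (z * Wr f f1 th th1 c)).
split => // x Ix cx.
have K v v1 : is_sol D z v v1 -> Wr f f1 v v1 x = Wr f f1 v v1 c.
  move=> sv; apply: (Wr_const (w := z) tf sv Ic Ix cx) => t ct tx.
  by split => //; apply: e => //; exact: Iab_conv Ic Ix ct (ltW tx).
have [-> ->] := fundamental_reconstruct f f1 z_0 (W Ix).
by rewrite (K _ _ sth) (K _ _ sph); split; ring.
Qed.

(** The equation is required only for [x < c], as increments are taken over [[x, c[], yet the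
    expansion also holds at [c]. *)
Lemma local_sol_a f f1 ft c : is_tau D f f1 ft -> I c ->
  (forall x, I x -> x < c -> ft x = z * f x) ->
  exists k l : C, k = z * Wr f f1 ph ph1 c /\ forall x, I x -> x <= c ->
    f x = k * th x + l * ph x /\ f1 x = k * th1 x + l * ph1 x.
Proof.
move=> tf Ic e; exists (z * Wr f f1 ph ph1 c), (- (z * Wr f f1 th th1 c)).
split => // x Ix xc.
have K v v1 : is_sol D z v v1 -> Wr f f1 v v1 x = Wr f f1 v v1 c.
  move=> sv; apply/esym; apply: (Wr_const (w := z) tf sv Ix Ic xc) => t xt tc.
  by split => //; apply: e => //; exact: Iab_conv Ix Ic xt (ltW tc).
have [-> ->] := fundamental_reconstruct f f1 z_0 (W Ix).
by rewrite (K _ _ sth) (K _ _ sph); split; ring.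
Qed.

End LocalSolutions.

Section WeylSolution.
Context {R : realType} (D : sldata R).
Hypothesis H : sl_hyp D.
Local Notation C := (Cx R).
Local Notation I := (Iab D).
Implicit Types (m : {measure set R -> \bar R}) (f g h u : R -> C).
Variables (va va1 vat vat1 vb vb1 vbt vbt1 : R -> C).
Hypothesis (Ba : bfun_a D va va1 vat vat1) (Bb : bfun_b D vb vb1 vbt vbt1).
Local Notation inS := (inS D va1 vat vb1 vbt).
Local Notation resolvent := (resolvent D va1 vat vb1 vbt).
Local Notation Res := (Res D va1 vat vb1 vbt).
Local Notation S_a := (sol_in_S_near_a D va1 vat).
Local Notation S_b := (sol_in_S_near_b D vb1 vbt).

Variables (z : C) (th th1 ph ph1 : R -> C).
Hypotheses (z_0 : z != 0) (sth : is_sol D z th th1) (sph : is_sol D z ph ph1)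
  (W : forall x, I x -> Wr th th1 ph ph1 x = z^-1)
  (pha : S_a z ph ph1) (ph_nt : exists x, I x /\ ph x != 0) (rz : resolvent z).

Lemma S_a_S_b_inS u u1 : is_sol D z u u1 -> S_a z u u1 -> S_b z u u1 ->
  inS u u1 (fun x => z * u x) (fun x => z * u1 x).
Proof.
move=> su [a1 a2 a3] [b1 b2 b3]; split => //; split => //.
have l1 := tau_locb1 H su.
by split; apply: (H1_of_near H) => //; exact: locbZ.
Qed.

(** Otherwise [ph] would be an eigenfunction of [S] at a point of the resolvent set. *)
Lemma ph_not_S_b : ~ S_b z ph ph1.
Proof.
move=> hb; have S := S_a_S_b_inS sph pha hb.
have [_ inj _] := rz; have [x [Ix]] := ph_nt.
by rewrite (inj _ _ _ _ S _ x Ix)// eqxx.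
Qed.

(* Outside the l.c. case, a nonzero [th]-component of [f] near [a] would put the whole
   fundamental system into H^1 near [a]. *)
Lemma Res_Wr_a h h1 f f1 d : Res z h h1 f f1 -> I d ->
  (forall x, I x -> x < d -> h x = 0) -> Wr f f1 ph ph1 d = 0.
Proof.
move=> [[tf [hf hft]] fa _] Id h0.
have e x : I x -> x < d -> h x + z * f x = z * f x.
  by move=> Ix xd; rewrite h0// add0r.
have [k [l [kE fE]]] := local_sol_a H z_0 sth sph W tf Id e.
have [pa1 pa2 pa3] := pha.
(* In the l.c. case [f] and [ph] satisfy the same boundary condition, so [V(f, ph)] tends to 0 at
   [a]; to the left of [d] it is the constant [z * Wr f f1 ph ph1 d]. *)
have [la|nla] := pselect (lc_a D).
  have [Tv vv0 [g [g1 [gt [gt1 [Tg ng]]]]]] := Ba la.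
  have FF := near_a_proper H.
  have Tf : Tmax D f f1 (fun x => h x + z * f x) (fun x => h1 x + z * f1 x) by [].
  have Tph := Tnear_a_sol H sph pa1.
  have Tg' := Tmax_near_a H Tg.
  have [l0 gv] := Vw_cvg_a H Tg' (Tnear_a_conj H (Tmax_near_a H Tv)).
  have l00 : l0 != 0 by apply/eqP => l00; apply: ng; rewrite -l00; exact: gv.
  have [x fg] := Vw_cvg_a H (Tmax_near_a H Tf) Tg'.
  have [w pg] := Vw_cvg_a H Tph Tg'.
  have V0 := boundary_Vw0 FF l00 gv (fa la) (pa3 la) fg pg.
  have E : \forall t \near near_a D,
      Vw f1 (fun x => h x + z * f x) ph1 (fun x => z * ph x) t = z * Wr f f1 ph ph1 d.
    apply/(near_aP H); exists d.
    split; first exact: Id.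
    move=> t It td.
    rewrite (@Wr_const _ _ H _ _ _ _ _ _ z t d tf sph It Id (ltW td)).
      by rewrite -Vw_Wr /Vw e.
    move=> s ts sd; split; last by [].
    exact: e (Iab_conv It Id ts (ltW sd)) sd.
  apply/eqP; rewrite -(mulrI_eq0 _ (mulfI z_0)) -nrm_eq0 eq_le nrm_ge0 andbT.
  apply/ler_addgt0Pl => eps eps0; rewrite addr0.
  have := filter_ex (filterI (proj1 (cvgCxP _ _) V0 eps eps0) E).
  by move=> [t [/= lt <-]]; rewrite subr0 in lt; exact: ltW.
have [k0|kn0] := eqVneq k 0.
  by apply/eqP; rewrite -(mulrI_eq0 _ (mulfI z_0)) -kE k0.
exfalso; apply: nla => w u u1 w0 su.
apply: (weyl_alternative_sol H z_0 w0 sth sph su W _ pa1).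
have lth := tau_locb H sth; have lth1 := tau_locb1 H sth.
have lf := tau_locb H tf; have lf1 := tau_locb1 H tf.
have lp := tau_locb H sph; have lp1 := tau_locb1 H sph.
have hu := H1_near_a_Z H k^-1 (H1_near_a_add H (- l) (H1_near_aW H hf) pa1).
apply: (H1_near_a_eq H Id hu).
- by apply: locbZ; apply: locbD => //; exact: locbZ.
- by apply: locbZ; apply: locbD => //; exact: locbZ.
- exact: tau_ac sth.
- move=> x Ix xd; have [-> ->] := fE x Ix xd.
  by split; rewrite mulNr addrK mulKf.
Qed.

End WeylSolution.

Lemma nrm_small_eq0 {R : realType} (x : Cx R) (B : R) : 0 <= B ->
  (forall e : R, 0 < e -> nrm x <= B * e) -> x = 0.
Proof.
move=> B0 xe; apply/eqP; rewrite -nrm_eq0 eq_le nrm_ge0 andbT.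
apply/ler_addgt0Pl => e e0; rewrite addr0.
have B1 : 0 < B + 1 by lra.
apply: (le_trans (xe (e / (B + 1)) (divr_gt0 e0 B1))).
by rewrite mulrA ler_pdivrMr// [leRHS]mulrDr mulr1 mulrC lerDl ltW.
Qed.

Section NoWeylSolution.
Context {R : realType} (D : sldata R).
Hypothesis H : sl_hyp D.
Local Notation C := (Cx R).
Local Notation I := (Iab D).
Implicit Types (m : {measure set R -> \bar R}) (f g h u : R -> C).

Lemma crho_cat x y w h : L1loc_rho D h -> I x -> I w -> x <= y -> y <= w ->
  crho D `[x, w[ h = crho D `[x, y[ h + crho D `[y, w[ h.
Proof.
move=> [hp hn'] Ix Iw xy yw; rewrite /crho (cint_itv_cat xy yw); last exact: (L1loc_co hp Ix Iw).
by rewrite (cint_itv_cat xy yw); [ring|exact: (L1loc_co hn' Ix Iw)].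
Qed.

Lemma H1_ramp g g1 d c : isAC D (sigma D) g g1 -> locb D g1 -> H1_near_b D g g1 ->
  I d -> I c -> d < c -> exists h h1, [/\ H1 D h h1,
    forall x, I x -> x <= d -> h x = 0,
    forall x, I x -> c <= x -> h x = g x /\ h1 x = g1 x &
    forall x, d <= x -> x < c -> nrm (h x) <= nrm (g c)].
Proof.
move=> ac lg1 gb Id Ic dc.
have [h [h1 [[hac lh1] h0 h10 hg hB]]] := ramp H ac lg1 Id Ic dc.
exists h, h1; split => //; apply: (H1_of_near H) => //.
  exact: (ramp_near_a Id hac h0 h10).
apply: (H1_near_b_eq H Ic gb) => //.
  exact: (isAC_locb H (locfin_sigma H) ac).
by move=> x Ix cx; have [-> ->] := hg x Ix cx.
Qed.

(** The difference of two ramps of the constant 1, one rising on [[d, al[] and one on [[e, be[]. The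
    bounds on the two edges hold however steep they are. *)
Lemma bump d al e be : I d -> I be -> d < al -> al <= e -> e < be ->
  exists h h1, [/\ H1 D h h1,
    forall x, I x -> x <= d -> h x = 0,
    forall x, I x -> be <= x -> h x = 0,
    forall x, al <= x -> x <= e -> h x = 1 &
    (forall x, d <= x -> x < al -> nrm (h x) <= 1) /\
    (forall x, e <= x -> x < be -> nrm (1 - h x) <= 1)].
Proof.
move=> Id Ibe da ae eb.
have Ie : I e by apply: (Iab_conv Id Ibe _ (ltW eb)); exact: ltW (lt_le_trans da ae).
have Ia : I al by exact: (Iab_conv Id Ie (ltW da) ae).
have ac1 : isAC D (sigma D) (fun=> 1) (fun=> 0 : C).
  apply: (isAC_intro H); first by apply: (locb_L1loc H (locfin_sigma H)); exact: locb_cst.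
  move=> x y _ _ _; rewrite subrr; apply: eqCx; by rewrite ?Re_cint ?Im_cint /Rintegral/= integral0.
have l0 : locb D (fun=> 0 : C) by exact: locb_cst.
have [h [h1 [[hac lh1] h0 h10 hg hB]]] := ramp H ac1 l0 Id Ia da.
have [k [k1 [[kac lk1] k0 k10 kg kB]]] := ramp H ac1 l0 Ie Ibe eb.
have n1 : nrm (1 : C) = 1 by rewrite /nrm cnorm2_1 sqrtr1.
have ac := isAC_add H (-1) hac kac.
have lh2 : locb D (fun x => h1 x + -1 * k1 x) by apply: locbD => //; exact: locbZ.
have hb x : I x -> be <= x -> h x + -1 * k x = 0 /\ h1 x + -1 * k1 x = 0.
  move=> Ix bx; have ax : al <= x by exact: le_trans ae (le_trans (ltW eb) bx).
  by have [-> ->] := hg x Ix ax; have [-> ->] := kg x Ix bx; split; ring.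
exists (fun x => h x + -1 * k x), (fun x => h1 x + -1 * k1 x); split.
- apply: (H1_of_near H) => //.
    apply: (ramp_near_a Id ac) => x Ix xd.
      by rewrite h0// k0 ?mulr0 ?addr0// (le_trans xd)// (le_trans (ltW da) ae).
    rewrite h10// k10 ?mulr0 ?addr0//.
    exact: lt_trans xd (lt_le_trans da ae).
  apply: (H1_near_b_eq H Ibe (H1_near_bW H (H1_0 H)) l0 l0 ac) => x Ix bx.
  by have [-> ->] := hb x Ix bx.
- by move=> x Ix xd; rewrite h0// k0 ?mulr0 ?addr0// (le_trans xd)// (le_trans (ltW da) ae).
- by move=> x Ix bx; have [-> _] := hb x Ix bx.
- move=> x ax xe; have Ix := Iab_conv Ia Ie ax xe.
  by have [-> _] := hg x Ix ax; rewrite k0// mulr0 addr0.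
- split.
    move=> x dx xa; have Ix := Iab_conv Id Ia dx (ltW xa).
    rewrite k0 ?mulr0 ?addr0 -?n1; [exact: hB|by []|exact: le_trans (ltW xa) ae].
  move=> x ex xb; have Ix := Iab_conv Ie Ibe ex (ltW xb).
  have [-> _] := hg x Ix (le_trans ae ex).
  by rewrite (_ : _ - _ = k x); [rewrite -n1; exact: kB|ring].
Qed.

Variables (va va1 vat vat1 vb vb1 vbt vbt1 : R -> C).
Hypothesis (Ba : bfun_a D va va1 vat vat1).
Local Notation inS := (inS D va1 vat vb1 vbt).
Local Notation resolvent := (resolvent D va1 vat vb1 vbt).
Local Notation Res := (Res D va1 vat vb1 vbt).
Local Notation S_a := (sol_in_S_near_a D va1 vat).
Local Notation S_b := (sol_in_S_near_b D vb1 vbt).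

Variables (z : C) (th th1 ph ph1 : R -> C).
Hypotheses (z_0 : z != 0) (sth : is_sol D z th th1) (sph : is_sol D z ph ph1)
  (W : forall x, I x -> Wr th th1 ph ph1 x = z^-1)
  (pha : S_a z ph ph1) (ph_nt : exists x, I x /\ ph x != 0) (rz : resolvent z).
(** The situation to be refuted: no nontrivial solution with parameter [z] lies in H^1 near [b]. *)
Hypothesis NB : forall k l : C, H1_near_b D (fun x => k * th x + l * ph x)
  (fun x => k * th1 x + l * ph1 x) -> k = 0 /\ l = 0.

Let lp := tau_locb H sph.
Let lp1 := tau_locb1 H sph.

Let NB_zero f f1 ft c : is_tau D f f1 ft -> H1_near_b D f f1 -> I c ->
  (forall x, I x -> c <= x -> ft x = z * f x) ->
  forall x, I x -> c <= x -> f x = 0 /\ f1 x = 0.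
Proof.
move=> tf hf Ic e; have [k [l [_ _ fE]]] := local_sol_b H z_0 sth sph W tf Ic e.
have [k0 l0] : k = 0 /\ l = 0.
  apply: NB; apply: (H1_near_b_eq H Ic hf (tau_locb H tf) (tau_locb1 H tf)) => //.
  exact: tau_ac (sol_comb H k l sth sph).
by move=> x Ix cx; have [-> ->] := fE x Ix cx; rewrite k0 l0; split; ring.
Qed.

(** The terms with [z] cancel in the increment of the Wronskian, leaving the inhomogeneity; the
    value at [d] is 0 by [Res_Wr_a]. *)
Let Wr_crho h h1 f f1 d c : Res z h h1 f f1 -> H1 D h h1 -> I d -> I c -> d <= c ->
  (forall x, I x -> x <= d -> h x = 0) ->
  Wr f f1 ph ph1 c = crho D `[d, c[ (fun t => ph t * h t).
Proof.
move=> S hh Id Ic dc h0; have [[tf _] _ _] := S.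
have W0 : Wr f f1 ph ph1 d = 0.
  apply: (Res_Wr_a H Ba z_0 sth sph W pha S Id) => x Ix xd.
  by apply: h0 => //; exact: ltW.
rewrite -(subr0 (Wr f f1 ph ph1 c)) -W0 (wronskian_incr H tf sph Id Ic dc).
by apply: crho_eq => t _; ring.
Qed.

Let locb_H1 h h1 : H1 D h h1 -> locb D h.
Proof. by move=> [ac _]; exact: (isAC_locb H (locfin_sigma H) ac). Qed.

(* Testing with [f = (S - z)^-1 (bump)], which vanishes to the right of the bump, yields
   [int ph * bump drho = 0]. *)
Let ker al be : I al -> I be -> al < be -> crho D `[al, be[ ph = 0.
Proof.
move=> Ia Ib ab; have [y [Iy ya]] := Iab_left Ia.
have [_ /(_ y be Iy Ib)[B BP]] := lp.
have B0 : 0 <= B.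
  by apply: le_trans (nrm_ge0 _) (BP y (lexx _) (ltW (lt_trans ya ab))).
apply: (@nrm_small_eq0 _ _ (4 * B)); first by rewrite mulr_ge0.
move=> e e0.
(* Both edges of the bump are squeezed into half-open intervals on which [rho_p + rho_n] has mass
   below [e]; each then contributes an error of at most [2 B e]. *)
have [d1 [Id1 d1a] P1] := rho_mass_left H Ia e0.
have [d2 [Id2 d2b] P2] := rho_mass_left H Ib e0.
set d := Num.max d1 y; set be' := Num.max d2 al.
have Id : I d by exact: (Iab_max Id1 Iy).
have Ie : I be' by exact: (Iab_max Id2 Ia).
have da : d < al by rewrite gt_max d1a.
have eb : be' < be by rewrite gt_max d2b.
have ae : al <= be' by rewrite le_max lexx orbT.
have yd : y <= d by rewrite le_max lexx orbT.
have [h [h1 [hh h0 hb h_1 [hB1 hB2]]]] := bump Id Ib da ae eb.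
have [[f f1] /= S] := Res_ex H rz hh.
have [[tf [hf _]] _ _] := S.
have db : d <= be by exact: ltW (lt_trans da ab).
have fb : f be = 0 /\ f1 be = 0.
  apply: (NB_zero tf (H1_near_bW H hf) Ib) => // x Ix bx.
  by rewrite hb// add0r.
have X := Wr_crho S hh Id Ib db h0.
have lh := locb_H1 hh.
have lph : locb D (fun t => ph t * h t) by exact: locbM.
have e1 : crho D `[d, be[ (fun t => ph t * h t) = 0.
  by rewrite -X /Wr; have [-> ->] := fb; ring.
move: e1; rewrite (crho_cat (locb_rho H lph) Id Ib (ltW da) (ltW ab)).
rewrite (crho_cat (locb_rho H lph) Ia Ib ae (ltW eb)).
rewrite (crho_cat (locb_rho H lp) Ia Ib ae (ltW eb)).
have -> : crho D `[al, be'[ (fun t => ph t * h t) = crho D `[al, be'[ ph.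
  apply: crho_eq => t; rewrite /= in_itv/= => /andP[at_ te].
  by rewrite h_1 ?mulr1// ltW.
have l1h : locb D (fun t => ph t * (1 + -1 * h t)).
  by apply: locbM => //; apply: locbD; [exact: locb_cst|exact: locbZ].
have E : crho D `[be', be[ ph = crho D `[be', be[ (fun t => ph t * h t) +
    crho D `[be', be[ (fun t => ph t * (1 + -1 * h t)).
  have [p1 p2] := locb_rho H lph; have [q1 q2] := locb_rho H l1h.
  rewrite -(crhoD (measurable_itv _) (L1loc_co p1 Ie Ib) (L1loc_co p2 Ie Ib)
    (L1loc_co q1 Ie Ib) (L1loc_co q2 Ie Ib)).
  by apply: crho_eq => t _; ring.
rewrite E => /eqP; rewrite addrA addr_eq0 => /eqP Y.
have -> : crho D `[al, be'[ ph + (crho D `[be', be[ (fun t => ph t * h t) +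
    crho D `[be', be[ (fun t => ph t * (1 + -1 * h t))) =
  - crho D `[d, al[ (fun t => ph t * h t) + crho D `[be', be[ (fun t => ph t * (1 + -1 * h t)).
  have -> : crho D `[be', be[ (fun t => ph t * h t) =
    - (crho D `[d, al[ (fun t => ph t * h t) + crho D `[al, be'[ ph) by rewrite Y opprK.
  ring.
apply: (le_trans (le_nrmD _ _)); rewrite nrmN.
have G (x w : R) (g : R -> C) : I x -> I w -> locb D g ->
    (forall t, x <= t -> t < w -> nrm (g t) <= B) ->
    fine (rho_p D `[x, w[%classic) + fine (rho_n D `[x, w[%classic) < e ->
    nrm (crho D `[x, w[ g) <= 2 * B * e.
  move=> Ix Iw lg gB lt; apply: (le_trans (nrm_crho_bound H Ix Iw (locb_rho H lg) gB)).
  by apply: ler_wpM2l (ltW lt); rewrite mulr_ge0.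
have -> : 4 * B * e = 2 * B * e + 2 * B * e by ring.
apply: lerD; apply: G => //.
- move=> t dt ta; rewrite nrmM -[leRHS]mulr1; apply: ler_pM; rewrite ?nrm_ge0//.
    by apply: BP; [exact: le_trans yd dt|exact: ltW (lt_trans ta ab)].
  exact: hB1.
- by apply: P1 => //; rewrite le_max lexx.
- move=> t et tb; rewrite nrmM -[leRHS]mulr1; apply: ler_pM; rewrite ?nrm_ge0//.
    apply: BP; last exact: ltW.
    exact: le_trans (ltW ya) (le_trans ae et).
  by rewrite (_ : 1 + -1 * h t = 1 - h t); [exact: hB2|ring].
- by apply: P2 => //; rewrite le_max lexx.
Qed.

(* By [ker], the right-hand side [z ph drho] of the equation vanishes, so that [ph]
   solves the equation for every spectral parameter. *)
Let ph_any (w : C) : is_sol D w ph ph1.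
Proof.
have lw : locb D (fun x => w * ph x) by exact: locbZ.
apply: (tau_intro H (tau_ac sph)); first exact: locb_rho.
move=> x y Ix Iy xy; rewrite (tau_incr sph Ix Iy xy); congr (_ - _).
have [p1 p2] := locb_rho H lp.
move: xy; rewrite le_eqVlt => /orP[/eqP ->|xy].
  by rewrite !crho0// => t; rewrite /= in_itv/= => /andP[yt /(le_lt_trans yt)]; rewrite ltxx.
have c1 := L1loc_co p1 Ix Iy; have c2 := L1loc_co p2 Ix Iy.
by rewrite !crhoZ// ker// !mulr0.
Qed.

(* For a ramp [h] of the Weyl solution [y] at [i], [y + (z - i) (S - z)^-1 h] is a
   [z]-solution in H^1 near [b] and hence 0; steepening the ramp gives [Wr y ph = 0],
   so [ph] is a multiple of [y] and lies in H^1 near [b]. *)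
Lemma no_weyl_solution_false thi thi1 phi phi1 : is_sol D iC thi thi1 ->
  is_sol D iC phi phi1 -> (forall x, I x -> Wr thi thi1 phi phi1 x = (iC : C)^-1) -> False.
Proof.
move=> si sj Wi; have [c Ic] := Iab_nonempty H.
have i0 := @iC_neq0 R.
(* The system at [i] is recombined to the Cauchy data (1, 0) and (0, 1) at [c] required by
   [weyl_disc]; [Wc] is the determinant. *)
pose p x := iC * phi1 c * thi x + (- (iC * thi1 c)) * phi x.
pose p1 x := iC * phi1 c * thi1 x + (- (iC * thi1 c)) * phi1 x.
pose q x := (- (iC * phi c)) * thi x + iC * thi c * phi x.
pose q1 x := (- (iC * phi c)) * thi1 x + iC * thi c * phi1 x.
have Wc : iC * (thi c * phi1 c - thi1 c * phi c) = 1 by rewrite -[X in _ * X]/(Wr thi thi1 phi phi1 c) Wi// divff.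
have sp : is_sol D iC p p1 by exact: sol_comb.
have sq : is_sol D iC q q1 by exact: sol_comb.
have [|||| k hb] := weyl_disc H Ic sp sq.
- by rewrite /p -Wc; ring.
- by rewrite /p1; ring.
- by rewrite /q; ring.
- by rewrite /q1 -Wc; ring.
set y := fun x => p x + k * q x in hb; set y1 := fun x => p1 x + k * q1 x in hb.
have yc : y c = 1.
  by rewrite /y (_ : q c = 0) ?mulr0 ?addr0 /p /q; [rewrite -Wc; ring|ring].
have sy : is_sol D iC y y1.
  apply: (tau_eq H _ _ _ (sol_comb H 1 k sp sq)) => x _; rewrite /y /y1; ring.
have ly1 := tau_locb1 H sy.
have [y0 [Iy0 y0c]] := Iab_left Ic.
have [_ /(_ y0 c Iy0 Ic)[B BP]] := lp.
have B0 : 0 <= B by apply: le_trans (nrm_ge0 _) (BP y0 (lexx _) (ltW y0c)).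
have n1 : nrm (1 : C) = 1 by rewrite /nrm cnorm2_1 sqrtr1.
have Wc0 : Wr y y1 ph ph1 c = 0.
  apply: (@nrm_small_eq0 _ _ (nrm (z - iC) * (2 * B))).
    by apply: mulr_ge0; [exact: nrm_ge0|rewrite mulr_ge0].
  move=> e e0; have [d1 [Id1 d1c] P1] := rho_mass_left H Ic e0.
  set d := Num.max d1 y0.
  have Id : I d by exact: (Iab_max Id1 Iy0).
  have dc : d < c by rewrite gt_max d1c.
  have y0d : y0 <= d by rewrite le_max lexx orbT.
  have [h [h1 [hh h0 hg hB]]] := H1_ramp (tau_ac sy) ly1 hb Id Ic dc.
  have [[f f1] /= S] := Res_ex H rz hh.
  have [[tf [hf _]] _ _] := S.
  have Z : y c + (z - iC) * f c = 0 /\ y1 c + (z - iC) * f1 c = 0.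
    apply: (NB_zero (tau_add H (z - iC) sy tf) _ Ic) => //.
      exact: (H1_near_b_add H (z - iC) hb (H1_near_bW H hf)).
    by move=> x Ix cx; have [-> _] := hg x Ix cx; ring.
  have X := Wr_crho S hh Id Ic (ltW dc) h0.
  have [Z1 Z2] := Z.
  have -> : Wr y y1 ph ph1 c = - ((z - iC) * Wr f f1 ph ph1 c).
    have e1 : y c = - ((z - iC) * f c) by apply/eqP; rewrite -addr_eq0 Z1.
    have e2 : y1 c = - ((z - iC) * f1 c) by apply/eqP; rewrite -addr_eq0 Z2.
    by rewrite /Wr e1 e2; ring.
  rewrite nrmN nrmM -mulrA; apply: ler_wpM2l; first exact: nrm_ge0.
  have lph : locb D (fun t => ph t * h t) by apply: locbM => //; exact: locb_H1 hh.
  rewrite X; have hBB t : d <= t -> t < c -> nrm (ph t * h t) <= B.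
    move=> dt tc; rewrite nrmM -[leRHS]mulr1; apply: ler_pM; rewrite ?nrm_ge0//.
      by apply: BP; [exact: le_trans y0d dt|exact: ltW].
    by rewrite -n1 -yc; exact: hB.
  apply: (le_trans (nrm_crho_bound H Id Ic (locb_rho H lph) hBB)).
  apply: ler_wpM2l; first by rewrite mulr_ge0.
  by apply/ltW/P1 => //; rewrite le_max lexx.
(* By [ph_any], [ph - ph c * y] is a solution with parameter [i]. Its data at [c] vanish because
   [y c = 1] and the Wronskian is 0, so it vanishes everywhere. *)
have phE x : I x -> ph x = ph c * y x /\ ph1 x = ph c * y1 x.
  move=> Ix.
  have su : is_sol D iC (fun x => ph x + (- ph c) * y x) (fun x => ph1 x + (- ph c) * y1 x).
    apply: (tau_eq H _ _ _ (sol_comb H 1 (- ph c) (ph_any iC) sy)) => x' _; ring.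
  have u0 : ph c + (- ph c) * y c = 0 by rewrite yc; ring.
  have u1 : ph1 c + (- ph c) * y1 c = 0.
    by move: Wc0; rewrite /Wr yc => <-; ring.
  have Wc' v v1 : is_sol D iC v v1 -> Wr (fun x => ph x + (- ph c) * y x)
     (fun x => ph1 x + (- ph c) * y1 x) v v1 x = 0.
    move=> sv; have V0 : Wr (fun x => ph x + (- ph c) * y x)
       (fun x => ph1 x + (- ph c) * y1 x) v v1 c = 0 by rewrite /Wr u0 u1; ring.
    have [cx|/ltW xc] := leP c x.
      by rewrite (Wr_const (w := iC) H su sv Ic Ix cx).
    by rewrite -(Wr_const (w := iC) H su sv Ix Ic xc).
  have [e1 e2] := fundamental_reconstruct (fun x => ph x + (- ph c) * y x)
     (fun x => ph1 x + (- ph c) * y1 x) i0 (Wi x Ix).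
  move: e1 e2; rewrite !Wc'// !mul0r subrr mulr0 => e1 e2.
  by split; apply/eqP; rewrite -subr_eq0 -mulNr; apply/eqP.
have phb : H1_near_b D ph ph1.
  apply: (H1_near_b_eq H Ic (H1_near_b_Z H (ph c) hb)).
  - exact: locbZ (tau_locb H sy).
  - exact: locbZ.
  - exact: tau_ac sph.
  - by move=> x Ix _; have [-> ->] := phE x Ix.
have [|_ /eqP] := NB (k := 0) (l := 1); last by rewrite oner_eq0.
apply: (H1_near_b_eq H Ic phb lp lp1).
- exact: tau_ac (sol_comb H 0 1 sth sph).
- by move=> x Ix _; split; ring.
Qed.

End NoWeylSolution.

(** * The Weyl function *)

Section ComplexDerivatives.
Context {R : realType}.
Local Notation C := (Cx R).

Lemma near_Cx (z0 : C) (e : R) : 0 < e -> \forall z \near z0, cnorm2 (z - z0) <= e.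
Proof.
move=> e0; pose d := Num.min 1 e.
have d0 : 0 < d by rewrite lt_min ltr01 e0.
apply/nbhs_ballP; exists (RtoC d); first by rewrite /= -[0]/(RtoC 0) RtoC_lt.
move=> z; rewrite /ball/= nrmE RtoC_lt lt_min nrm_sub -sqr_nrm => /andP[l1 le].
have n0 := nrm_ge0 (z - z0); rewrite expr2.
apply: le_trans (ltW le); rewrite -[leRHS]mulr1; apply: ler_wpM2l => //.
exact: ltW.
Qed.

(** The difference quotient at [z0] is [A] itself, so its limit is [A z0]; no derivative of [A] is
    involved. This is applied to point values of [(S - z)^-1 h]. *)
Lemma derivable_lipschitz (A : C -> C) (z0 : C) (e L : R) : 0 < e -> 0 <= L ->
  (forall z, cnorm2 (z - z0) <= e -> nrm (A z - A z0) <= L * nrm (z - z0)) ->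
  derivable (fun z => (z - z0) * A z) z0 1.
Proof.
move=> e0 L0 hA; apply/cvg_ex; exists (A z0); apply/cvgCxP => e' e'0.
have L1 : 0 < L + 1 by lra.
have d0 : 0 < Num.min e ((e' / (L + 1)) ^+ 2 / 2).
  by rewrite lt_min e0 divr_gt0// exprn_gt0// divr_gt0.
have := near_Cx (0 : C) d0; apply: filterS => h; rewrite subr0 le_min => /andP[he he'] h0 /=.
rewrite subrr mul0r subr0 addrK.
have -> : h *: (1 : C) = h by exact: mulr1.
rewrite -[h^-1 *: _]/(h^-1 * _) mulKf//.
have E : h + z0 - z0 = h by rewrite addrK.
have := hA (h + z0); rewrite E => /(_ he) le; apply: (le_lt_trans le).
have q0 : 0 < e' / (L + 1) by rewrite divr_gt0.
have n0 := nrm_ge0 h.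
have nh : nrm h < e' / (L + 1).
  rewrite ltNge; apply/negP => ge.
  have : (e' / (L + 1)) ^+ 2 <= nrm h ^+ 2 by rewrite !expr2; apply: ler_pM => //; exact: ltW.
  rewrite sqr_nrm; move: (exprn_gt0 2 q0) he'; lra.
rewrite -[ltRHS](divfK (lt0r_neq0 L1)); apply: (@le_lt_trans _ _ (nrm h * (L + 1))).
  by rewrite [leRHS]mulrDr mulr1 mulrC lerDl.
by rewrite ltr_pM2r.
Qed.

Lemma derivable_near_neq0 (F : C -> C) (z0 : C) :
  derivable F z0 1 -> F z0 != 0 -> \forall z \near z0, F z != 0.
Proof.
move=> /derivable1_diffP dF F0; have cF := differentiable_continuous dF.
exact: (cvgr_neq0 _ cF F0).
Qed.

End ComplexDerivatives.

Section WeylFunction.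
Context {R : realType} (D : sldata R).
Hypothesis H : sl_hyp D.
Local Notation C := (Cx R).
Local Notation I := (Iab D).
Variables (va va1 vat vat1 vb vb1 vbt vbt1 : R -> C).
Hypothesis (Ba : bfun_a D va va1 vat vat1) (Bb : bfun_b D vb vb1 vbt vbt1).
Local Notation inS := (inS D va1 vat vb1 vbt).
Local Notation resolvent := (resolvent D va1 vat vb1 vbt).
Local Notation Res := (Res D va1 vat vb1 vbt).
Local Notation S_a := (sol_in_S_near_a D va1 vat).
Local Notation S_b := (sol_in_S_near_b D vb1 vbt).

Lemma S_b_comb z u u1 v v1 (k : C) : S_b z u u1 -> S_b z v v1 ->
  S_b z (fun x => u x + k * v x) (fun x => u1 x + k * v1 x).
Proof.
move=> [h1 _ h3] [g1 _ g3].
have hh := H1_near_b_add H k h1 g1; split => //; first exact: H1_near_b_Z.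
move=> lb; have FF := near_b_proper H.
have e1 x : I x -> u1 x + k * v1 x = u1 x + k * v1 x by [].
have et x : I x -> z * u x + k * (z * v x) = z * (u x + k * v x) by move=> _; ring.
exact: (Vc_ext0 (near_b_Iab H) e1 et (Vc_add0 k (h3 lb) (g3 lb))).
Qed.

Lemma S_b_Z z u u1 (k : C) : S_b z u u1 -> S_b z (fun x => k * u x) (fun x => k * u1 x).
Proof.
move=> h; have := S_b_comb (k - 1) h h.
have E (v : R -> C) : (fun x => v x + (k - 1) * v x) = (fun x => k * v x).
  by apply/funext => x; ring.
by rewrite !E.
Qed.

Section OneParameter.
Variables (z : C) (th th1 ph ph1 : R -> C).
Hypotheses (z_0 : z != 0) (sth : is_sol D z th th1) (sph : is_sol D z ph ph1)
  (W : forall x, I x -> Wr th th1 ph ph1 x = z^-1)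
  (pha : S_a z ph ph1) (ph_nt : exists x, I x /\ ph x != 0) (rz : resolvent z).

Let pnb := ph_not_S_b H sph pha ph_nt rz.

(** The difference of the two solutions is [(m - n) ph], and [ph] is not in [S] near [b]. *)
Lemma weyl_unique (m n : C) : S_b z (fun x => th x + m * ph x) (fun x => th1 x + m * ph1 x) ->
  S_b z (fun x => th x + n * ph x) (fun x => th1 x + n * ph1 x) -> m = n.
Proof.
move=> hm hn; apply/eqP; rewrite -subr_eq0; apply/negPn/negP => mn.
apply: pnb; have := S_b_Z (m - n)^-1 (S_b_comb (-1) hm hn).
have E (p q : R -> C) : (fun x => (m - n)^-1 * (p x + m * q x + -1 * (p x + n * q x))) = q.
  apply/funext => x; have -> : p x + m * q x + -1 * (p x + n * q x) = (m - n) * q x by ring.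
  by rewrite mulKf.
by rewrite !E.
Qed.

Lemma weyl_of_comb (k l : C) : k != 0 ->
  S_b z (fun x => k * th x + l * ph x) (fun x => k * th1 x + l * ph1 x) ->
  S_b z (fun x => th x + l / k * ph x) (fun x => th1 x + l / k * ph1 x).
Proof.
move=> k0 /(S_b_Z k^-1).
have E (p q : R -> C) : (fun x => k^-1 * (k * p x + l * q x)) = (fun x => p x + l / k * q x).
  by apply/funext => x; rewrite mulrDr mulKf//; congr (_ + _); ring.
by rewrite !E.
Qed.

(** The fundamental system at [i], needed for the disc argument, is taken as an argument; it is
    supplied by the given solutions at [z = i]. *)
Lemma weyl_exists thi thi1 phi phi1 : is_sol D iC thi thi1 ->
  is_sol D iC phi phi1 -> (forall x, I x -> Wr thi thi1 phi phi1 x = (iC : C)^-1) ->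
  exists m, S_b z (fun x => th x + m * ph x) (fun x => th1 x + m * ph1 x).
Proof.
move=> si sj Wi; have [lb|nlb] := pselect (lc_b D).
  have [Tv vv0 _] := Bb lb.
  have Tv' := Tnear_b_conj H (Tmax_near_b H Tv).
  have hth := lb _ _ _ z_0 sth; have hph := lb _ _ _ z_0 sph.
  have [lt tv] := Vw_cvg_b H (Tnear_b_sol H sth hth) Tv'.
  have [lp pv] := Vw_cvg_b H (Tnear_b_sol H sph hph) Tv'.
  have FF := near_b_proper H.
  have lp0 : lp != 0.
    apply/eqP => lp0; rewrite lp0 in pv.
    apply: pnb; split; [exact: hph|exact: H1_near_b_Z|by move=> _; exact: pv].
  (* The form [V] against the conjugate of [v_b] is linear in the solution, and this coefficient
     makes its limit at [b] vanish. *)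
  exists (- (lt / lp)).
  have hm := H1_near_b_add H (- (lt / lp)) hth hph.
  split; [exact: hm|exact: H1_near_b_Z|].
  have E0 : lt + - (lt / lp) * lp = 0 by rewrite mulNr divfK// subrr.
  move=> _; apply: (cvgCx_lin0 tv pv E0) => x.
  by rewrite /Vc /Vw; ring.
(* Outside the l.c. case, lying in [S] near [b] means lying in H^1 near [b]. So any nontrivial
   combination in H^1 near [b] would give a coefficient [l / k], and [k = 0] is excluded as it would
   put [ph] itself into [S] near [b]. *)
apply: contrapT => nm; apply: (@no_weyl_solution_false _ _ H va va1 vat vat1 vb1 vbt
   Ba z th th1 ph ph1 z_0 sth sph W pha rz _ thi thi1 phi phi1 si sj Wi).
move=> k l hkl; apply: contrapT => nkl; apply: nm.
have Skl : S_b z (fun x => k * th x + l * ph x) (fun x => k * th1 x + l * ph1 x).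
  by split => //; exact: H1_near_b_Z.
have [k0|k0] := eqVneq k 0; last by exists (l / k); exact: weyl_of_comb.
have l0 : l != 0 by apply/eqP => l0; apply: nkl.
exfalso; apply: pnb; have := S_b_Z l^-1 Skl.
have E (p q : R -> C) : (fun x => l^-1 * (k * p x + l * q x)) = q.
  by apply/funext => x; rewrite k0 mul0r add0r mulKf.
by rewrite !E.
Qed.

End OneParameter.

End WeylFunction.

(** * Invariance of S under conjugation *)

Section Reality.
Context {R : realType} (D : sldata R).
Hypothesis H : sl_hyp D.
Local Notation C := (Cx R).
Local Notation I := (Iab D).
Variables (va va1 vat vat1 vb vb1 vbt vbt1 : R -> C).
Hypothesis (Ba : bfun_a D va va1 vat vat1) (Bb : bfun_b D vb vb1 vbt vbt1).
Local Notation inS := (inS D va1 vat vb1 vbt).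
Local Notation resolvent := (resolvent D va1 vat vb1 vbt).
Local Notation S_b := (sol_in_S_near_b D vb1 vbt).
Local Notation cj f := (fun x => cconj (f x)).

Lemma boundary_conj_a (f f1 ft ft1 : R -> C) : lc_a D -> Tnear_a D f f1 ft ft1 ->
  Vc f1 ft va1 vat @ near_a D --> (0 : C) ->
  Vc (cj f1) (cj ft) va1 vat @ near_a D --> (0 : C).
Proof.
move=> la Tf f0; have [Tv vv0 [g [g1 [gt [gt1 [Tg ng]]]]]] := Ba la.
have FF := near_a_proper H.
have Tg' := Tmax_near_a H Tg; have Tv' := Tmax_near_a H Tv.
have [l gv] := Vw_cvg_a H Tg' (Tnear_a_conj H Tv').
have l0 : l != 0 by apply/eqP => l0; rewrite l0 in gv; exact: ng gv.
have [x fg] := Vw_cvg_a H Tf Tg'.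
have [w gv'] := Vw_cvg_a H Tg' Tv'.
exact: (boundary_conj FF vv0 l0 gv f0 fg gv').
Qed.

Lemma boundary_conj_b (f f1 ft ft1 : R -> C) : lc_b D -> Tnear_b D f f1 ft ft1 ->
  Vc f1 ft vb1 vbt @ near_b D --> (0 : C) ->
  Vc (cj f1) (cj ft) vb1 vbt @ near_b D --> (0 : C).
Proof.
move=> lb Tf f0; have [Tv vv0 [g [g1 [gt [gt1 [Tg ng]]]]]] := Bb lb.
have FF := near_b_proper H.
have Tg' := Tmax_near_b H Tg; have Tv' := Tmax_near_b H Tv.
have [l gv] := Vw_cvg_b H Tg' (Tnear_b_conj H Tv').
have l0 : l != 0 by apply/eqP => l0; rewrite l0 in gv; exact: ng gv.
have [x fg] := Vw_cvg_b H Tf Tg'.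
have [w gv'] := Vw_cvg_b H Tg' Tv'.
exact: (boundary_conj FF vv0 l0 gv f0 fg gv').
Qed.

Lemma inS_conj (f f1 ft ft1 : R -> C) : inS f f1 ft ft1 -> inS (cj f) (cj f1) (cj ft) (cj ft1).
Proof.
move=> [Tf fa fb]; split; first exact: Tmax_conj.
- by move=> la; exact: (boundary_conj_a la (Tmax_near_a H Tf) (fa la)).
- by move=> lb; exact: (boundary_conj_b lb (Tmax_near_b H Tf) (fb lb)).
Qed.

Lemma H1norm2_conj (f f1 g g1 : R -> C) : (forall x, g x = cconj (f x)) ->
  (forall x, g1 x = cconj (f1 x)) -> H1norm2 D g g1 = H1norm2 D f f1.
Proof.
move=> e e1; rewrite /H1norm2; congr (_ + _); apply: Rint_eq => t _.
  by rewrite e cnorm2_conj.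
by rewrite e1 cnorm2_conj.
Qed.

Lemma resolvent_conj z : resolvent z -> resolvent (cconj z).
Proof.
move=> [ex inj [K KP]]; split.
- move=> h h1 hh; have [f [f1 [ft [ft1 [S e]]]]] := ex _ _ (H1_conj H hh).
  exists (cj f), (cj f1), (cj ft), (cj ft1); split; first exact: inS_conj.
  by move=> x Ix; rewrite -cconjM -cconjB e// cconjK.
- move=> f f1 ft ft1 S e x Ix.
  have : cconj (f x) = 0.
    by apply: (inj _ _ _ _ (inS_conj S)) => // y Iy; rewrite e// cconjM cconjK.
  by move/eqP; rewrite cconj_eq0 => /eqP.
- exists K => f f1 ft ft1 S; have := KP _ _ _ _ (inS_conj S).
  rewrite (H1norm2_conj (f := f) (f1 := f1))//.
  rewrite (H1norm2_conj (f := fun x => ft x - cconj z * f x)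
    (f1 := fun x => ft1 x - cconj z * f1 x) (g := fun x => cconj (ft x) - z * cconj (f x)))//.
  - by move=> x; rewrite cconjB cconjM cconjK.
  - by move=> x; rewrite cconjB cconjM cconjK.
Qed.

Lemma S_b_conj z (u u1 : R -> C) : is_sol D z u u1 -> S_b z u u1 ->
  S_b (cconj z) (cj u) (cj u1).
Proof.
move=> su [b1 b2 b3]; have hb := H1_near_b_conj H b1.
split; [exact: hb|exact: H1_near_b_Z|] => lb.
have := boundary_conj_b lb (Tnear_b_sol H su b1) (b3 lb).
rewrite [X in Vc _ X](_ : _ = fun x => cconj z * cconj (u x)); first by [].
by apply/funext => x; rewrite cconjM.
Qed.

Lemma S_b_eq z (u u1 v v1 : R -> C) : is_sol D z u u1 -> is_sol D z v v1 ->
  (forall x, I x -> u x = v x /\ u1 x = v1 x) -> S_b z u u1 -> S_b z v v1.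
Proof.
move=> su sv e [b1 _ b3]; have [c Ic] := Iab_nonempty H.
have hv : H1_near_b D v v1.
  apply: (H1_near_b_eq H Ic b1 (tau_locb H su) (tau_locb1 H su) (tau_ac sv)).
  by move=> x Ix _; exact: e.
split; [exact: hv|exact: H1_near_b_Z|] => lb.
have FF := near_b_proper H.
have e1 x : I x -> u1 x = v1 x by move=> /e[].
have et x : I x -> z * u x = z * v x by move=> /e[-> _].
exact: (Vc_ext0 (near_b_Iab H) e1 et (b3 lb)).
Qed.

End Reality.

(** * Differentiability and reality of M *)

Section Analyticity.
Context {R : realType} (D : sldata R).
Hypothesis H : sl_hyp D.
Local Notation C := (Cx R).
Local Notation I := (Iab D).
Variables (va va1 vat vat1 vb vb1 vbt vbt1 : R -> C).
Hypothesis (Ba : bfun_a D va va1 vat vat1) (Bb : bfun_b D vb vb1 vbt vbt1).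
Local Notation resolvent := (resolvent D va1 vat vb1 vbt).
Local Notation Res := (Res D va1 vat vb1 vbt).
Local Notation S_a := (sol_in_S_near_a D va1 vat).
Local Notation S_b := (sol_in_S_near_b D vb1 vbt).
Variables (phi phi1 theta theta1 : C -> R -> C) (M : C -> C).
Hypotheses
  (sphi : forall z, z != 0 -> is_sol D z (phi z) (phi1 z))
  (phi_nt : forall z, z != 0 -> exists x, I x /\ phi z x != 0)
  (phi_a : forall z, z != 0 -> S_a z (phi z) (phi1 z))
  (stheta : forall z, z != 0 -> is_sol D z (theta z) (theta1 z))
  (W : forall z x, z != 0 -> I x -> Wr (theta z) (theta1 z) (phi z) (phi1 z) x = z^-1)
  (M_b : forall z, resolvent z -> z != 0 ->
     S_b z (fun x => theta z x + M z * phi z x) (fun x => theta1 z x + M z * phi1 z x)).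

Lemma psi_sol z m : z != 0 -> is_sol D z (fun x => theta z x + m * phi z x)
  (fun x => theta1 z x + m * phi1 z x).
Proof.
move=> z0; apply: (tau_eq H _ _ _ (tau_add H m (stheta z0) (sphi z0))) => x _ //.
by ring.
Qed.

(** To the right of [c] one has [u = k theta + l phi], and uniqueness of the Weyl coefficient forces
    [M z = l / k]. The denominator of the quotient is [k / z]. *)
Lemma M_eq_quotient z u u1 ut c : z != 0 -> resolvent z -> is_tau D u u1 ut ->
  H1_near_b D u u1 -> (lc_b D -> Vc u1 ut vb1 vbt @ near_b D --> (0 : C)) ->
  I c -> (forall x, I x -> c <= x -> ut x = z * u x) ->
  Wr u u1 (phi z) (phi1 z) c != 0 ->
  M z = - Wr u u1 (theta z) (theta1 z) c / Wr u u1 (phi z) (phi1 z) c.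
Proof.
move=> z0 rz tu hu bu Ic e De0.
have Wz x : I x -> Wr (theta z) (theta1 z) (phi z) (phi1 z) x = z^-1 by exact: W.
have [k [l [kE lE uE]]] := local_sol_b H z0 (stheta z0) (sphi z0) Wz tu Ic e.
have k0 : k != 0 by rewrite kE mulf_neq0.
have sc := sol_comb H k l (stheta z0) (sphi z0).
have hc : H1_near_b D (fun x => k * theta z x + l * phi z x)
    (fun x => k * theta1 z x + l * phi1 z x).
  exact: (H1_near_b_eq H Ic hu (tau_locb H tu) (tau_locb1 H tu) (tau_ac sc) uE).
have Sc : S_b z (fun x => k * theta z x + l * phi z x)
    (fun x => k * theta1 z x + l * phi1 z x).
  split; [exact: hc|exact: H1_near_b_Z|] => lb.
  have FF := near_b_proper H.
  move: (bu lb) => /cvgCxP bu0; apply/cvgCxP => eps eps0.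
  have E : \forall x \near near_b D, Vc u1 ut vb1 vbt x =
      Vc (fun x => k * theta1 z x + l * phi1 z x)
        (fun x => z * (k * theta z x + l * phi z x)) vb1 vbt x.
    apply/(near_bP H); exists c; split; first exact: Ic.
    move=> x Ix cx; have [e1 e2] := uE x Ix (ltW cx).
    by rewrite /Vc /Vw (e x Ix (ltW cx)) e1 e2.
  by move: (bu0 eps eps0) E; apply: filterS2 => x lt <-.
have := weyl_of_comb H k0 Sc.
move=> /(weyl_unique H (sphi z0) (phi_a z0) (phi_nt z0) rz (M_b rz z0)) ->.
rewrite kE lE; field.
by rewrite De0 z0.
Qed.

Lemma M_derivable z0 c : resolvent z0 -> z0 != 0 -> I c ->
  derivable (fun z => phi z c) z0 1 -> derivable (fun z => phi1 z c) z0 1 ->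
  derivable (fun z => theta z c) z0 1 -> derivable (fun z => theta1 z c) z0 1 ->
  derivable M z0 1.
Proof.
move=> rz0 z00 Ic dp dp1 dt dt1.
have [d [Id dc]] := Iab_left Ic.
pose p x := theta z0 x + M z0 * phi z0 x.
pose p1 x := theta1 z0 x + M z0 * phi1 z0 x.
have sp : is_sol D z0 p p1 by exact: psi_sol.
have [pb1 _ pb3] : S_b z0 p p1 by exact: M_b.
have [h [h1 [hh _ hp _]]] := H1_ramp H (tau_ac sp) (tau_locb1 H sp) pb1 Id Ic dc.
have [e1 [K1 [e10 _ ro]]] := resolvent_open H Ba Bb rz0.
(* A choice of [(S - z)^-1 h] for [z] near [z0], with a default value elsewhere that a derivative at
   [z0] does not see. *)
have Gex z : exists q : (R -> C) * (R -> C), cnorm2 (z - z0) <= e1 -> Res z h h1 q.1 q.2.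
  have [le|nle] := boolP (cnorm2 (z - z0) <= e1); last by exists (fun=> 0, fun=> 0).
  by have [q qP] := Res_ex H (ro z le).1 hh; exists q.
have [G GP] := choice Gex.
have z00e : cnorm2 (z0 - z0) <= e1 by rewrite subrr cnorm20 ltW.
have [e2 [L [e20 L0 lip]]] := Res_continuous H Ba Bb rz0 hh (GP _ z00e) Ic.
pose e := Num.min e1 e2.
have e0 : 0 < e by rewrite lt_min e10.
pose U z := p c + (z - z0) * (G z).1 c.
pose U1 z := p1 c + (z - z0) * (G z).2 c.
have lipG z : cnorm2 (z - z0) <= e ->
    nrm ((G z).1 c - (G z0).1 c) <= L * nrm (z - z0) /\
    nrm ((G z).2 c - (G z0).2 c) <= L * nrm (z - z0).
  by rewrite le_min => /andP[l1 l2]; exact: (lip z _ _ l2 (GP z l1)).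
have dU : derivable U z0 1.
  have : derivable (cst (p c) + (fun z => (z - z0) * (G z).1 c)) z0 1.
    apply: derivableD; first exact: derivable_cst.
    by apply: (derivable_lipschitz e0 L0) => z /lipG[].
  by [].
have dU1 : derivable U1 z0 1.
  have : derivable (cst (p1 c) + (fun z => (z - z0) * (G z).2 c)) z0 1.
    apply: derivableD; first exact: derivable_cst.
    by apply: (derivable_lipschitz e0 L0) => z /lipG[].
  by [].
pose Wq (v v1 : C -> C) z := U z * v1 z - U1 z * v z.
have dW v v1 : derivable v z0 1 -> derivable v1 z0 1 -> derivable (Wq v v1) z0 1.
  by move=> dv dv1; exact: (derivableB (derivableM dU dv1) (derivableM dU1 dv)).
pose De := Wq (fun z => phi z c) (fun z => phi1 z c).
pose Nu := Wq (fun z => theta z c) (fun z => theta1 z c).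
have dDe : derivable De z0 1 := dW _ _ dp dp1.
have dNu : derivable Nu z0 1 := dW _ _ dt dt1.
(* At [z0] the perturbation vanishes, so the denominator is the Wronskian of [theta + M phi] with
   [phi], that is [z0^-1]. *)
have De0 : De z0 != 0.
  rewrite /De /Wq /U /U1 subrr !mul0r !addr0.
  have -> : p c * phi1 z0 c - p1 c * phi z0 c =
    Wr (theta z0) (theta1 z0) (phi z0) (phi1 z0) c by rewrite /Wr /p /p1; ring.
  by rewrite W// invr_neq0.
have nDe := derivable_near_neq0 dDe De0.
have n0 : \forall z \near z0, z != 0.
  have q0 : 0 < cnorm2 z0 / 2.
    by rewrite divr_gt0// lt_def cnorm2_ge0 cnorm2_eq0 z00.
  have := near_Cx z0 q0; apply: filterS => z; apply: contraTneq => ->.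
  by rewrite sub0r cnorm2N -ltNge; lra.
have ME : \forall z \near z0, - Nu z * (De z)^-1 = M z.
  move: (near_Cx z0 e0) nDe n0; apply: filterS3 => z le Dz zn0; have le1 : cnorm2 (z - z0) <= e1.
    by move: le; rewrite le_min => /andP[].
  have [[tf [hf _]] _ fb] := GP z le1; have [rz _] := ro z le1.
  have tu := tau_add H (z - z0) sp tf.
  have hu := H1_near_b_add H (z - z0) pb1 (H1_near_bW H hf).
  apply/esym; apply: (M_eq_quotient zn0 rz tu hu _ Ic _ Dz).
    by move=> lb; have FF := near_b_proper H; exact: (Vc_add0 (z - z0) (pb3 lb) (fb lb)).
  by move=> x Ix cx; have [-> _] := hp x Ix cx; ring.
apply: (near_eq_derivable ME).
exact: (derivableM (derivableN dNu) (derivableV De0 dDe)).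
Qed.

(** Conjugating the Weyl solution at [cconj z] gives [theta z + cconj (M (cconj z)) * phi z], a
    solution with parameter [z] in [S] near [b]; uniqueness identifies the coefficient. *)
Lemma M_real z : resolvent z -> z != 0 ->
  (forall x, I x -> phi (cconj z) x = cconj (phi z x) /\
     phi1 (cconj z) x = cconj (phi1 z x)) ->
  (forall x, I x -> theta (cconj z) x = cconj (theta z x) /\
     theta1 (cconj z) x = cconj (theta1 z x)) ->
  M z = cconj (M (cconj z)).
Proof.
move=> rz z0 ep et; have z0' : cconj z != 0 by rewrite cconj_eq0.
have rz' := resolvent_conj H Ba Bb rz.
have := S_b_conj H Bb (psi_sol (M (cconj z)) z0') (M_b rz' z0').
rewrite cconjK => Sc.
have sc : is_sol D z (fun x => cconj (theta (cconj z) x + M (cconj z) * phi (cconj z) x))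
    (fun x => cconj (theta1 (cconj z) x + M (cconj z) * phi1 (cconj z) x)).
  apply: (tau_eq H _ _ _ (tau_conj H (psi_sol (M (cconj z)) z0'))) => x _ //.
  by rewrite cconjM cconjK.
apply: (weyl_unique H (sphi z0) (phi_a z0) (phi_nt z0) rz (M_b rz z0)).
apply: (S_b_eq H sc (psi_sol _ z0) _ Sc) => x Ix.
have [-> ->] := ep x Ix; have [-> ->] := et x Ix.
by split; rewrite cconjD cconjM !cconjK.
Qed.

End Analyticity.

Theorem theorem4p3 (R : realType) (D : sldata R)
  (va va1 vat vat1 vb vb1 vbt vbt1 : R -> Cx R)
  (phi phi1 theta theta1 : Cx R -> R -> Cx R) :
  sl_hyp D ->
  bfun_a D va va1 vat vat1 ->
  bfun_b D vb vb1 vbt vbt1 ->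
  (* phi_z : non-trivial solutions lying in S near a *)
  (forall z : Cx R, z != 0 ->
     [/\ is_sol D z (phi z) (phi1 z),
         (exists x, Iab D x /\ phi z x != 0) &
         sol_in_S_near_a D va1 vat z (phi z) (phi1 z)]) ->
  (forall c, Iab D c ->
     real_analytic_pole0 (fun z => phi z c) /\
     real_analytic_pole0 (fun z => phi1 z c)) ->
  (* theta_z : solutions with V(theta_z, phi_z) = 1 *)
  (forall z : Cx R, z != 0 ->
     is_sol D z (theta z) (theta1 z) /\
     forall x, Iab D x ->
       Vw (theta1 z) (fun t => z * theta z t)
          (phi1 z) (fun t => z * phi z t) x = 1) ->
  (forall c, Iab D c ->
     real_analytic_pole0 (fun z => theta z c) /\
     real_analytic_pole0 (fun z => theta1 z c)) ->
  let psi z m := fun x => theta z x + m * phi z x in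
  let psi1 z m := fun x => theta1 z x + m * phi1 z x in
  (* M(z) is uniquely determined ... *)
  (forall z : Cx R, resolvent D va1 vat vb1 vbt z -> z != 0 ->
     exists! m : Cx R, sol_in_S_near_b D vb1 vbt z (psi z m) (psi1 z m)) /\
  (* ... and the resulting function M is analytic and real *)
  (forall M : Cx R -> Cx R,
     (forall z : Cx R, resolvent D va1 vat vb1 vbt z -> z != 0 ->
        sol_in_S_near_b D vb1 vbt z (psi z (M z)) (psi1 z (M z))) ->
     forall z : Cx R, resolvent D va1 vat vb1 vbt z -> z != 0 ->
       derivable M z 1 /\ M z = cconj (M (cconj z))).
Proof.
move=> H Ba Bb hphi aphi htheta atheta psi psi1.
have sphi z : z != 0 -> is_sol D z (phi z) (phi1 z) by move=> /hphi[].
have phi_nt z : z != 0 -> exists x, Iab D x /\ phi z x != 0 by move=> /hphi[].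
have phi_a z : z != 0 -> sol_in_S_near_a D va1 vat z (phi z) (phi1 z).
  by move=> /hphi[].
have stheta z : z != 0 -> is_sol D z (theta z) (theta1 z) by move=> /htheta[].
have W z x : z != 0 -> Iab D x -> Wr (theta z) (theta1 z) (phi z) (phi1 z) x = z^-1.
  move=> z0 Ix; have [_ /(_ x Ix)] := htheta z z0.
  rewrite Vw_Wr => e; apply: (mulfI z0); rewrite e divff//.
have i0 := @iC_neq0 R.
split=> [z rz z0|M hM z rz z0].
  have [m hm] := weyl_exists H Ba Bb z0 (stheta z z0) (sphi z z0) (fun x => W z x z0)
    (phi_a z z0) (phi_nt z z0) rz (stheta _ i0) (sphi _ i0) (fun x => W _ x i0).
  exists m; split => // n hn.
  exact: (weyl_unique H (sphi z z0) (phi_a z z0) (phi_nt z z0) rz hm hn).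
have [c Ic] := Iab_nonempty H.
split.
  have [[dp _ _] [dp1 _ _]] := aphi c Ic; have [[dt _ _] [dt1 _ _]] := atheta c Ic.
  exact: (M_derivable H Ba Bb sphi phi_nt phi_a stheta W hM rz z0 Ic
    (dp z z0) (dp1 z z0) (dt z z0) (dt1 z z0)).
apply: (M_real H Ba Bb sphi phi_nt phi_a stheta hM rz z0) => x Ix.
  by have [[_ r _] [_ r1 _]] := aphi x Ix; rewrite r ?r1.
by have [[_ r _] [_ r1 _]] := atheta x Ix; rewrite r ?r1.
Qed.
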